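(* Let $(\Gamma,\mu,v_0)$ be a vertex-weighted pointed graph (satisfying the standing assumptions in the context), with free loop algebra $\mathcal S_0=\mathcal S_0(\Gamma,\mu)$, polynomial subalgebra $A\subset\mathcal S_0$ and Dirac number operator $N$. For $a\in A$ set $L(a):=\|[N,a]\|$. Then $L$ is a Lip-norm on $A$, so that $(\mathcal S_0,A,L)$ is a compact quantum metric space; that is, $L$ is a seminorm on $A$ with $L(a)=0$ if and only if $a\in\mathbb C1_A$, and the topology on the state space $S(\mathcal S_0)$ induced by $$\rho_L(\phi,\psi)=\sup\{|\phi(x)-\psi(x)| : x\in A,\ L(x)\le 1\}$$ is the weak-$*$ topology.
   Context: Graphs. $\Gamma=(V,E)$ is a countable, connected, locally finite, undirected graph (loops and multiple edges allowed) with a weighting $\mu:V\to(0,\infty)$. The directed graph $\vec\Gamma=(V,\vec E,s,t)$ has, for each $e\in E$ with distinct endpoints $\alpha\ne\beta$, two edges $\epsilon,\epsilon^{\rm op}$ with $s(\epsilon)=t(\epsilon^{\rm op})=\alpha$, $t(\epsilon)=s(\epsilon^{\rm op})=\beta$, and for each loop $e\in E$ at a vertex $\gamma$ a single edge $\epsilon=\epsilon^{\rm op}$ with $s(\epsilon)=t(\epsilon)=\gamma$. A base point $v_0\in V$ is fixed. Standing assumptions: $\mu(v_0)=1$ and $\mu(v_0)\le\mu(v)$ for all $v\in V$; and $\mu(v)<\sum_{\epsilon\in\vec E,\,s(\epsilon)=v}\mu(t(\epsilon))$ for all $v\in V$. Free graph algebra. $C_0(V)$ is generated by the indicator functions $p_v$,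 $v\in V$. $\mathcal X$ is the Hilbert $C_0(V)$-bimodule completing the finite linear combinations of edges in $\vec E$, with $\langle\epsilon,\epsilon'\rangle=\delta_{\epsilon,\epsilon'}p_{t(\epsilon)}$, $p_\alpha\epsilon=\delta_{\alpha,s(\epsilon)}\epsilon$, $\epsilon p_\beta=\delta_{\beta,t(\epsilon)}\epsilon$. On the Fock space $\mathcal F(\vec\Gamma)=C_0(V)\oplus\bigoplus_{n\ge1}\mathcal X^{\otimes_{C_0(V)}n}$ (whose $n$-th summand is spanned by $\epsilon_1\otimes\cdots\otimes\epsilon_n$ with $\epsilon_1\cdots\epsilon_n$ a path) the creation operator is $\ell(\epsilon)(\epsilon_1\otimes\cdots\otimes\epsilon_n)=\epsilon\otimes\epsilon_1\otimes\cdots\otimes\epsilon_n$, $\ell(\epsilon)p_v=\delta_{v,t(\epsilon)}\epsilon$, with adjoint $\ell(\epsilon)^*(\epsilon_1\otimes\cdots\otimes\epsilon_n)=\langle\epsilon,\epsilon_1\rangle\epsilon_2\otimes\cdots\otimes\epsilon_n$, $\ell(\epsilon)^*p_v=0$. Put $a_\epsilon=(\mu(s(\epsilon))/\mu(t(\epsilon)))^{1/4}$ and $X_\epsilon=a_\epsilon\ell(\epsilon)+a_\epsilon^{-1}\ell(\epsilon^{\rm op})^*$. The free graph algebra $\mathcal S(\Gamma,\mu)$ is the $\mathrm C^*$-algebra generated by $C_0(V)$ and all $X_\epsilon$, $\epsilon\in\vec E$. It carries a faithful semifinite trace $\mathrm{Tr}=\mu\circ\mathbb E$, where $\mathbb E(x)=\sum_v\langle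 p_v, xp_v\rangle_{C_0(V)}$; $\mathrm{Tr}(p_v)=\mu(v)$. Free loop algebra. $\mathcal S_0=\mathcal S_0(\Gamma,\mu):=p_{v_0}\mathcal S(\Gamma,\mu)p_{v_0}$, with faithful tracial state $\mathrm{tr}_0=\mathrm{Tr}|_{\mathcal S_0}$ and GNS space $\mathcal H_0=L^2(\mathcal S_0,\mathrm{tr}_0)$. For a path $\sigma=\epsilon_1\cdots\epsilon_n$ in $\vec\Gamma$ put $|\sigma|=n$, $\sigma^{\rm op}=\epsilon_n^{\rm op}\cdots\epsilon_1^{\rm op}$, $\ell(\sigma)=\ell(\epsilon_1)\cdots\ell(\epsilon_n)$, $a_\sigma=(\mu(s(\epsilon_1))/\mu(t(\epsilon_n)))^{1/4}$; for a path of length $0$ at $v$, $\ell(v)=p_v$ and $a_v=1$. The Wick word is $Y_\sigma=\sum_{\sigma=\rho\tau}a_\rho a_\tau^{-1}\ell(\rho)\ell(\tau^{\rm op})^*$ (sum over all factorizations, $\rho$ or $\tau$ possibly of length $0$); it lies in $\mathcal S(\Gamma,\mu)$. Let $\Pi_0$ be the set of loops in $\vec\Gamma$ based at $v_0$ (including length $0$). The elements $Y_\sigma$, $\sigma\in\Pi_0$, lie in $\mathcal S_0$ and form an orthonormal basis of $\mathcal H_0$. $A=A(\Gamma,\mu)$ is the unital $*$-algebra generated by (equivalently, the linear span of) $\{Y_\sigma:\sigma\in\Pi_0\}$, a dense unital $*$-subalgebra of $\mathcal S_0$. The Dirac number operator $N$ is the closure of the operator on $\mathcal H_0$ with $N Y_\sigma=|\sigma|Y_\sigma$,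 $\sigma\in\Pi_0$. For $a\in A$ acting on $\mathcal H_0$ by left multiplication, $[N,a]$ is densely defined and extends to a bounded operator on $\mathcal H_0$, and $\|[N,a]\|$ is its operator norm. *)

(* Defs.v *)
From HB Require Import structures.
From mathcomp Require Import all_boot all_order all_algebra.
From mathcomp Require Import complex ring.
From mathcomp Require Import all_classical all_reals all_analysis.

Set Implicit Arguments.
Unset Strict Implicit.
Unset Printing Implicit Defensive.
Import Order.TTheory GRing.Theory Num.Theory.
Import numFieldNormedType.Exports.
Local Open Scope classical_set_scope.
Local Open Scope complex_scope.
Local Open Scope ring_scope.

Definition cabs (R : realType) (z : R[i]) : R := ComplexField.Normc.normc z.

(* Sum of an absolutely summable family. *)
Definition rsum (R : realType) (T : choiceType) (D : set T) (f : T -> R) : R :=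
  fine (\esum_(i in D) (Num.max (f i) 0)%:E)
  - fine (\esum_(i in D) (Num.max (- f i) 0)%:E).

Definition csum (R : realType) (T : choiceType) (D : set T) (f : T -> R[i]) :
    R[i] :=
  rsum D (fun i => complex.Re (f i)) +i* rsum D (fun i => complex.Im (f i)).

Lemma rsum_supp1 (R : realType) (T : choiceType) (D : set T) (f : T -> R) i :
  D i -> (forall j, D j -> j <> i -> f j = 0) -> rsum D f = f i.
Proof.
move=> Di f0.
have h (g : T -> \bar R) : (forall j, 0 <= g j)%E ->
    (forall j, D j -> j <> i -> g j = 0%E) -> (\esum_(j in D) g j = g i)%E.
  move=> g0 gi; rewrite (esumID [set i]); last by move=> *; exact: g0.
  rewrite [X in (_ + X)%E]esum1 ?adde0; last by move=> j [/gi].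
  rewrite (_ : D `&` [set i] = [set i]) ?esum_set1 //.
  by apply/seteqP; split=> [j []|j ->].
rewrite /rsum !h /=.
- case: (leP 0 (f i)) => fi; case: (leP 0 (- f i)) => fi'; first 1 last.
  + by rewrite subr0.
  + by rewrite sub0r opprK.
  + by move: fi'; rewrite oppr_lt0 ltNge ltW.
  have -> : f i = 0 by apply/eqP; rewrite eq_le fi -oppr_ge0 fi'.
  by rewrite oppr0 subr0.
- by move=> j; rewrite lee_fin le_max lexx orbT.
- by move=> j Dj ji; rewrite f0 // oppr0 maxxx.
- by move=> j; rewrite lee_fin le_max lexx orbT.
- by move=> j Dj ji; rewrite f0 // maxxx.
Qed.

Lemma csum_supp1 (R : realType) (T : choiceType) (D : set T) (f : T -> R[i]) i :
  D i -> (forall j, D j -> j <> i -> f j = 0) -> csum D f = f i.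
Proof.
move=> Di f0; rewrite /csum !(@rsum_supp1 _ _ _ _ i) //; first by case: (f i).
all: by move=> j Dj ji; rewrite f0.
Qed.

Definition lspan (K : pzRingType) (W : lmodType K) (P : set W) : set W :=
  [set x | exists (n : nat) (c : 'I_n -> K) (p : 'I_n -> W),
     (forall i, P (p i)) /\ x = \sum_(i < n) c i *: p i].

(* Loops and multiple edges are allowed. The order of the two endpoints in
   [ends e] carries no meaning: it only serves to name the two orientations of
   a non-loop. *)
Record ugraph := UGraph {
  vert : countType;
  uedge : countType;
  ends : uedge -> vert * vert }.

Definition is_loop (G : ugraph) (e : uedge G) : bool :=
  (ends e).1 == (ends e).2.

(* The edges of the directed graph: [(e, false)] runs from [(ends e).1] to
   [(ends e).2], and [(e, true)] runs backwards. A loop has only [(e, false)]. *)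
Record dedge (G : ugraph) := DEdge {
  dval : uedge G * bool;
  _ : ~~ (dval.2 && is_loop dval.1) }.

HB.instance Definition _ (G : ugraph) := [isSub for @dval G].
HB.instance Definition _ (G : ugraph) := [Countable of dedge G by <:].

Section Graph.
Variable G : ugraph.
Implicit Types (v w : vert G) (e : dedge G) (s : seq (dedge G)).

Definition src e : vert G :=
  if (dval e).2 then (ends (dval e).1).2 else (ends (dval e).1).1.
Definition tgt e : vert G :=
  if (dval e).2 then (ends (dval e).1).1 else (ends (dval e).1).2.

(* [insubd] returns [e] itself when the reversed pair is not a directed edge,
   that is, when the underlying edge is a loop. *)
Definition dop e : dedge G := insubd e ((dval e).1, ~~ (dval e).2).

Lemma src_dop e : src (dop e) = tgt e.
Proof.
rewrite /dop /insubd; case: insubP => [u _ ude|] /=.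
  by rewrite /src /tgt -[dval u]/(val u) ude /=; case: (dval e).2.
rewrite negbK => /andP[/negPf e2 /eqP el].
by rewrite /src /tgt e2 el.
Qed.

Lemma tgt_dop e : tgt (dop e) = src e.
Proof.
rewrite /dop /insubd; case: insubP => [u _ ude|] /=.
  by rewrite /src /tgt -[dval u]/(val u) ude /=; case: (dval e).2.
rewrite negbK => /andP[/negPf e2 /eqP el].
by rewrite /src /tgt e2 el.
Qed.

Fixpoint walk v s : bool :=
  if s is e :: s' then (src e == v) && walk (tgt e) s' else true.

Definition endpt v s : vert G := last v (map tgt s).

Definition connected_graph := forall v w, exists s, walk v s /\ endpt v s = w.

Definition locally_finite := forall v,
  finite_set [set e : uedge G | (ends e).1 = v \/ (ends e).2 = v].

(* A directed path is its starting vertex together with its list of edges, so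
   that there is one path of length 0 at each vertex. *)
Record gpath := GPath {
  pval : vert G * seq (dedge G);
  _ : walk pval.1 pval.2 }.

HB.instance Definition _ := [isSub for pval].
HB.instance Definition _ := [Countable of gpath by <:].

Definition psrc (p : gpath) := (pval p).1.
Definition ptgt (p : gpath) := endpt (pval p).1 (pval p).2.
Definition plen (p : gpath) := size (pval p).2.

Definition pnil v : gpath := GPath (pval := (v, [::])) isT.

Definition pcons e (p : gpath) : option gpath :=
  if psrc p == tgt e then insub (src e, e :: (pval p).2) else None.

Definition puncons e (p : gpath) : option gpath :=
  if (pval p).2 is e' :: s then
    if e' == e then insub (tgt e, s) else None
  else None.

Definition loops_at v : set gpath := [set p | psrc p = v /\ ptgt p = v].

Lemma pconsP e p q : pcons e p = Some q -> pval q = (src e, e :: (pval p).2) /\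
  psrc p = tgt e.
Proof.
rewrite /pcons; case: eqP => // pe; case: insubP => // u _ uq [<-].
by split.
Qed.

Lemma punconsP e p q : puncons e p = Some q ->
  pval p = (src e, e :: (pval q).2) /\ psrc q = tgt e.
Proof.
case: p => -[v [|e' s]] //= ps; rewrite /puncons /=; case: eqP => // ee.
case: insubP => // u _ uq [<-]; rewrite /psrc -[pval u]/(val u) uq /=.
by subst e'; case/andP: ps => /eqP-> _.
Qed.

End Graph.

Section FockSpace.
Variables (R : realType) (G : ugraph).
Local Notation C := (R[i]^o).
Implicit Types (v : vert G) (e : dedge G) (f g : gpath G -> C).

(* The value at [v] of the C_0(V)-valued inner product <f, f>. *)
Definition sqnorm_at v f : \bar R :=
  \esum_(p in [set p | ptgt p = v]) ((cabs (f p)) ^+ 2)%:E.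

(* The completion of the finitely supported functions on paths consists of
   those f for which <f, f> is an element of C_0(V). *)
Definition in_fock f :=
  (forall v, (sqnorm_at v f < +oo)%E) /\
  (forall eps : R, 0 < eps -> finite_set [set v | (eps%:E <= sqnorm_at v f)%E]).

Definition fock_pred : {pred gpath G -> C} := [pred f | `[< in_fock f >]].

Lemma cabs2E (z : R[i]) :
  cabs z ^+ 2 = complex.Re z ^+ 2 + complex.Im z ^+ 2.
Proof.
by case: z => a b; rewrite /cabs /= sqr_sqrtr // addr_ge0 // sqr_ge0.
Qed.

Lemma cabs0 : cabs (0 : R[i]) = 0.
Proof. exact: ComplexField.Normc.normc0. Qed.

Lemma cabsM (z w : R[i]) : cabs (z * w) = cabs z * cabs w.
Proof. exact: ComplexField.Normc.normcM. Qed.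

Lemma sqnorm_ge0 v f : (0 <= sqnorm_at v f)%E.
Proof. by apply: esum_ge0 => p _; rewrite lee_fin sqr_ge0. Qed.

Lemma sqnorm_atD v f g :
  (sqnorm_at v (f + g)%R <= 2%:E * (sqnorm_at v f + sqnorm_at v g))%E.
Proof.
have h0 (h : gpath G -> C) p : (0 <= (cabs (h p) ^+ 2)%:E :> \bar R)%E.
  by rewrite lee_fin sqr_ge0.
rewrite mule_natl mule2n /sqnorm_at -!esumD;
  try by move=> *; rewrite ?adde_ge0.
apply: le_esum => p _; rewrite -!EFinD lee_fin.
rewrite (_ : (f + g) p = f p + g p) // !cabs2E.
case: (f p) => a b; case: (g p) => c d /=.
rewrite -subr_ge0 (_ : _ - _ = (a - c) ^+ 2 + (b - d) ^+ 2).
  by rewrite addr_ge0 // sqr_ge0.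
by ring.
Qed.

Lemma sqnorm_atZ v (k : R[i]) f :
  (sqnorm_at v (k *: f)%R <= (cabs k ^+ 2)%:E * sqnorm_at v f)%E.
Proof.
apply: ge_ereal_sup => _ [X [finX XD] <-].
rewrite (_ : (\sum_(p \in X) _)%E =
    ((cabs k ^+ 2)%:E * \sum_(p \in X) (cabs (f p) ^+ 2)%:E)%E); last first.
  rewrite ge0_mule_fsumr => [|p]; last by rewrite lee_fin sqr_ge0.
  apply: eq_fsbigr => p _; rewrite -EFinM; congr EFin.
  by rewrite (_ : (k *: f) p = k * f p) // cabsM exprMn.
by apply: lee_wpmul2l; [rewrite lee_fin sqr_ge0 | apply: ereal_sup_ubound; exists X].
Qed.

Lemma in_fock_dominated (K : R) f g h : 0 < K -> in_fock f -> in_fock g ->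
  (forall v, (sqnorm_at v h <= K%:E * (sqnorm_at v f + sqnorm_at v g))%E) ->
  in_fock h.
Proof.
move=> K0 [f1 f2] [g1 g2] hle; split=> [v|eps eps0].
  apply: le_lt_trans (hle v) _.
  by rewrite lte_mul_pinfty ?lee_fin ?ltW // lte_add_pinfty.
have d0 : 0 < eps / (2 * K) by rewrite divr_gt0 // mulr_gt0.
have : finite_set ([set v | ((eps / (2 * K))%:E <= sqnorm_at v f)%E] `|`
                   [set v | ((eps / (2 * K))%:E <= sqnorm_at v g)%E]).
  by rewrite finite_setU; split; [exact: f2 | exact: g2].
apply: sub_finite_set => v /= epsv.
case: (leP (eps / (2 * K))%:E (sqnorm_at v f)) => [|fv]; first by left.
case: (leP (eps / (2 * K))%:E (sqnorm_at v g)) => [|gv]; first by right.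
suff : (eps%:E < eps%:E)%E by rewrite ltxx.
apply: le_lt_trans epsv _; apply: le_lt_trans (hle v) _.
have -> : eps%:E = (K%:E * ((eps / (2 * K))%:E + (eps / (2 * K))%:E))%E.
  by rewrite -EFinD -EFinM; congr EFin; field; rewrite gt_eqF.
by rewrite lte_pmul2l // lteD.
Qed.

Lemma fock_submod : submod_closed fock_pred.
Proof.
split=> [|a f g]; rewrite /fock_pred !inE.
  have z v : sqnorm_at v 0%R = 0%E.
    by rewrite /sqnorm_at esum1 // => p _; rewrite cabs0 expr0n.
  split=> [v|eps eps0]; first by rewrite z.
  rewrite (_ : [set v | _] = set0) // -subset0 => v /=.
  by rewrite z lee_fin leNgt eps0.
move=> ff fg; apply: (@in_fock_dominated (2 * (cabs a ^+ 2 + 1)) f g) => //.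
  by rewrite mulr_gt0 // ltr_pwDr // sqr_ge0.
move=> v; apply: le_trans (sqnorm_atD _ _ _) _.
rewrite EFinM -muleA lee_wpmul2l // ge0_muleDr ?sqnorm_ge0 // leeD //.
  apply: le_trans (sqnorm_atZ _ _ _) _.
  by rewrite lee_wpmul2r ?sqnorm_ge0 // lee_fin lerDl.
by rewrite lee_pemull ?sqnorm_ge0 // lee_fin lerDr sqr_ge0.
Qed.

HB.instance Definition _ := GRing.isSubmodClosed.Build R[i] (gpath G -> C)
  fock_pred fock_submod.

(* The Fock space: the path [e1 .. en] stands for the tensor e1 (x) .. (x) en,
   and the path of length 0 at [v] for the indicator function p_v. *)
Record fock := Fock { fval :> gpath G -> C; fvalP : fval \in fock_pred }.

HB.instance Definition _ := [isSub for fval].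
HB.instance Definition _ := [Choice of fock by <:].
HB.instance Definition _ := [SubChoice_isSubLmodule of fock by <:].

Definition pull (h : gpath G -> option (gpath G)) f : gpath G -> C :=
  fun p => oapp f 0 (h p).

Lemma pull_fock h f :
  (forall p q, h p = Some q -> ptgt p = ptgt q) ->
  (forall p q r, h p = Some r -> h q = Some r -> p = q) ->
  f \in fock_pred -> pull h f \in fock_pred.
Proof.
move=> htgt hinj; rewrite !inE => ff.
apply: (@in_fock_dominated 1 f f) => // v; rewrite mul1e.
apply: (@le_trans _ _ (sqnorm_at v f)); last by rewrite leeDl // sqnorm_ge0.
pose a p := (cabs (pull h f p) ^+ 2)%:E : \bar R.
pose D := [set p : gpath G | ptgt p = v].
pose B := [set p | h p != None].
have a0 p : (0 <= a p)%E by rewrite lee_fin sqr_ge0.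
have -> : sqnorm_at v (pull h f) = (\esum_(p in D `&` B) a p)%E.
  rewrite /sqnorm_at (esumID B); last by move=> p _; exact: a0.
  rewrite [X in (_ + X)%E]esum1 ?adde0 //.
  move=> p [_]; rewrite /B /pull /=; case: (h p) => [r|_]; first by case.
  by rewrite cabs0 expr0n.
pose e p := odflt p (h p).
have -> : (\esum_(p in D `&` B) a p =
           \esum_(p in D `&` B) (cabs (f (e p)) ^+ 2)%:E)%E.
  by apply: eq_esum => p [_]; rewrite /B /a /e /pull /=; case: (h p).
rewrite -(esum_image (D `&` B) e (fun p => (cabs (f p) ^+ 2)%:E)); last first.
  move=> p q; rewrite !inE => -[_]; rewrite /B /e /=.
  case hp: (h p) => [r|] // _ [_]; case hq: (h q) => [r'|] //= _ rr.
  by apply: hinj hp _; rewrite hq rr.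
rewrite /sqnorm_at; apply: le_ereal_sup => _ [X [finX XD] <-].
exists X => //; split=> // p /XD [q [qD qB] <-] /=.
move: qD qB; rewrite /D /B /e /=; case hq: (h q) => [r|] //= qv _.
by rewrite -(htgt _ _ hq).
Qed.

(* Arbitrary self-maps. The algebras below lie in the bounded adjointable
   operators, since these form a C*-algebra containing the generators. *)
Definition fop := fock -> fock.

Definition pull_op h (htgt : forall p q, h p = Some q -> ptgt p = ptgt q)
    (hinj : forall p q r, h p = Some r -> h q = Some r -> p = q) : fop :=
  fun x => Fock (pull_fock htgt hinj (fvalP x)).

Lemma pull_op_lin h htgt hinj (k : R[i]) (x y : fock) :
  @pull_op h htgt hinj (k *: x + y) =
  k *: @pull_op h htgt hinj x + @pull_op h htgt hinj y.
Proof.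
apply: val_inj; apply/funext => p.
have -> : val (k *: pull_op htgt hinj x + pull_op htgt hinj y) p =
    k * oapp x 0 (h p) + oapp y 0 (h p) by [].
rewrite [LHS]/= /pull; case: (h p) => [q|] //=.
by rewrite mulr0 addr0.
Qed.

Definition fproj_map v (p : gpath G) := if psrc p == v then Some p else None.

Lemma fproj_tgt v p q : fproj_map v p = Some q -> ptgt p = ptgt q.
Proof. by rewrite /fproj_map; case: eqP => // _ [->]. Qed.

Lemma fproj_inj v p q r :
  fproj_map v p = Some r -> fproj_map v q = Some r -> p = q.
Proof. by rewrite /fproj_map; do 2!case: eqP => // _; move=> [->] [->]. Qed.

Lemma pcons_tgt e p q : pcons e p = Some q -> ptgt p = ptgt q.
Proof. by move=> /pconsP [q1 pe]; rewrite /ptgt /endpt q1 /= -pe. Qed.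

Lemma pcons_inj e p q r : pcons e p = Some r -> pcons e q = Some r -> p = q.
Proof.
move=> /pconsP [r1 pe] /pconsP [r2 qe]; apply: val_inj => /=.
move: r1 pe qe; rewrite r2 /psrc.
by case: (pval p) => ? ?; case: (pval q) => ? ? /= [->] -> ->.
Qed.

Lemma puncons_tgt e p q : puncons e p = Some q -> ptgt p = ptgt q.
Proof. by move=> /punconsP [p1 qe]; rewrite /ptgt /endpt p1 /= -qe. Qed.

Lemma puncons_inj e p q r :
  puncons e p = Some r -> puncons e q = Some r -> p = q.
Proof.
by move=> /punconsP [p1 _] /punconsP [q1 _]; apply: val_inj; rewrite /= p1 q1.
Qed.

(* (p_v x)(s) = x(s) if s starts at v, and 0 otherwise. *)
Definition fproj v : fop := pull_op (@fproj_tgt v) (@fproj_inj v).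

(* (l(e) x)(e s) = x(s), and (l(e) x)(s) = 0 if s does not start with e. *)
Definition creat e : fop := pull_op (@puncons_tgt e) (@puncons_inj e).

(* (l(e)^* x)(s) = x(e s) if e s is a path, and 0 otherwise. *)
Definition annih e : fop := pull_op (@pcons_tgt e) (@pcons_inj e).

Definition finner (x y : fock) v : R[i] :=
  csum [set p | ptgt p = v] (fun p => conjc (x p) * y p).

(* The supremum is finite, because <x, x> is in C_0(V). *)
Definition fnorm (x : fock) : R :=
  Num.sqrt (fine (ereal_sup [set sqnorm_at v x | v in [set: vert G]])).

Definition is_adjoint (S T : fop) : Prop :=
  forall x y, finner (S x) y = finner x (T y).

Definition star_algebra (B : set fop) : Prop :=
  [/\ forall (k : R[i]) S T, B S -> B T -> B (k *: S + T),
      forall S T, B S -> B T -> B (S \o T)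
    & forall S T, B S -> is_adjoint S T -> B T].

Definition norm_closed (B : set fop) : Prop :=
  forall T : fop,
    (forall eps : R, 0 < eps ->
       exists2 S, B S & forall x, fnorm (T x - S x) <= eps * fnorm x) ->
    B T.

Definition cstar_algebra (B : set fop) : Prop :=
  star_algebra B /\ norm_closed B.

(* The indicator function p_v, as a vector of the Fock space. *)
Definition pvec_fun v : gpath G -> C := fun p => (p == pnil v)%:R.

Lemma pvec_fock v : pvec_fun v \in fock_pred.
Proof.
have h w : sqnorm_at w (pvec_fun v) = ((w == v)%:R)%:E.
  rewrite /sqnorm_at (esumID [set pnil v]); last first.
    by move=> *; rewrite lee_fin sqr_ge0.
  rewrite [X in (_ + X)%E]esum1 ?adde0; last first.
    by move=> p [_ /= /eqP/negPf pv]; rewrite /pvec_fun pv cabs0 expr0n.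
  case: eqP => [->|wv].
    rewrite (_ : _ `&` _ = [set pnil v]); last first.
      by apply/seteqP; split=> [p []|p ->].
    rewrite esum_set1 ?lee_fin ?sqr_ge0 // /pvec_fun eqxx cabs2E /=.
    by rewrite expr1n expr0n addr0.
  rewrite (_ : _ `&` _ = set0) ?esum_set0 // -subset0 => p [/= + pv].
  by rewrite pv /ptgt /= => /esym.
rewrite inE; split=> [w|eps eps0]; first by rewrite h ltry.
apply: (sub_finite_set _ (finite_set1 v)) => w /=; rewrite h lee_fin.
by case: eqP => //= _; rewrite leNgt eps0.
Qed.

Definition pvec v : fock := Fock (pvec_fock v).

Lemma finner_pvec v w (x : fock) :
  finner (pvec v) x w = if w == v then x (pnil v) else 0.
Proof.
rewrite /finner (@csum_supp1 _ _ _ _ (pnil w)) //=.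
  rewrite /pvec_fun; case: (eqVneq w v) => [->|wv].
    by rewrite eqxx conjc1 mul1r.
  case: eqP => [[] /eqP|_]; first by rewrite (negPf wv).
  by rewrite conjc0 mul0r.
move=> p pw /eqP/negPf pv; rewrite /pvec_fun.
case: eqP => [pe|_]; last by rewrite conjc0 mul0r.
by move: pv; rewrite -pw pe /ptgt /= eqxx.
Qed.

End FockSpace.

Arguments fproj R {G} v.
Arguments creat R {G} e.
Arguments annih R {G} e.
Arguments pvec R {G} v.

Section FreeLoopAlgebra.
Variables (R : realType) (G : ugraph) (mu : vert G -> R) (v0 : vert G).
Local Notation F := (fock R G).
Local Notation op := (fop R G).
Implicit Types (v : vert G) (e : dedge G) (s : seq (dedge G)).

Definition awt v s : R := (mu v / mu (endpt v s)) `^ (4%:R^-1).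

Definition aedge e : R := awt (src e) [:: e].

Definition Xop e : op :=
  (aedge e)%:C *: creat R e + ((aedge e)^-1)%:C *: annih R (dop e).

Definition graph_algebra : set op :=
  smallest (@cstar_algebra R G)
    ([set fproj R v | v in setT] `|` [set Xop e | e in setT]).

Definition loop_algebra : set op :=
  [set fproj R v0 \o x \o fproj R v0 | x in graph_algebra].

(* E(x), with values in functions on V, and Tr = mu o E; tr_0 is the restriction
   of Tr to S_0. *)
Definition cond_exp (x : op) v : R[i] :=
  csum [set: vert G] (fun w => finner (pvec R w) (x (pvec R w)) v).

Definition trace (x : op) : R[i] :=
  csum [set: vert G] (fun v => (mu v)%:C * cond_exp x v).

(* For a path starting at [v] with edges [s = e1 .. en], l(s) = l(e1) .. l(en),
   with l(v) = p_v when n = 0. *)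
Definition creat_path v s : op :=
  if s is [::] then fproj R v else foldr (fun e T => creat R e \o T) id s.

(* l(s)^* = l(en)^* .. l(e1)^* *)
Definition annih_path v s : op :=
  if s is [::] then fproj R v else foldl (fun T e => annih R e \o T) id s.

(* The factorizations s = r t are indexed by the length of r. *)
Definition wick (p : gpath G) : op :=
  let: (v, s) := pval p in
  \sum_(i < (size s).+1)
    let r := take i s in let w := endpt v r in
    let t := drop i s in let u := endpt w t in
    (awt v r * (awt w t)^-1)%:C *:
      (creat_path v r \o annih_path u (rev (map (@dop G) t))).

Definition poly_algebra : set op :=
  smallest (fun B => star_algebra B /\ B (fproj R v0))
    [set wick p | p in loops_at v0].

(* The GNS space L^2(S_0, tr_0). The vector [vac] satisfies
   <vac, x vac> = tr_0(x) for x in S_0 (see [traceE]), so that S_0 acting on the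
   closure of S_0 vac is the GNS representation of tr_0, x |-> x vac being the
   canonical map. *)
Definition vac : F := pvec R v0.

Definition gns_space : set F :=
  [set xi | forall eps : R, 0 < eps ->
     exists2 x, loop_algebra x & fnorm (xi - x vac) < eps].

(* The graph of the number operator on the span of the Wick words, and the graph
   of its closure. *)
Definition number_core : set (F * F) :=
  lspan [set ((wick p vac, (plen p)%:R *: wick p vac) : F * F)
        | p in loops_at v0].

Definition number_graph : set (F * F) :=
  [set z | [/\ gns_space z.1, gns_space z.2 &
     forall eps : R, 0 < eps -> exists2 y, number_core y &
       fnorm (z.1 - y.1) < eps /\ fnorm (z.2 - y.2) < eps]].

Definition comm_graph (a : op) : set (F * F) :=
  [set z | exists y w, [/\ number_graph (z.1, y), number_graph (a z.1, w)
                         & z.2 = w - a y]].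

(* For a densely defined operator this is the norm of its bounded extension, and
   it is infinite when there is none. *)
Definition graph_norm (Z : set (F * F)) : \bar R :=
  ereal_sup [set (fnorm z.2)%:E | z in Z `&` [set z | fnorm z.1 <= 1]].

Definition lip (a : op) : \bar R := graph_norm (comm_graph a).

Lemma graph_algebra_cstar : cstar_algebra graph_algebra.
Proof.
split; first split.
- move=> k S T BS BT D [cD gD]; case: (cD) => -[+ _ _] _; apply.
    exact: BS. exact: BT.
- move=> S T BS BT D [cD gD]; case: (cD) => -[_ + _] _; apply.
    exact: BS. exact: BT.
- move=> S T BS ST D [cD gD]; case: (cD) => -[_ _ +] _; apply; last exact: ST.
  exact: BS.
move=> T TS D [cD gD]; case: (cD) => _; apply => eps /TS [S BS STx].
by exists S => //; apply: BS.
Qed.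

Lemma graph_algebra_proj v : graph_algebra (fproj R v).
Proof. by apply: sub_gen_smallest; left; exists v. Qed.

Definition loop_pred : {pred op} := [pred x | `[< loop_algebra x >]].

Lemma loop_submod : submod_closed loop_pred.
Proof.
case: graph_algebra_cstar => -[glin _ _] _.
have g0 : graph_algebra 0.
  by have := glin (-1) _ _ (graph_algebra_proj v0) (graph_algebra_proj v0);
     rewrite scaleN1r addNr.
have lin k x y : fproj R v0 (k *: x + y) = k *: fproj R v0 x + fproj R v0 y.
  exact: pull_op_lin.
split=> [|k S T]; rewrite !inE.
  exists 0 => //; apply/funext => x /=.
  by have := lin (-1) 0 0; rewrite scaler0 addr0 scaleN1r addNr.
move=> [S' gS <-] [T' gT <-]; exists (k *: S' + T'); first exact: glin.
by apply/funext => x; rewrite /= lin.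
Qed.

HB.instance Definition _ := GRing.isSubmodClosed.Build R[i] op
  loop_pred loop_submod.

Record loop_alg := LoopAlg { lval :> op; lvalP : lval \in loop_pred }.

HB.instance Definition _ := [isSub for lval].
HB.instance Definition _ := [Choice of loop_alg by <:].
HB.instance Definition _ := [SubChoice_isSubLmodule of loop_alg by <:].

Lemma fproj_idem v : fproj R v \o fproj R v = fproj R v.
Proof.
apply/funext => x; apply: val_inj; apply/funext => p /=.
by rewrite /pull /fproj_map; case: ifP => //= ->.
Qed.

Lemma loop_one_subproof : fproj R v0 \in loop_pred.
Proof.
rewrite inE; exists (fproj R v0); first exact: graph_algebra_proj.
by rewrite !fproj_idem.
Qed.

Definition loop_one : loop_alg := LoopAlg loop_one_subproof.

(* In [state_pos], z is x^* x. *)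
Record state := State {
  sfun :> {scalar loop_alg};
  state_pos : forall (x z : loop_alg) (x' : op),
    is_adjoint (lval x) x' -> lval z = x' \o lval x -> 0 <= sfun z;
  state_one : sfun loop_one = 1 }.

HB.instance Definition _ := gen_eqMixin state.
HB.instance Definition _ := gen_choiceMixin state.

(* The weak-* topology is the topology of pointwise convergence. *)
Definition state_eval (phi : state) : {ptws loop_alg -> R[i]^o} := phi.

Definition wkstar_open (U : set state) : Prop :=
  @open (initial_topology state_eval) U.

Definition lip_dist (phi psi : state) : \bar R :=
  ereal_sup [set (cabs (phi x - psi x))%:E | x in
    [set x : loop_alg | poly_algebra (lval x) /\ (lip (lval x) <= 1)%E]].

(* The distance may be infinite a priori; its topology is generated by the open
   balls all the same. *)
Definition lip_open (U : set state) : Prop :=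
  forall phi, U phi -> exists2 eps : R, 0 < eps &
    forall psi, (lip_dist phi psi < eps%:E)%E -> U psi.

Lemma traceE x : mu v0 = 1 -> loop_algebra x ->
  trace x = finner vac (x vac) v0.
Proof.
move=> mu0 [y _ <-].
have E v : cond_exp (fproj R v0 \o y \o fproj R v0) v =
           finner (pvec R v) ((fproj R v0 \o y \o fproj R v0) (pvec R v)) v.
  rewrite /cond_exp (@csum_supp1 _ _ _ _ v) // => w _ wv.
  by rewrite finner_pvec; case: eqP => // vw; case: wv.
rewrite /trace (@csum_supp1 _ _ _ _ v0) // => [|v _ /eqP/negPf vv0].
  by rewrite mu0 mul1r E.
by rewrite E finner_pvec eqxx /= {1}/pull /fproj_map /psrc /= vv0 mulr0.
Qed.

End FreeLoopAlgebra.

(* Main.v *)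
Require Import Defs.
From mathcomp Require Import all_boot all_order all_algebra.
From mathcomp Require Import complex ring lra zify.
From mathcomp Require Import all_classical all_reals all_analysis.

Set Implicit Arguments.
Unset Strict Implicit.
Unset Printing Implicit Defensive.
Import Order.TTheory GRing.Theory Num.Theory.
Import numFieldNormedType.Exports.
Local Open Scope classical_set_scope.
Local Open Scope complex_scope.
Local Open Scope ring_scope.

(* The Wick word of a loop maps the vacuum to the basis vector of that loop, so
   the GNS space is the l^2-space of loops at [v0], on which [N] multiplies by
   the length. Since [mu v0] is minimal, all weights in the Wick words are at
   most 1, and the component of degree [k] with a given number of creation
   operators is bounded by the l^2-norm of its coefficients (Haagerup).

   Total boundedness: [N, a] applied to the vacuum bounds the coefficients of
   [a] of high degree. This controls, up to a factor depending on the width, the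
   part of [a] changing the length by little. The part changing the length by
   more than [K] has matrix entries those of [N, a] divided by the change
   [m - n] of length, and is small because the sum of 1/j^2 over j > K is. Hence
   elements of the Lip ball with small coefficients on the finitely many loops
   of small length are uniformly small as operators on the GNS space.

   Such a bound passes to all states by applying the state to the powers of
   [a^* a], whose norms on the Fock space exceed those on the GNS space by
   polynomial factors only, by the Haagerup inequality. Positivity of a state is
   used through the square root of [1 - h] for small self-adjoint [h]. *)

(** One obstacle is the factor k+1 in Haagerup's inequality. The commutator applied to the vacuum
    bounds the sum of k^2 |a_k|^2, where |a_k| is the l^2-norm of the coefficients of degree k,
    whereas the inequality asks for the sum of (k+1) |a_k|. That factor counts the components of
    degree k, one for each number of creations. Only N+1 of them at most change the length by no
    more than N, and for these the sum of the |a_k| suffices, which Cauchy-Schwarz controls; the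
    other components have to be read off from the commutator as an operator. The other obstacle is
    that states are bounded by the operator norm on the Fock module, while the Lip bound concerns
    only vectors over loops at [v0] in the domain of N. Growth rates of powers bridge the two
    without any identification of the norms. Constants are not optimized; many factors 2 come from
    estimating real and imaginary parts separately. *)

(** * Infinite sums through duplicate-free lists *)

Section Sums.
Variables (R : realType) (T : choiceType).
Implicit Types (D : set T) (a : T -> R) (X : seq T).

Lemma seq_le_esum D a X : (forall p, 0 <= a p) -> uniq X ->
  (forall p, p \in X -> D p) ->
  ((\sum_(p <- X) a p)%:E <= \esum_(p in D) (a p)%:E)%E.
Proof.
move=> a0 uX XD; apply: esum_ge; exists [set` X].
  by split => //; exact: finite_seq.
rewrite fsbig_finite ?finite_seq //= -sumEFin.
rewrite (perm_big (finmap.enum_fset (fset_set [set` X]))) ?sumEFin //.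
apply: uniq_perm => // p; rewrite in_fset_set ?finite_seq //.
by rewrite mem_setE.
Qed.

Lemma esum_le_seq D a (K : R) :
  (forall X, uniq X -> (forall p, p \in X -> D p) -> \sum_(p <- X) a p <= K) ->
  (\esum_(p in D) (a p)%:E <= K%:E)%E.
Proof.
move=> h; apply: ge_ereal_sup => _ [A [finA AD] <-].
rewrite fsbig_finite //= sumEFin lee_fin; apply: h => // p.
by rewrite in_fset_set // inE => /AD.
Qed.

End Sums.

(** * The Fock space norm *)

Section FNorm.
Variables (R : realType) (G : ugraph).
Implicit Types (x y z : fock R G) (X : seq (gpath G)).

Lemma sqnorm_val v x : sqnorm_at v x = (fine (sqnorm_at v x))%:E.
Proof.
rewrite fineK // ge0_fin_numE ?sqnorm_ge0 //.
by have := fvalP x; rewrite inE => -[/(_ v)].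
Qed.

(** Needed because [fnorm] takes [fine] of a supremum. The $C_0(V)$ condition leaves finitely many
    vertices with value at least 1, and their values are summed. *)
Lemma sqnorm_bounded x : exists K : R, forall v, (sqnorm_at v x <= K%:E)%E.
Proof.
have := fvalP x; rewrite inE => -[h1 /(_ 1 ltr01) h2].
exists (1 + \sum_(v \in [set v | (1%:E <= sqnorm_at v x)%E]) fine (sqnorm_at v x)) => v.
have f0 w : 0 <= fine (sqnorm_at w x) by rewrite fine_ge0 // sqnorm_ge0.
case: (leP 1%:E (sqnorm_at v x)) => hv.
  rewrite sqnorm_val lee_fin.
  apply: (@le_trans _ _ (\sum_(v \in [set v | (1%:E <= sqnorm_at v x)%E])
     fine (sqnorm_at v x))); last by rewrite lerDr.
  rewrite fsbig_finite //= (big_rem v) /=; last by rewrite in_fset_set // inE.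
  by rewrite lerDl sumr_ge0.
apply: ltW; apply: (lt_le_trans hv); rewrite lee_fin lerDl.
by rewrite fsbig_finite //= sumr_ge0.
Qed.

Lemma fnorm_ge0 x : 0 <= fnorm x.
Proof. exact: sqrtr_ge0. Qed.

Lemma sqnorm_le_fnorm v x : (sqnorm_at v x <= (fnorm x ^+ 2)%:E)%E.
Proof.
have [K hK] := sqnorm_bounded x.
set S := ereal_sup [set sqnorm_at v x | v in [set: vert G]].
have vS : (sqnorm_at v x <= S)%E by apply: ereal_sup_ubound; exists v.
have S0 : (0 <= S)%E by apply: le_trans vS; exact: sqnorm_ge0.
have Sf : S \is a fin_num.
  rewrite ge0_fin_numE //; apply: (@le_lt_trans _ _ K%:E); last by rewrite ltry.
  by apply: ge_ereal_sup => _ [w _ <-].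
by rewrite /fnorm sqr_sqrtr ?fine_ge0 // fineK.
Qed.

Lemma fnorm_le_sqnorm x (K : R) : 0 <= K ->
  (forall v, (sqnorm_at v x <= (K ^+ 2)%:E)%E) -> fnorm x <= K.
Proof.
move=> K0 h; rewrite -(ler_pXn2r (n := 2)) ?nnegrE ?fnorm_ge0 //.
rewrite /fnorm; set S := ereal_sup _.
case: (lerP 0 (fine S)) => [S0|/ltW S0]; last first.
  by rewrite ler0_sqrtr // expr0n /= sqr_ge0.
rewrite sqr_sqrtr //.
have SK : (S <= (K ^+ 2)%:E)%E by apply: ge_ereal_sup => _ [w _ <-].
by move: SK; case: (S) => [r||] //= _; rewrite sqr_ge0.
Qed.

(** With [fnorm_le], the interface for most norm bounds: the norm is the supremum, over the end
    vertex, of the l^2-norms on paths with that end. *)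
Lemma seq_le_fnorm v x X : uniq X -> (forall p, p \in X -> ptgt p = v) ->
  \sum_(p <- X) cabs (x p) ^+ 2 <= fnorm x ^+ 2.
Proof.
move=> uX XD; rewrite -lee_fin; apply: le_trans (sqnorm_le_fnorm v x).
by apply: (@seq_le_esum _ _ _ (fun p => cabs (x p) ^+ 2)) => // p; exact: sqr_ge0.
Qed.

Lemma fnorm_le x (K : R) : 0 <= K ->
  (forall v X, uniq X -> (forall p, p \in X -> ptgt p = v) ->
     \sum_(p <- X) cabs (x p) ^+ 2 <= K ^+ 2) -> fnorm x <= K.
Proof.
move=> K0 h; apply: fnorm_le_sqnorm => // v.
exact: (@esum_le_seq _ _ _ (fun p => cabs (x p) ^+ 2)) (h v).
Qed.

Lemma cabs_ge0 (z : R[i]) : 0 <= cabs z.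
Proof. by case: z => a b; exact: sqrtr_ge0. Qed.

Lemma cabsD (z w : R[i]) : cabs (z + w) <= cabs z + cabs w.
Proof. exact: le_normcD. Qed.

Lemma cabsN (z : R[i]) : cabs (- z) = cabs z.
Proof. exact: normcN. Qed.

Lemma cabs_real (r : R) : cabs r%:C = `|r|.
Proof. by rewrite /cabs /= expr0n addr0 sqrtr_sqr. Qed.

Lemma cabs_conj (z : R[i]) : cabs (conjc z) = cabs z.
Proof. by case: z => a b; rewrite /cabs /= sqrrN. Qed.

Lemma cabs_eq0 (z : R[i]) : cabs z = 0 -> z = 0.
Proof. exact: ComplexField.Normc.eq0_normc. Qed.

Lemma cabs_sum (I : Type) (r : seq I) (P : pred I) (F : I -> R[i]) :
  cabs (\sum_(i <- r | P i) F i) <= \sum_(i <- r | P i) cabs (F i).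
Proof.
elim/big_rec2: _ => [|i y z _ h]; first by rewrite cabs0.
by apply: le_trans (cabsD _ _) _; rewrite lerD2l.
Qed.

Lemma cabs_le_fnorm x p : cabs (x p) <= fnorm x.
Proof.
rewrite -(ler_pXn2r (n := 2)) ?nnegrE ?fnorm_ge0 ?cabs_ge0 //.
have := @seq_le_fnorm (ptgt p) x [:: p]; rewrite big_seq1; apply => //.
by move=> q; rewrite inE => /eqP ->.
Qed.

Lemma fock_eq x y : (forall p, x p = y p) -> x = y.
Proof. by move=> h; apply: val_inj; apply/funext. Qed.

Lemma fockDE x y p : (x + y) p = x p + y p. Proof. by []. Qed.
Lemma fockNE x p : (- x) p = - x p. Proof. by []. Qed.
Lemma fockBE x y p : (x - y) p = x p - y p. Proof. by []. Qed.
Lemma fockZE (k : R[i]) x p : (k *: x) p = k * x p. Proof. by []. Qed.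
Lemma fock0E p : (0 : fock R G) p = 0. Proof. by []. Qed.
Lemma fock_sumE (I : Type) (r : seq I) (P : pred I) (F : I -> fock R G) p :
  (\sum_(i <- r | P i) F i) p = \sum_(i <- r | P i) F i p.
Proof. by elim/big_rec2: _ => // i y z _ <-. Qed.

Lemma fnorm_eq0 x : fnorm x = 0 -> x = 0.
Proof.
move=> h; apply: fock_eq => p; apply: cabs_eq0; apply/eqP.
by rewrite eq_le cabs_ge0 -h cabs_le_fnorm.
Qed.

Lemma fnorm0 : fnorm (0 : fock R G) = 0.
Proof.
apply/eqP; rewrite eq_le fnorm_ge0 andbT; apply: fnorm_le => // v X _ _.
by rewrite big1 ?expr0n // => p _; rewrite fock0E cabs0 expr0n.
Qed.

(** Summing (u + w)^2 <= (1 + b/a) u^2 + (1 + a/b) w^2 gives exactly (a + b)^2. This divides by the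
    bounds, so bounds that may be 0 are first enlarged by e/2. *)
Lemma minkowski2 (T : Type) (X : seq T) (f g : T -> R[i]) (a b : R) :
  0 <= a -> 0 <= b ->
  \sum_(p <- X) cabs (f p) ^+ 2 <= a ^+ 2 ->
  \sum_(p <- X) cabs (g p) ^+ 2 <= b ^+ 2 ->
  \sum_(p <- X) cabs (f p + g p) ^+ 2 <= (a + b) ^+ 2.
Proof.
move=> a0 b0.
have strict (a' b' : R) : 0 < a' -> 0 < b' ->
  \sum_(p <- X) cabs (f p) ^+ 2 <= a' ^+ 2 ->
  \sum_(p <- X) cabs (g p) ^+ 2 <= b' ^+ 2 ->
  \sum_(p <- X) cabs (f p + g p) ^+ 2 <= (a' + b') ^+ 2.
  move=> a1 b1 ha hb.
  apply: (@le_trans _ _ (\sum_(p <- X) ((1 + b' / a') * cabs (f p) ^+ 2 +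
     (1 + a' / b') * cabs (g p) ^+ 2))).
    apply: ler_sum => p _; set u := cabs (f p); set w := cabs (g p).
    apply: (@le_trans _ _ ((u + w) ^+ 2)).
      by rewrite ler_pXn2r ?nnegrE ?addr_ge0 ?cabs_ge0 // cabsD.
    rewrite -subr_ge0.
    have -> : (1 + b' / a') * u ^+ 2 + (1 + a' / b') * w ^+ 2 - (u + w) ^+ 2 =
       (b' * u - a' * w) ^+ 2 / (a' * b') by field; rewrite !gt_eqF.
    by rewrite divr_ge0 ?sqr_ge0 // mulr_ge0 // ltW.
  rewrite big_split /= -!mulr_sumr.
  have -> : (a' + b') ^+ 2 = (1 + b' / a') * a' ^+ 2 + (1 + a' / b') * b' ^+ 2.
    by field; rewrite !gt_eqF.
  by rewrite lerD // ler_wpM2l // addr_ge0 // divr_ge0 // ltW.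
move=> ha hb.
set S := \sum_(p <- X) _.
have S0 : 0 <= S by apply: sumr_ge0 => p _; rewrite sqr_ge0.
suff : Num.sqrt S <= a + b.
  by rewrite -(ler_pXn2r (n := 2)) ?nnegrE ?sqrtr_ge0 ?addr_ge0 // sqr_sqrtr.
apply/ler_addgt0Pr => e e0.
rewrite -(ler_pXn2r (n := 2)) ?nnegrE ?sqrtr_ge0 ?addr_ge0 ?(ltW e0) // sqr_sqrtr //.
have -> : a + b + e = (a + e / 2) + (b + e / 2) by field.
have e2 : 0 < e / 2 by rewrite divr_gt0.
apply: strict; rewrite ?ltr_wpDl //.
  by apply: le_trans ha _; rewrite ler_pXn2r ?nnegrE ?addr_ge0 ?(ltW e2) // lerDl ltW.
by apply: le_trans hb _; rewrite ler_pXn2r ?nnegrE ?addr_ge0 ?(ltW e2) // lerDl ltW.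
Qed.

Lemma minkowski_sum (T I : Type) (X : seq T) (r : seq I) (P : pred I)
    (f : I -> T -> R[i]) (a : I -> R) :
  (forall i, P i -> 0 <= a i) ->
  (forall i, P i -> \sum_(p <- X) cabs (f i p) ^+ 2 <= a i ^+ 2) ->
  \sum_(p <- X) cabs (\sum_(i <- r | P i) f i p) ^+ 2 <=
    (\sum_(i <- r | P i) a i) ^+ 2.
Proof.
move=> a0 h; elim: r => [|i r IH].
  by rewrite big_nil expr0n /= big1 // => p _; rewrite big_nil cabs0 expr0n.
rewrite big_cons; case: ifP => Pi; last first.
  by under [leLHS]eq_bigr do rewrite big_cons Pi; exact: IH.
under [leLHS]eq_bigr do rewrite big_cons Pi.
by apply: minkowski2 => //; [exact: a0|apply: sumr_ge0|exact: h].
Qed.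

Lemma fnormD x y : fnorm (x + y) <= fnorm x + fnorm y.
Proof.
apply: fnorm_le => [|v X uX XD]; first by rewrite addr_ge0 ?fnorm_ge0.
by apply: minkowski2; rewrite ?fnorm_ge0 //; apply: (seq_le_fnorm (v := v)).
Qed.

Lemma fnormZ (k : R[i]) x : fnorm (k *: x) = cabs k * fnorm x.
Proof.
have le k' x' : fnorm (k' *: x') <= cabs k' * fnorm x'.
  apply: fnorm_le => [|v X uX XD]; first by rewrite mulr_ge0 ?fnorm_ge0 ?cabs_ge0.
  rewrite exprMn; under eq_bigr do rewrite fockZE cabsM exprMn.
  by rewrite -mulr_sumr ler_wpM2l ?sqr_ge0 // (seq_le_fnorm (v := v)).
case: (eqVneq k 0) => [->|k0]; first by rewrite scale0r fnorm0 cabs0 mul0r.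
apply/eqP; rewrite eq_le le /=.
have c0 : 0 < cabs k.
  by rewrite lt_neqAle cabs_ge0 andbT eq_sym; apply: contra_neq k0 => /cabs_eq0.
rewrite -ler_pdivlMl //; have := le k^-1 (k *: x).
rewrite scalerA mulVf // scale1r; congr (_ <= _ * _).
by rewrite /cabs ComplexField.Normc.normcV.
Qed.

Lemma fnormN x : fnorm (- x) = fnorm x.
Proof. by rewrite -scaleN1r fnormZ cabsN (cabs_real 1) normr1 mul1r. Qed.

Lemma fnormB x y : fnorm (x - y) = fnorm (y - x).
Proof. by rewrite -fnormN opprB. Qed.

Lemma fnorm_tri x y z : fnorm (x - z) <= fnorm (x - y) + fnorm (y - z).
Proof. by apply: le_trans (fnormD _ _); rewrite addrA subrK. Qed.

End FNorm.

(** * Inner products and adjoints *)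

Section SignedSums.
Variables (R : realType) (T : choiceType) (D : set T).
Implicit Types (f g h : T -> R).

Definition abs_bounded f (K : R) := forall X, uniq X ->
  (forall p, p \in X -> D p) -> \sum_(p <- X) `|f p| <= K.

Lemma abs_bounded_esum f K : abs_bounded f K ->
  (\esum_(p in D) `|f p|%:E <= K%:E)%E.
Proof. exact: esum_le_seq. Qed.

Lemma esum_le_fine (a b : T -> R) (K : R) : (forall p, 0 <= a p) ->
  (forall p, D p -> a p <= b p) -> (\esum_(p in D) (b p)%:E <= K%:E)%E ->
  (\esum_(p in D) (a p)%:E)%E = (fine (\esum_(p in D) (a p)%:E))%:E /\
  fine (\esum_(p in D) (a p)%:E) <= K.
Proof.
move=> a0 ab bK.
have aK : (\esum_(p in D) (a p)%:E <= K%:E)%E.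
  by apply: le_trans bK; apply: le_esum => p Dp; rewrite lee_fin ab.
have a00 : (0 <= \esum_(p in D) (a p)%:E)%E.
  by apply: esum_ge0 => p _; rewrite lee_fin.
have af : (\esum_(p in D) (a p)%:E)%E \is a fin_num.
  by rewrite ge0_fin_numE // (le_lt_trans aK) // ltry.
by split; rewrite ?fineK // -lee_fin fineK.
Qed.

(** Positive parts are not additive, so linearity of [rsum] goes through arbitrary decompositions f
    = g - h: pointwise f^+ + h = f^- + g, and sums of nonnegative families are additive. *)
Lemma rsum_diff f g h (K : R) : (forall p, 0 <= g p) -> (forall p, 0 <= h p) ->
  (\esum_(p in D) (g p)%:E <= K%:E)%E -> (\esum_(p in D) (h p)%:E <= K%:E)%E ->
  (forall p, D p -> f p = g p - h p) ->
  rsum D f = fine (\esum_(p in D) (g p)%:E) - fine (\esum_(p in D) (h p)%:E).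
Proof.
move=> g0 h0 gK hK fgh; rewrite /rsum.
have m0 (r : R) : 0 <= Num.max r 0 by rewrite le_max lexx orbT.
have [g1 _] := esum_le_fine g0 (fun p _ => lexx (g p)) gK.
have [h1 _] := esum_le_fine h0 (fun p _ => lexx (h p)) hK.
have [p1 _] : (\esum_(p in D) (Num.max (f p) 0)%:E)%E =
    (fine (\esum_(p in D) (Num.max (f p) 0)%:E))%:E /\
    fine (\esum_(p in D) (Num.max (f p) 0)%:E) <= K.
  apply: (esum_le_fine _ _ gK) => // p Dp.
  by rewrite ge_max g0 andbT fgh // gerBl.
have [n1 _] : (\esum_(p in D) (Num.max (- f p) 0)%:E)%E =
    (fine (\esum_(p in D) (Num.max (- f p) 0)%:E))%:E /\
    fine (\esum_(p in D) (Num.max (- f p) 0)%:E) <= K.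
  apply: (esum_le_fine _ _ hK) => // p Dp.
  by rewrite ge_max h0 andbT fgh // opprB gerBl.
have : ((\esum_(p in D) (Num.max (f p) 0)%:E) + \esum_(p in D) (h p)%:E =
  (\esum_(p in D) (Num.max (- f p) 0)%:E) + \esum_(p in D) (g p)%:E)%E.
  rewrite -!esumD; try by move=> p _; rewrite lee_fin.
  apply: eq_esum => p Dp; rewrite -!EFinD; congr EFin.
  rewrite fgh //; case: (lerP (g p - h p) 0) => h2.
    by rewrite max_l ?oppr_ge0 // opprB add0r addrNK.
  by rewrite max_r ?oppr_le0 1?ltW // add0r subrK.
rewrite p1 h1 n1 g1 -!EFinD => -[]; rewrite /=; lra.
Qed.

Lemma abs_bounded_pos f K : abs_bounded f K ->
  (\esum_(p in D) (Num.max (f p) 0)%:E <= K%:E)%E.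
Proof.
move=> /abs_bounded_esum; apply: le_trans; apply: le_esum => p _.
by rewrite lee_fin ge_max normr_ge0 ler_norm.
Qed.

Lemma abs_bounded_neg f K : abs_bounded f K ->
  (\esum_(p in D) (Num.max (- f p) 0)%:E <= K%:E)%E.
Proof.
move=> /abs_bounded_esum; apply: le_trans; apply: le_esum => p _.
by rewrite lee_fin ge_max normr_ge0 -normrN ler_norm.
Qed.

Let pos_ge0 (r : R) : 0 <= Num.max r 0.
Proof. by rewrite le_max lexx orbT. Qed.

Lemma posBneg (r : R) : r = Num.max r 0 - Num.max (- r) 0.
Proof.
case: (lerP r 0) => h; first by rewrite max_l ?oppr_ge0 // opprK add0r.
by rewrite max_r ?oppr_le0 1?ltW // subr0.
Qed.

Lemma rsumD f g K L : abs_bounded f K -> abs_bounded g L ->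
  rsum D (fun p => f p + g p) = rsum D f + rsum D g.
Proof.
move=> fK gL.
have fp := abs_bounded_pos fK; have fn := abs_bounded_neg fK.
have gp := abs_bounded_pos gL; have gn := abs_bounded_neg gL.
rewrite (@rsum_diff _ (fun p => Num.max (f p) 0 + Num.max (g p) 0)
   (fun p => Num.max (- f p) 0 + Num.max (- g p) 0) (K + L)); last first.
- by move=> p _; rewrite {1}(posBneg (f p)) {1}(posBneg (g p)); ring.
- under eq_esum do rewrite EFinD.
  by rewrite esumD ?EFinD ?leeD // => p _; rewrite lee_fin.
- under eq_esum do rewrite EFinD.
  by rewrite esumD ?EFinD ?leeD // => p _; rewrite lee_fin.
- by move=> p; rewrite addr_ge0.
- by move=> p; rewrite addr_ge0.
have [fp1 _] := esum_le_fine (fun p => pos_ge0 (f p)) (fun p _ => lexx _) fp.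
have [gp1 _] := esum_le_fine (fun p => pos_ge0 (g p)) (fun p _ => lexx _) gp.
have [fn1 _] := esum_le_fine (fun p => pos_ge0 (- f p)) (fun p _ => lexx _) fn.
have [gn1 _] := esum_le_fine (fun p => pos_ge0 (- g p)) (fun p _ => lexx _) gn.
have -> : (\esum_(p in D) (Num.max (f p) 0 + Num.max (g p) 0)%:E =
  \esum_(p in D) (Num.max (f p) 0)%:E + \esum_(p in D) (Num.max (g p) 0)%:E)%E.
  by rewrite -esumD // => p _; rewrite lee_fin.
have -> : (\esum_(p in D) (Num.max (- f p) 0 + Num.max (- g p) 0)%:E =
  \esum_(p in D) (Num.max (- f p) 0)%:E + \esum_(p in D) (Num.max (- g p) 0)%:E)%E.
  by rewrite -esumD // => p _; rewrite lee_fin.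
by rewrite fp1 fn1 gp1 gn1 -!EFinD /= /rsum; ring.
Qed.

Lemma rsumN f : rsum D (fun p => - f p) = - rsum D f.
Proof.
rewrite /rsum opprB; congr (_ - _).
by congr fine; apply: eq_esum => p _; rewrite opprK.
Qed.

Lemma esumZ (k : R) (a : T -> R) : 0 <= k -> (forall p, 0 <= a p) ->
  (\esum_(p in D) (k * a p)%:E = k%:E * \esum_(p in D) (a p)%:E)%E.
Proof.
have le (k' : R) (b : T -> R) : 0 <= k' -> (forall p, 0 <= b p) ->
    (\esum_(p in D) (k' * b p)%:E <= k'%:E * \esum_(p in D) (b p)%:E)%E.
  move=> k0 b0; apply: ge_ereal_sup => _ [X [finX XD] <-].
  rewrite (_ : (\sum_(p \in X) _)%E = (k'%:E * \sum_(p \in X) (b p)%:E)%E).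
    by apply: lee_wpmul2l; rewrite ?lee_fin //; apply: ereal_sup_ubound; exists X.
  rewrite ge0_mule_fsumr => [|p]; last by rewrite lee_fin.
  by apply: eq_fsbigr => p _; rewrite -EFinM.
move=> k0 a0; case: (eqVneq k 0) => [->|kn].
  by rewrite mul0e esum1 // => p _; rewrite mul0r.
apply/eqP; rewrite eq_le le //=.
have kp : 0 < k by rewrite lt_neqAle eq_sym kn.
have := le k^-1 (fun p => k * a p); rewrite invr_ge0 => /(_ k0).
have eqa : (\esum_(p in D) (k^-1 * (k * a p))%:E = \esum_(p in D) (a p)%:E)%E.
  by apply: eq_esum => p _; rewrite mulrA mulVf // mul1r.
rewrite eqa => /(_ _) h.
rewrite -lee_pdivlMl //; apply: h => p; exact: mulr_ge0.
Qed.

Lemma rsumZ (k : R) f K : abs_bounded f K ->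
  rsum D (fun p => k * f p) = k * rsum D f.
Proof.
have pos (k' : R) : 0 <= k' -> abs_bounded f K ->
    rsum D (fun p => k' * f p) = k' * rsum D f.
  move=> k0 fK.
  have fp := abs_bounded_pos fK; have fn := abs_bounded_neg fK.
  have [fp1 _] := esum_le_fine (fun p => pos_ge0 (f p)) (fun p _ => lexx _) fp.
  have [fn1 _] := esum_le_fine (fun p => pos_ge0 (- f p)) (fun p _ => lexx _) fn.
  rewrite (@rsum_diff _ (fun p => k' * Num.max (f p) 0)
     (fun p => k' * Num.max (- f p) 0) (k' * K)).
  - by rewrite !esumZ // fp1 fn1 -!EFinM /= mulrBr.
  - by move=> p; exact: mulr_ge0.
  - by move=> p; exact: mulr_ge0.
  - by rewrite esumZ // EFinM lee_wpmul2l.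
  - by rewrite esumZ // EFinM lee_wpmul2l.
  - by move=> p _; rewrite {1}(posBneg (f p)) mulrBr.
move=> fK; case: (lerP 0 k) => [k0|/ltW k0]; first exact: pos.
have -> : (fun p => k * f p) = (fun p => - ((- k) * f p)).
  by apply/funext => p; rewrite mulNr opprK.
by rewrite rsumN pos ?oppr_ge0 // mulNr opprK.
Qed.

Lemma rsum_le f K : abs_bounded f K -> `|rsum D f| <= K.
Proof.
move=> fK.
have fp := abs_bounded_pos fK; have fn := abs_bounded_neg fK.
have [_ fp1] := esum_le_fine (fun p => pos_ge0 (f p)) (fun p _ => lexx _) fp.
have [_ fn1] := esum_le_fine (fun p => pos_ge0 (- f p)) (fun p _ => lexx _) fn.
have e0 (a : T -> R) : (forall p, 0 <= a p) -> 0 <= fine (\esum_(p in D) (a p)%:E).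
  by move=> a0; rewrite fine_ge0 // esum_ge0 // => p _; rewrite lee_fin.
have := e0 _ (fun p => pos_ge0 (f p)); have := e0 _ (fun p => pos_ge0 (- f p)).
by rewrite /rsum ler_norml; lra.
Qed.

Lemma eq_rsum f g : (forall p, D p -> f p = g p) -> rsum D f = rsum D g.
Proof.
by move=> fg; rewrite /rsum; congr (fine _ - fine _);
  apply: eq_esum => p Dp; rewrite fg.
Qed.

Definition cabs_bounded (f : T -> R[i]) (K : R) := forall X, uniq X ->
  (forall p, p \in X -> D p) -> \sum_(p <- X) cabs (f p) <= K.

Lemma Re_le_cabs (z : R[i]) : `|complex.Re z| <= cabs z.
Proof.
case: z => a b; rewrite /cabs /= -sqrtr_sqr ler_wsqrtr //.
by rewrite lerDl sqr_ge0.
Qed.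

Lemma Im_le_cabs (z : R[i]) : `|complex.Im z| <= cabs z.
Proof.
case: z => a b; rewrite /cabs /= -sqrtr_sqr ler_wsqrtr //.
by rewrite lerDr sqr_ge0.
Qed.

Lemma cabs_bounded_Re (f : T -> R[i]) K : cabs_bounded f K ->
  abs_bounded (fun p => complex.Re (f p)) K.
Proof.
by move=> h X uX XD; apply: le_trans (h X uX XD); apply: ler_sum => p _;
  exact: Re_le_cabs.
Qed.

Lemma cabs_bounded_Im (f : T -> R[i]) K : cabs_bounded f K ->
  abs_bounded (fun p => complex.Im (f p)) K.
Proof.
by move=> h X uX XD; apply: le_trans (h X uX XD); apply: ler_sum => p _;
  exact: Im_le_cabs.
Qed.

Lemma abs_boundedZ (k : R) f K : abs_bounded f K ->
  abs_bounded (fun p => k * f p) (`|k| * K).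
Proof.
move=> h X uX XD; under eq_bigr do rewrite normrM.
by rewrite -mulr_sumr ler_wpM2l // h.
Qed.

Lemma csum_ext (f g : T -> R[i]) :
  (forall p, D p -> f p = g p) -> csum D f = csum D g.
Proof.
by move=> fg; rewrite /csum; congr (_ +i* _); apply: eq_rsum => p Dp; rewrite fg.
Qed.

Lemma csumD (f g : T -> R[i]) K L : cabs_bounded f K -> cabs_bounded g L ->
  csum D (fun p => f p + g p) = csum D f + csum D g.
Proof.
move=> fK gL; rewrite /csum.
have [fr fi] := (cabs_bounded_Re fK, cabs_bounded_Im fK).
have [gr gi] := (cabs_bounded_Re gL, cabs_bounded_Im gL).
rewrite (_ : rsum D (fun i => complex.Re (f i)) +i* _ + _ =
  (rsum D (fun i => complex.Re (f i)) + rsum D (fun i => complex.Re (g i))) +i*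
  (rsum D (fun i => complex.Im (f i)) + rsum D (fun i => complex.Im (g i)))) //.
rewrite -(rsumD fr gr) -(rsumD fi gi).
by congr (_ +i* _); apply: eq_rsum => p _; case: (f p); case: (g p).
Qed.

Lemma csumZ (k : R[i]) (f : T -> R[i]) K : cabs_bounded f K ->
  csum D (fun p => k * f p) = k * csum D f.
Proof.
move=> fK; rewrite /csum; case: k => a b.
have [fr fi] := (cabs_bounded_Re fK, cabs_bounded_Im fK).
rewrite (_ : (a +i* b) * (_ +i* _) =
  (a * rsum D (fun i => complex.Re (f i)) + (- b) * rsum D (fun i => complex.Im (f i)))
  +i* (a * rsum D (fun i => complex.Im (f i)) + b * rsum D (fun i => complex.Re (f i)))).
  rewrite -(rsumZ a fr) -(rsumZ b fr) -(rsumZ a fi) -(rsumZ (- b) fi).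
  rewrite -(rsumD (abs_boundedZ a fr) (abs_boundedZ (- b) fi)).
  rewrite -(rsumD (abs_boundedZ a fi) (abs_boundedZ b fr)).
  congr (_ +i* _); apply: eq_rsum => p _; case: (f p) => c d /=.
    by rewrite mulNr.
  by rewrite addrC.
by apply/eqP; rewrite eq_complex /= mulNr (addrC (a * _)) !eqxx.
Qed.

Lemma csum_conj (f : T -> R[i]) : csum D (fun p => conjc (f p)) = conjc (csum D f).
Proof.
rewrite /csum /= -rsumN.
by congr (_ +i* _); apply: eq_rsum => p _; case: (f p).
Qed.

(** The factor 2, from separate bounds for real and imaginary part, reappears in [finner_le] and in
    all bounds for adjoints. *)
Lemma csum_le (f : T -> R[i]) K : cabs_bounded f K -> cabs (csum D f) <= 2 * K.
Proof.
move=> fK.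
have [fr fi] := (rsum_le (cabs_bounded_Re fK), rsum_le (cabs_bounded_Im fK)).
have -> : csum D f = (rsum D (fun i => complex.Re (f i)))%:C +
   'i%C * (rsum D (fun i => complex.Im (f i)))%:C by rewrite [LHS]complexE.
apply: le_trans (cabsD _ _) _; rewrite cabsM !cabs_real.
have -> : cabs ('i%C : R[i]) = 1 by rewrite /cabs /= expr0n expr1n add0r sqrtr1.
by rewrite mul1r mulr_natl mulr2n lerD.
Qed.

End SignedSums.

(** * Reindexing along mutually inverse partial maps *)

Section Reindex.
Variables (R : realType) (T : choiceType) (D : set T).
Variables (h k : T -> option T).
Hypothesis hk : forall p q, h p = Some q <-> k q = Some p.
Hypothesis hD : forall p q, h p = Some q -> D p <-> D q.

Lemma esum_partial_bij (a : T -> T -> \bar R) : (forall p q, 0 <= a p q)%E ->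
  (\esum_(p in D) oapp (a p) 0 (h p) = \esum_(q in D) oapp (a^~ q) 0 (k q))%E.
Proof.
move=> a0.
pose B := [set p | h p != None]; pose B' := [set q | k q != None].
have split_h : (\esum_(p in D) oapp (a p) 0 (h p) =
   \esum_(p in D `&` B) oapp (a p) 0 (h p))%E.
  rewrite (esumID B); last by move=> p _; case: (h p) => //= q; exact: a0.
  rewrite [X in (_ + X)%E]esum1 ?adde0 // => p [_].
  by rewrite /B /=; case: (h p) => // q; case.
have split_k : (\esum_(q in D) oapp (a^~ q) 0 (k q) =
   \esum_(q in D `&` B') oapp (a^~ q) 0 (k q))%E.
  rewrite (esumID B'); last by move=> p _; case: (k p) => //= q; exact: a0.
  rewrite [X in (_ + X)%E]esum1 ?adde0 // => p [_].
  by rewrite /B' /=; case: (k p) => // q; case.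
rewrite split_h split_k.
pose e p := odflt p (h p).
rewrite (@reindex_esum R T T (D `&` B) (D `&` B') e).
- apply: eq_esum => p [Dp]; rewrite /B /e /=; case hp: (h p) => [q|] //= _.
  by move/hk: hp => ->.
- split.
  + move=> p [Dp]; rewrite /B /B' /e /=; case hp: (h p) => [q|] //= _.
    by split; [apply/(hD hp)|move/hk: hp => ->].
  + move=> p q; rewrite !inE => -[_]; rewrite /B /e /=.
    case hp: (h p) => [r|] // _ [_]; case hq: (h q) => [r'|] //= _ rr.
    move: hq; rewrite -rr => /hk hq; move/hk: hp; rewrite hq => -[] //.
  + move=> q [Dq]; rewrite /B' /=; case kq: (k q) => [p|] //= _.
    move/hk: (kq) => hp; exists p; last by rewrite /e hp.
    by split; [apply/(hD hp)|rewrite /B /= hp].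
Qed.

Lemma rsum_partial_bij (a : T -> T -> R) :
  rsum D (fun p => oapp (a p) 0 (h p)) = rsum D (fun q => oapp (a^~ q) 0 (k q)).
Proof.
rewrite /rsum; congr (fine _ - fine _).
  rewrite -[LHS](@eq_esum _ _ _ (fun p => oapp (fun q => (Num.max (a p q) 0)%:E) 0%E (h p))).
    rewrite esum_partial_bij; last by move=> p q; rewrite lee_fin le_max lexx orbT.
    by apply: eq_esum => q _; case: (k q) => //=; rewrite maxxx.
  by move=> p _; case: (h p) => //=; rewrite maxxx.
rewrite -[LHS](@eq_esum _ _ _ (fun p => oapp (fun q => (Num.max (- a p q) 0)%:E) 0%E (h p))).
  rewrite esum_partial_bij; last by move=> p q; rewrite lee_fin le_max lexx orbT.
  by apply: eq_esum => q _; case: (k q) => //=; rewrite oppr0 maxxx.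
by move=> p _; case: (h p) => //=; rewrite oppr0 maxxx.
Qed.

Lemma csum_partial_bij (a : T -> T -> R[i]) :
  csum D (fun p => oapp (a p) 0 (h p)) = csum D (fun q => oapp (a^~ q) 0 (k q)).
Proof.
rewrite /csum; congr (_ +i* _).
  rewrite -[LHS](@eq_rsum _ _ _ (fun p => oapp (fun q => complex.Re (a p q)) 0 (h p))).
    by rewrite rsum_partial_bij; apply: eq_rsum => q _; case: (k q).
  by move=> p _; case: (h p).
rewrite -[LHS](@eq_rsum _ _ _ (fun p => oapp (fun q => complex.Im (a p q)) 0 (h p))).
  by rewrite rsum_partial_bij; apply: eq_rsum => q _; case: (k q).
by move=> p _; case: (h p).
Qed.

End Reindex.

(** * The $C_0(V)$-valued inner product *)

Section Inner.
Variables (R : realType) (G : ugraph).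
Implicit Types (x y z : fock R G) (S T : fop R G).

Lemma finner_bounded x y v : cabs_bounded [set p : gpath G | ptgt p = v]
  (fun p => conjc (x p) * y p) (fnorm x * fnorm y).
Proof.
move=> X uX XD.
have hx := seq_le_fnorm x uX XD; have hy := seq_le_fnorm y uX XD.
have [x0|x0] := eqVneq (fnorm x) 0.
  rewrite x0 mul0r big1 // => p _.
  by rewrite (fnorm_eq0 x0) conjc0 mul0r cabs0.
have [y0|y0] := eqVneq (fnorm y) 0.
  by rewrite y0 mulr0 big1 // => p _; rewrite (fnorm_eq0 y0) mulr0 cabs0.
have xp : 0 < fnorm x by rewrite lt_neqAle fnorm_ge0 eq_sym x0.
have yp : 0 < fnorm y by rewrite lt_neqAle fnorm_ge0 eq_sym y0.
(* This weight in the arithmetic-geometric inequality makes both halves equal to half of the product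
   of the norms. *)
set t := fnorm y / fnorm x; have t0 : 0 < t by rewrite divr_gt0.
apply: (@le_trans _ _ (\sum_(p <- X) (t / 2 * cabs (x p) ^+ 2 +
    t^-1 / 2 * cabs (y p) ^+ 2))).
  apply: ler_sum => p _; rewrite cabsM cabs_conj -subr_ge0.
  have -> : t / 2 * cabs (x p) ^+ 2 + t^-1 / 2 * cabs (y p) ^+ 2 -
     cabs (x p) * cabs (y p) = (t * cabs (x p) - cabs (y p)) ^+ 2 / (2 * t).
    by field; rewrite gt_eqF.
  by rewrite divr_ge0 ?sqr_ge0 // mulr_ge0 // ltW.
rewrite big_split /= -!mulr_sumr.
have -> : fnorm x * fnorm y = t / 2 * fnorm x ^+ 2 + t^-1 / 2 * fnorm y ^+ 2.
  by rewrite /t; field; rewrite x0 y0.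
by rewrite lerD // ler_wpM2l // divr_ge0 // ?invr_ge0 ltW.
Qed.

Lemma finnerDr x y z v : finner x (y + z) v = finner x y v + finner x z v.
Proof.
rewrite /finner -(csumD (@finner_bounded x y v) (@finner_bounded x z v)).
by apply: csum_ext => p _; rewrite fockDE mulrDr.
Qed.

Lemma finnerZr (k : R[i]) x y v : finner x (k *: y) v = k * finner x y v.
Proof.
rewrite /finner -(csumZ k (@finner_bounded x y v)).
by apply: csum_ext => p _; rewrite fockZE mulrCA.
Qed.

Lemma finner_conj x y v : finner y x v = conjc (finner x y v).
Proof.
rewrite /finner -csum_conj; apply: csum_ext => p _.
by rewrite rmorphM /= conjcK mulrC.
Qed.

Lemma finnerBr x y z v : finner x (y - z) v = finner x y v - finner x z v.
Proof. by rewrite finnerDr -scaleN1r finnerZr mulN1r. Qed.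

Lemma finnerBl x y z v : finner (x - y) z v = finner x z v - finner y z v.
Proof.
rewrite finner_conj finnerBr (finner_conj z x) (finner_conj z y).
by rewrite (rmorphB (@conjc R)).
Qed.

Lemma finner_le x y v : cabs (finner x y v) <= 2 * (fnorm x * fnorm y).
Proof. exact: csum_le (@finner_bounded x y v). Qed.

Lemma finner_self x v : finner x x v = (fine (sqnorm_at v x))%:C.
Proof.
have e p : conjc (x p) * x p = (cabs (x p) ^+ 2)%:C.
  rewrite cabs2E; case: (x p) => a b /=.
  by apply/eqP; rewrite eq_complex /=; apply/andP; split; apply/eqP; ring.
rewrite /finner /csum; congr (_ +i* _).
  rewrite (@rsum_diff _ _ _ _ (fun p => cabs (x p) ^+ 2) (fun=> 0) (fnorm x ^+ 2)).
  - by rewrite [X in _ - fine X]esum1 //= subr0.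
  - by move=> p; exact: sqr_ge0.
  - by [].
  - exact: (sqnorm_le_fnorm v x).
  - by rewrite esum1 // lee_fin sqr_ge0.
  - by move=> p _; rewrite e subr0.
rewrite (@rsum_diff _ _ _ _ (fun=> 0) (fun=> 0) 0) ?subrr //.
  by rewrite esum1.
  by rewrite esum1.
by move=> p _; rewrite e.
Qed.

Definition dvec_fun q : gpath G -> R[i]^o := fun p => (p == q)%:R.

Lemma dvec_fock q : dvec_fun q \in @fock_pred R G.
Proof.
have h w : sqnorm_at w (dvec_fun q) = ((w == ptgt q)%:R)%:E.
  rewrite /sqnorm_at (esumID [set q]); last first.
    by move=> *; rewrite lee_fin sqr_ge0.
  rewrite [X in (_ + X)%E]esum1 ?adde0; last first.
    by move=> p [_ /= /eqP/negPf pv]; rewrite /dvec_fun pv cabs0 expr0n.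
  case: eqP => [->|wv].
    rewrite (_ : _ `&` _ = [set q]); last first.
      by apply/seteqP; split=> [p []|p ->].
    rewrite esum_set1 ?lee_fin ?sqr_ge0 // /dvec_fun eqxx cabs2E /=.
    by rewrite expr1n expr0n addr0.
  rewrite (_ : _ `&` _ = set0) ?esum_set0 // -subset0 => p [/= + pv].
  by rewrite pv => /esym.
rewrite inE; split=> [w|eps eps0]; first by rewrite h ltry.
apply: (sub_finite_set _ (finite_set1 (ptgt q))) => w /=; rewrite h lee_fin.
by case: eqP => //= _; rewrite leNgt eps0.
Qed.

Definition dvec q : fock R G := Fock (dvec_fock q).

Lemma dvecE q p : dvec q p = (p == q)%:R. Proof. by []. Qed.

Lemma pvec_dvec v : pvec R v = dvec (pnil v).
Proof. exact: fock_eq. Qed.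

Lemma finner_dvec q x v : finner (dvec q) x v = if ptgt q == v then x q else 0.
Proof.
rewrite /finner; case: eqP => qv.
  rewrite (@csum_supp1 _ _ _ _ q) //; first by rewrite dvecE eqxx conjc1 mul1r.
  by move=> p _ /eqP/negPf pq; rewrite dvecE pq conjc0 mul0r.
have -> : csum [set p | ptgt p = v] (fun p => conjc (dvec q p) * x p) =
          csum [set p | ptgt p = v] (fun p => 0 * 0).
  apply: csum_ext => p pv; rewrite dvecE; case: eqP => [pq|_].
    by case: qv; rewrite -pq.
  by rewrite conjc0 mul0r mul0r.
rewrite (@csumZ _ _ _ 0 _ 0) ?mul0r // => X _ _.
by rewrite big1 // => p _; rewrite cabs0.
Qed.

Lemma finner_inj x y : (forall z v, finner z x v = finner z y v) -> x = y.
Proof.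
move=> h; apply: fock_eq => p.
by have := h (dvec p) (ptgt p); rewrite !finner_dvec eqxx.
Qed.

Definition bounded_by (K : R) S := forall x, fnorm (S x) <= K * fnorm x.

Lemma is_adjointP S T : is_adjoint S T <->
  forall x y v, finner (S x) y v = finner x (T y) v.
Proof.
split=> [h x y v|h x y]; first by rewrite h.
by apply/funext => v; rewrite h.
Qed.

Lemma is_adjoint_sym S T : is_adjoint S T -> is_adjoint T S.
Proof.
move=> /is_adjointP h; apply/is_adjointP => x y v.
by rewrite finner_conj -h -finner_conj.
Qed.

(** Operators are arbitrary self-maps, so linearity is derived: the values of [S] are determined by
    inner products against [T z], which are linear. *)
Lemma adjoint_linear S T (k : R[i]) x y : is_adjoint S T ->
  S (k *: x + y) = k *: S x + S y.
Proof.
move=> /is_adjoint_sym /is_adjointP h; apply: finner_inj => z v.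
by rewrite -h !finnerDr !finnerZr -!h.
Qed.

Lemma adjoint_unique S T T' : is_adjoint S T -> is_adjoint S T' -> T = T'.
Proof.
move=> /is_adjointP h /is_adjointP h'; apply/funext => y.
by apply: finner_inj => z v; rewrite -h -h'.
Qed.

Lemma adjoint_comb (k : R[i]) S S' T T' : is_adjoint S T -> is_adjoint S' T' ->
  is_adjoint (k *: S + S') (conjc k *: T + T').
Proof.
move=> /is_adjointP h /is_adjointP h'; apply/is_adjointP => x y v.
rewrite [RHS]finnerDr finnerZr -h -h' [LHS]finner_conj.
rewrite [X in conjc X](_ : _ = finner y (k *: S x + S' x) v) //.
rewrite finnerDr finnerZr (finner_conj y (S x)) (finner_conj y (S' x)).
by rewrite (rmorphD (@conjc R)) (rmorphM (@conjc R)).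
Qed.

Lemma adjoint_comp S S' T T' : is_adjoint S T -> is_adjoint S' T' ->
  is_adjoint (S \o S') (T' \o T).
Proof.
move=> /is_adjointP h /is_adjointP h'; apply/is_adjointP => x y v /=.
by rewrite h h'.
Qed.

(** From <T y, T y> = <S (T y), y>. Only a bound on [S] at the single vector [T y] enters, so the
    argument also works for operators whose bound is known only on the domain of N. *)
Lemma adjoint_bounded_at S T K y : 0 <= K -> is_adjoint S T ->
  fnorm (S (T y)) <= K * fnorm (T y) -> fnorm (T y) <= 2 * K * fnorm y.
Proof.
move=> K0 /is_adjointP h bS.
have : fnorm (T y) ^+ 2 <= 2 * K * fnorm y * fnorm (T y).
  have c0 : 0 <= 2 * K * fnorm y * fnorm (T y).
    by rewrite !mulr_ge0 ?fnorm_ge0.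
  rewrite -(sqr_sqrtr c0) ler_pXn2r ?nnegrE ?sqrtr_ge0 ?fnorm_ge0 //.
  apply: fnorm_le_sqnorm => [|v]; first exact: sqrtr_ge0.
  rewrite sqr_sqrtr // sqnorm_val lee_fin.
  have := finner_le (S (T y)) y v; rewrite h finner_self cabs_real ger0_norm.
    move=> /le_trans; apply; rewrite -!mulrA ler_wpM2l //.
    by rewrite (mulrC (fnorm y) (fnorm (T y))) mulrA ler_wpM2r ?fnorm_ge0.
  by rewrite fine_ge0 // sqnorm_ge0.
have [->|n0] := eqVneq (fnorm (T y)) 0; first by rewrite !mulr_ge0 ?fnorm_ge0.
by rewrite expr2 ler_pM2r // lt_neqAle eq_sym n0 fnorm_ge0.
Qed.

Lemma adjoint_bounded S T K : 0 <= K -> is_adjoint S T -> bounded_by K S ->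
  bounded_by (2 * K) T.
Proof. by move=> K0 ST bS y; exact: adjoint_bounded_at ST (bS (T y)). Qed.

(** Adjointable maps respect the right action of $C_0(V)$: the value of [S x] at [p] is the inner
    product of [T (dvec p)] and [x] at the end of [p], which involves only paths with that end. *)
Lemma adjoint_ptgt S T x v : is_adjoint S T ->
  (forall p, ptgt p <> v -> x p = 0) -> forall p, ptgt p <> v -> S x p = 0.
Proof.
move=> /is_adjoint_sym /is_adjointP h xv p pv.
have := h (dvec p) x (ptgt p); rewrite finner_dvec eqxx => <-.
rewrite -(mul0r (finner x x (ptgt p))) /finner.
rewrite -(csumZ 0 (@finner_bounded x x (ptgt p))); apply: csum_ext => q qp.
by rewrite mul0r xv ?mulr0 // qp.
Qed.

Lemma pull_op_bounded h htgt hinj : bounded_by 1 (@pull_op R G h htgt hinj).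
Proof.
move=> x; rewrite mul1r; apply: fnorm_le => [|v X uX XD]; first exact: fnorm_ge0.
pose Y := pmap h X.
have -> : \sum_(p <- X) cabs (pull_op htgt hinj x p) ^+ 2 =
          \sum_(q <- Y) cabs (x q) ^+ 2.
  rewrite /Y; elim: (X) => [|p X' IH]; first by rewrite !big_nil.
  rewrite big_cons IH /= /pull; case: (h p) => [q|]; first by rewrite big_cons.
  by rewrite [oapp _ _ _]/= cabs0 expr0n add0r.
apply: (seq_le_fnorm (v := v)) => [|q].
  rewrite /Y; elim: (X) uX => //= p X' IH /andP[pX uX].
  case hp: (h p) => [q|] /=; last exact: IH.
  rewrite IH // andbT mem_pmap; apply: contra pX => /mapP [r rX rq].
  by rewrite (hinj p r q).
rewrite mem_pmap => /mapP [p pX /esym hp]; rewrite -(htgt _ _ hp); exact: XD.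
Qed.

Lemma pull_op_adjoint h htgt hinj k ktgt kinj :
  (forall p q, h p = Some q <-> k q = Some p) ->
  is_adjoint (@pull_op R G h htgt hinj) (@pull_op R G k ktgt kinj).
Proof.
move=> hk; apply/is_adjointP => x y v.
have hD p q : h p = Some q -> [set r | ptgt r = v] p <-> [set r | ptgt r = v] q.
  by move=> /htgt /= ->.
have := csum_partial_bij hk hD (fun p q => conjc (x q) * y p).
rewrite /finner => e.
transitivity (csum [set p | ptgt p = v]
    (fun p => oapp (fun q => conjc (x q) * y p) 0 (h p))).
  apply: csum_ext => p _ /=; rewrite /pull.
  by case: (h p) => [q|]; [|rewrite [oapp x _ _]/= conjc0 mul0r].
rewrite e; apply: csum_ext => p _ /=; rewrite /pull.
by case: (k p) => [q|]; [|rewrite [oapp y _ _]/= mulr0].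
Qed.

Lemma fproj_adjoint v : is_adjoint (fproj R v) (@fproj R G v).
Proof.
apply: pull_op_adjoint => p q; rewrite /fproj_map.
by split; case: eqP => // pv [<-]; rewrite pv eqxx.
Qed.

Lemma pcons_puncons (e : dedge G) p q : pcons e q = Some p <-> puncons e p = Some q.
Proof.
split.
  move=> /[dup] /pconsP [pv qe] _.
  case: p pv => -[v s] ws /= [ev es]; subst v s.
  rewrite /puncons /= eqxx; rewrite -qe.
  by rewrite (_ : (psrc q, _) = val q) ?valK //; case: q {qe ws} => -[].
move=> /[dup] /punconsP [pv qe] _.
rewrite /pcons qe eqxx -pv.
by rewrite (_ : pval p = val p) ?valK.
Qed.

Lemma creat_adjoint (e : dedge G) : is_adjoint (creat R e) (annih R e).
Proof.
apply: pull_op_adjoint => p q.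
by split=> /pcons_puncons.
Qed.

Lemma fproj_linear v (k : R[i]) x y :
  fproj R v (k *: x + y) = k *: fproj R v x + fproj R v y.
Proof. exact: pull_op_lin. Qed.

End Inner.

Arguments dvec R {G} q.

(** * Completeness, with explicit rates *)

Section Completeness.
Variables (R : realType) (G : ugraph).

(** The intervals [a n - r n, a n + r n] meet pairwise, so the supremum of their left ends lies in
    all of them. The rate [r] is kept for the limit. *)
Lemma real_cauchy_limit (a r : nat -> R) :
  (forall n m, (n <= m)%N -> `|a m - a n| <= r n) ->
  exists l, forall n, `|l - a n| <= r n.
Proof.
move=> h.
have r0 n : 0 <= r n by apply: le_trans (h n n (leqnn n)).
have cross n m : a n - r n <= a m + r m.
  case: (leqP n m) => [/h|/ltnW /h]; rewrite ler_norml; have := r0 n; have := r0 m; lra.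
exists (sup (range (fun n => a n - r n))) => n.
have hs : has_sup (range (fun n => a n - r n)).
  split; first by exists (a 0%N - r 0%N), 0%N.
  by exists (a 0%N + r 0%N) => _ [m _ <-]; exact: cross.
have lb : a n - r n <= sup (range (fun n => a n - r n)).
  by apply: ub_le_sup; [case: hs|exists n].
have ub : sup (range (fun n => a n - r n)) <= a n + r n.
  by apply: ge_sup; [case: hs|move=> _ [m _ <-]; exact: cross].
by rewrite ler_norml; move: lb ub; lra.
Qed.

Lemma complex_cauchy_limit (a : nat -> R[i]) (r : nat -> R) :
  (forall n m, (n <= m)%N -> cabs (a m - a n) <= r n) ->
  exists l, forall n, cabs (l - a n) <= 2 * r n.
Proof.
move=> h.
have [lr hr] : exists l, forall n, `|l - complex.Re (a n)| <= r n.
  apply: real_cauchy_limit => n m nm; apply: le_trans (h n m nm).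
  by apply: le_trans (Re_le_cabs _); case: (a n); case: (a m).
have [li hi] : exists l, forall n, `|l - complex.Im (a n)| <= r n.
  apply: real_cauchy_limit => n m nm; apply: le_trans (h n m nm).
  by apply: le_trans (Im_le_cabs _); case: (a n); case: (a m).
exists (lr +i* li) => n.
have -> : lr +i* li - a n = (lr - complex.Re (a n))%:C + 'i%C * (li - complex.Im (a n))%:C.
  by rewrite [LHS]complexE; case: (a n).
apply: le_trans (cabsD _ _) _; rewrite cabsM !cabs_real.
have -> : cabs ('i%C : R[i]) = 1 by rewrite /cabs /= expr0n expr1n add0r sqrtr1.
by rewrite mul1r mulr_natl mulr2n lerD.
Qed.

Lemma fock_complete (u : nat -> fock R G) (r : nat -> R) :
  (forall n m, (n <= m)%N -> fnorm (u m - u n) <= r n) ->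
  (forall e : R, 0 < e -> exists n, r n <= e) ->
  exists x, forall n, fnorm (x - u n) <= r n.
Proof.
move=> h rlim.
have r0 n : 0 <= r n by apply: le_trans (h n n (leqnn n)); exact: fnorm_ge0.
have [f hf] : {f : gpath G -> R[i] &
    forall p n, cabs (f p - u n p) <= 2 * r n}.
  apply: (@boolp.choice _ _ (fun p l => forall n, cabs (l - u n p) <= 2 * r n)) => p.
  apply: complex_cauchy_limit => n m nm.
  by apply: le_trans (h n m nm); exact: (cabs_le_fnorm (u m - u n)).
have fX n v X : uniq X -> (forall p, p \in X -> ptgt p = v) ->
    \sum_(p <- X) cabs (f p - u n p) ^+ 2 <= r n ^+ 2.
  move=> uX XD.
  set S := \sum_(p <- X) _.
  have S0 : 0 <= S by apply: sumr_ge0 => p _; exact: sqr_ge0.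
  suff : Num.sqrt S <= r n.
    by rewrite -(ler_pXn2r (n := 2)) ?nnegrE ?sqrtr_ge0 // sqr_sqrtr.
  apply/ler_addgt0Pr => e e0.
  rewrite -(ler_pXn2r (n := 2)) ?nnegrE ?sqrtr_ge0 ?addr_ge0 ?(ltW e0) // sqr_sqrtr //.
  pose s := (size X)%:R : R.
  have s0 : 0 < s + 1 by rewrite ltr_wpDl.
  (* Each coordinate of the limit is within 3 r(m0) of that of [u m]; over the entries of the finite
     list [X] these errors amount to at most e in l^2. *)
  have [m0 hm0] := rlim (e / (3 * (s + 1))) (divr_gt0 e0 (mulr_gt0 (ltr0Sn R 2) s0)).
  pose m := maxn m0 n.
  have fm p : cabs (f p - u m p) <= 3 * r m0 .
    have -> : f p - u m p = (f p - u m0 p) - (u m p - u m0 p) by ring.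
    apply: le_trans (cabsD _ _) _; rewrite cabsN.
    have := hf p m0; have := le_trans (cabs_le_fnorm (u m - u m0) p) (h m0 m (leq_maxl _ _)).
    rewrite fockBE; lra.
  rewrite addrC /S.
  under eq_bigr => p _.
    rewrite (_ : f p - u n p = (f p - u m p) + (u m p - u n p)); last by ring.
    over.
  apply: minkowski2 => //; first exact: ltW.
    apply: (@le_trans _ _ (\sum_(p <- X) (3 * r m0) ^+ 2)).
      by apply: ler_sum => p _; rewrite ler_pXn2r ?nnegrE ?cabs_ge0 ?mulr_ge0.
    rewrite big_const_seq count_predT iter_addr_0 -(mulr_natr (_ ^+ 2)) -/s.
    apply: (@le_trans _ _ ((3 * r m0 * (s + 1)) ^+ 2)).
      rewrite [leRHS]exprMn ler_wpM2l ?sqr_ge0 //.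
      have : 0 <= s by []. nra.
    rewrite ler_pXn2r ?nnegrE ?mulr_ge0 ?(ltW e0) ?(ltW s0) //.
    by move: hm0; rewrite ler_pdivlMr ?mulr_gt0 // mulrCA mulrA.
  apply: le_trans (seq_le_fnorm (u m - u n) uX XD) _.
  by rewrite ler_pXn2r ?nnegrE ?fnorm_ge0 // h // leq_maxr.
have fS n v : (sqnorm_at v (fun p => f p - u n p)%R <= (r n ^+ 2)%:E)%E.
  exact: (@esum_le_seq _ _ _ (fun p => cabs (f p - u n p) ^+ 2)) (fX n v).
have fS2 n v : (sqnorm_at v f <= 2%:E * ((r n ^+ 2)%:E + sqnorm_at v (u n)))%E.
  have := sqnorm_atD v (fun p => f p - u n p) (u n).
  rewrite (_ : (fun p => f p - u n p) + u n = f :> (gpath G -> R[i]^o)).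
    by move=> /le_trans; apply; apply: lee_wpmul2l => //; apply: leeD.
  by apply/funext => p; rewrite /= -[LHS]/(f p - u n p + u n p) subrK.
have ff : (f : gpath G -> R[i]^o) \in @fock_pred R G.
  rewrite inE; split=> [v|e e0].
    by apply: le_lt_trans (fS2 0%N v) _; rewrite sqnorm_val -EFinD -EFinM ltry.
  (* Then (r n)^2 <= e/8, so by [fS2] a value of at least e for the limit forces a value of at least
     e/4 for [u n], which happens at finitely many vertices only. *)
  have m8 : 0 < Num.min 1 (e / 8) by rewrite lt_min ltr01 divr_gt0.
  have [n hn] := rlim _ m8.
  have : finite_set [set v | ((e / 4)%:E <= sqnorm_at v (u n))%E].
    by have := fvalP (u n); rewrite inE => -[_]; apply; rewrite divr_gt0.
  apply: sub_finite_set => v /= ev; rewrite sqnorm_val lee_fin.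
  have := le_trans ev (fS2 n v); rewrite sqnorm_val -EFinD -EFinM lee_fin.
  move: hn; rewrite le_min => /andP[r1 r8]; have := r0 n; nra.
exists (Fock ff) => n; apply: fnorm_le => // v X uX XD.
exact: (fX n v).
Qed.

Lemma fop_complete (S : nat -> fop R G) (r : nat -> R) :
  (forall n m, (n <= m)%N -> forall x, fnorm (S m x - S n x) <= r n * fnorm x) ->
  (forall e : R, 0 < e -> exists n, r n <= e) ->
  exists T : fop R G, forall n x, fnorm (T x - S n x) <= r n * fnorm x.
Proof.
move=> h rlim.
have [T hT] : {T : fop R G & forall x n, fnorm (T x - S n x) <= r n * fnorm x}.
  apply: (@boolp.choice _ _ (fun x y => forall n, fnorm (y - S n x) <= r n * fnorm x)) => x.
  apply: (@fock_complete (fun n => S n x) (fun n => r n * fnorm x)).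
    by move=> n m nm; exact: h.
  move=> e e0; have x0 : 0 < fnorm x + 1 by rewrite ltr_wpDl ?fnorm_ge0.
  have [n hn] := rlim (e / (fnorm x + 1)) (divr_gt0 e0 x0).
  exists n; move: hn; rewrite ler_pdivlMr // => hn.
  by case: (lerP 0 (r n)); have := fnorm_ge0 x; nra.
by exists T => n x; exact: hT.
Qed.

End Completeness.

(** * Adjointable operators *)

Section AdjointableOperators.
Variables (R : realType) (G : ugraph).
Implicit Types (x y z : fock R G) (S T U : fop R G).

(** A C*-algebra containing the generators. By minimality of [graph_algebra], all its elements are
    linear, bounded and have an adjoint. *)
Definition adjointable S :=
  (exists T, is_adjoint S T) /\ (exists2 K, 0 <= K & bounded_by K S).

Lemma fopDE S T x : (S + T) x = S x + T x. Proof. by []. Qed.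
Lemma fopZE (k : R[i]) S x : (k *: S) x = k *: S x. Proof. by []. Qed.
Lemma fopNE S x : (- S) x = - S x. Proof. by []. Qed.
Lemma fop0E x : (0 : fop R G) x = 0. Proof. by []. Qed.
Lemma fop_sumE (I : Type) (r : seq I) (P : pred I) (F : I -> fop R G) x :
  (\sum_(i <- r | P i) F i) x = \sum_(i <- r | P i) F i x.
Proof. by elim/big_rec2: _ => // i y z _ <-. Qed.

Lemma conjcN1 : conjc (-1 : R[i]) = -1.
Proof. by apply/eqP; rewrite eq_complex /= !oppr0 !eqxx. Qed.

Lemma bounded_comb (k : R[i]) S T K L : bounded_by K S -> bounded_by L T ->
  bounded_by (cabs k * K + L) (k *: S + T).
Proof.
move=> hS hT x; rewrite fopDE fopZE mulrDl; apply: le_trans (fnormD _ _) _.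
by rewrite lerD // fnormZ -mulrA ler_wpM2l ?cabs_ge0.
Qed.

Lemma bounded_comp S T K L : 0 <= K -> bounded_by K S -> bounded_by L T ->
  bounded_by (K * L) (S \o T).
Proof.
move=> K0 hS hT x /=; apply: le_trans (hS _) _.
by rewrite -mulrA ler_wpM2l.
Qed.

Lemma adjoint_limit T U :
  (forall e : R, 0 < e -> exists S S', [/\ is_adjoint S S',
     forall x, fnorm (T x - S x) <= e * fnorm x &
     forall x, fnorm (U x - S' x) <= e * fnorm x]) ->
  is_adjoint T U.
Proof.
move=> h; apply/is_adjointP => x y v; apply/eqP; rewrite -subr_eq0; apply/eqP.
apply: cabs_eq0; apply/eqP; rewrite eq_le cabs_ge0 andbT.
apply/ler_addgt0Pl => e e0; rewrite addr0.
have c0 : 0 < 4 * (fnorm x * fnorm y) + 1.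
  by rewrite ltr_wpDl // !mulr_ge0 ?fnorm_ge0.
have [S [S' [/is_adjointP SS' hS hS']]] := h _ (divr_gt0 e0 c0).
set d := e / _ in hS hS'.
have -> : finner (T x) y v - finner x (U y) v =
   finner (T x - S x) y v - finner x (U y - S' y) v.
  by rewrite finnerBl finnerBr SS'; ring.
apply: le_trans (cabsD _ _) _; rewrite cabsN.
have d0 : 0 <= d by rewrite divr_ge0 // ltW.
apply: (@le_trans _ _ (2 * (d * fnorm x * fnorm y) + 2 * (fnorm x * (d * fnorm y)))).
  apply: lerD; apply: le_trans (finner_le _ _ _) _; rewrite ler_wpM2l //.
    by rewrite ler_wpM2r ?fnorm_ge0 // hS.
  by rewrite ler_wpM2l ?fnorm_ge0 // hS'.
have -> : 2 * (d * fnorm x * fnorm y) + 2 * (fnorm x * (d * fnorm y)) =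
  d * (4 * (fnorm x * fnorm y)) by ring.
have : e = d * (4 * (fnorm x * fnorm y) + 1) by rewrite /d divfK // gt_eqF.
by move=> ->; rewrite ler_wpM2l // lerDl.
Qed.

Lemma adjointable_lin (k : R[i]) S T :
  adjointable S -> adjointable T -> adjointable (k *: S + T).
Proof.
move=> [[S' SS'] [K K0 hK]] [[T' TT'] [L L0 hL]]; split.
  by exists (conjc k *: S' + T'); exact: adjoint_comb.
exists (cabs k * K + L); last exact: bounded_comb.
by rewrite addr_ge0 // mulr_ge0 // cabs_ge0.
Qed.

Lemma adjointable_comp S T :
  adjointable S -> adjointable T -> adjointable (S \o T).
Proof.
move=> [[S' SS'] [K K0 hK]] [[T' TT'] [L L0 hL]]; split.
  by exists (T' \o S'); exact: adjoint_comp.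
by exists (K * L); [rewrite mulr_ge0|exact: bounded_comp].
Qed.

Lemma adjointable_adj S T : adjointable S -> is_adjoint S T -> adjointable T.
Proof.
move=> [_ [K K0 hK]] ST; split; first by exists S; exact: is_adjoint_sym.
by exists (2 * K); [rewrite mulr_ge0|exact: adjoint_bounded ST hK].
Qed.

Lemma invn_small (e : R) : 0 < e -> exists n : nat, n.+1%:R^-1 <= e.
Proof.
move=> e0; exists (Num.truncn e^-1).
rewrite -[leRHS]invrK lef_pV2 ?posrE ?invr_gt0 //.
by apply: ltW; exact: truncnS_gt.
Qed.

(** By [adjoint_bounded] the adjoints of an approximating sequence are again Cauchy, at twice the
    rate; their limit is an adjoint of the limit. *)
Lemma adjointable_closed : norm_closed adjointable.
Proof.
move=> T hT.
have [S hS] : {S : nat -> fop R G & forall n, adjointable (S n) /\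
    forall x, fnorm (T x - S n x) <= n.+1%:R^-1 * fnorm x}.
  apply: (@boolp.choice _ _ (fun n S => adjointable S /\
     forall x, fnorm (T x - S x) <= n.+1%:R^-1 * fnorm x)) => n.
  by have [|S] := hT n.+1%:R^-1; [rewrite invr_gt0|exists S].
have [S' hS'] : {S' : nat -> fop R G & forall n, is_adjoint (S n) (S' n)}.
  apply: (@boolp.choice _ _ (fun n S' => is_adjoint (S n) S')) => n.
  by have [[]] := hS n.
pose r n : R := n.+1%:R^-1.
have r0 n : 0 <= r n by rewrite invr_ge0.
have SS n m : (n <= m)%N -> bounded_by (2 * r n) (S m - S n).
  move=> nm x; rewrite fopDE fopNE.
  apply: le_trans (fnorm_tri _ (T x) _) _; rewrite fnormB.
  apply: le_trans (lerD ((hS m).2 x) ((hS n).2 x)) _.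
  rewrite -mulrDl ler_wpM2r ?fnorm_ge0 // mulr_natl mulr2n lerD2r.
  by rewrite lef_pV2 ?posrE // ler_nat ltnS.
have SS' n m : (n <= m)%N -> bounded_by (4 * r n) (S' m - S' n).
  move=> nm; have -> : 4 * r n = 2 * (2 * r n) :> R by ring.
  apply: (@adjoint_bounded _ _ (S m - S n)); first by rewrite mulr_ge0.
    rewrite addrC -scaleN1r [S' m - _]addrC -(scaleN1r (S' n)).
    by rewrite -{2}conjcN1; apply: adjoint_comb.
  exact: SS.
have r4 (e : R) : 0 < e -> exists n, 4 * r n <= e.
  move=> e0; have [n hn] := invn_small (divr_gt0 e0 (ltr0Sn R 3)).
  by exists n; move: hn; rewrite ler_pdivlMr // mulrC.
have [U hU] := fop_complete (S := S') (r := fun n => 4 * r n) (fun n m nm x => SS' n m nm x) r4.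
split.
  exists U; apply: adjoint_limit => e e0; have [n hn] := r4 e e0.
  exists (S n), (S' n); split => // x.
    apply: le_trans ((hS n).2 x) _; rewrite ler_wpM2r ?fnorm_ge0 //.
    by apply: le_trans hn; rewrite ler_peMl // ler1n.
  by apply: le_trans (hU n x) _; rewrite ler_wpM2r ?fnorm_ge0.
have [_ [K K0 hK]] := (hS 0%N).1.
exists (r 0%N + K) => [|x]; first by rewrite addr_ge0.
have -> : T x = (T x - S 0%N x) + S 0%N x by rewrite subrK.
by apply: le_trans (fnormD _ _) _; rewrite mulrDl lerD // (hS 0%N).2.
Qed.

Lemma adjointable_cstar : cstar_algebra adjointable.
Proof.
split; last exact: adjointable_closed.
split; [exact: adjointable_lin|exact: adjointable_comp|exact: adjointable_adj].
Qed.

Lemma adjointable_fproj v : adjointable (fproj R v).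
Proof.
by split; [exists (fproj R v); exact: fproj_adjoint|exists 1 => //; exact: pull_op_bounded].
Qed.

Lemma adjointable_creat (e : dedge G) : adjointable (creat R e).
Proof.
by split; [exists (annih R e); exact: creat_adjoint|exists 1 => //; exact: pull_op_bounded].
Qed.

Lemma adjointable_annih (e : dedge G) : adjointable (annih R e).
Proof. exact: adjointable_adj (adjointable_creat e) (creat_adjoint e). Qed.

Lemma adjoint0 : is_adjoint (0 : fop R G) 0.
Proof.
apply/is_adjointP => x y v; rewrite !fop0E.
rewrite [LHS]finner_conj -(scale0r (0 : fock R G)) !finnerZr !mul0r.
exact: conjc0.
Qed.

Lemma adjointable0 : adjointable (0 : fop R G).
Proof.
split; first by exists 0; exact: adjoint0.
by exists 0 => // x; rewrite fop0E fnorm0 mul0r.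
Qed.

Lemma adjointable_Xop (mu : vert G -> R) (e : dedge G) : adjointable (Xop mu e).
Proof.
apply: adjointable_lin; first exact: adjointable_creat.
rewrite -[X in adjointable X]addr0; apply: adjointable_lin.
  exact: adjointable_annih.
exact: adjointable0.
Qed.

End AdjointableOperators.

(** * The loop algebra as a corner of the graph algebra *)

Section LoopAlgebra.
Variables (R : realType) (G : ugraph) (mu : vert G -> R) (v0 : vert G).
Implicit Types (x y z : fock R G) (S T U : fop R G).
Local Notation p0 := (@fproj R G v0).

Lemma graph_algebra_adjointable S : graph_algebra mu S -> adjointable S.
Proof.
move=> /(_ (@adjointable R G)); apply; split; first exact: adjointable_cstar.
move=> _ [[v _ <-]|[e _ <-]]; [exact: adjointable_fproj|exact: adjointable_Xop].
Qed.

Lemma loop_algebraP S : loop_algebra mu v0 S <->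
  graph_algebra mu S /\ p0 \o S \o p0 = S.
Proof.
split=> [[T gT <-]|[gS e]]; last by exists S.
have [[_ gM _] _] := graph_algebra_cstar mu.
have gp := @graph_algebra_proj R G mu v0.
split; first by apply: (gM (p0 \o T)) => //; apply: (gM p0).
apply/funext => x /=; have e := congr1 (fun f => f _) (@fproj_idem R G v0).
by rewrite -[p0 (p0 (T _))]/((p0 \o p0) _) -[p0 (p0 x)]/((p0 \o p0) x) !e.
Qed.

Lemma fproj_fproj v x : fproj R v (fproj R v x) = fproj R v x.
Proof. exact: (congr1 (fun f => f x) (@fproj_idem R G v)). Qed.

Lemma loop_left S x : loop_algebra mu v0 S -> p0 (S x) = S x.
Proof. by move=> [T _ <-] /=; rewrite fproj_fproj. Qed.

Lemma loop_right S x : loop_algebra mu v0 S -> S (p0 x) = S x.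
Proof. by move=> [T _ <-] /=; rewrite fproj_fproj. Qed.

Lemma loop_intro S : graph_algebra mu S ->
  (forall x, p0 (S x) = S x) -> (forall x, S (p0 x) = S x) ->
  loop_algebra mu v0 S.
Proof.
move=> gS l r; apply/loop_algebraP; split => //.
by apply/funext => x /=; rewrite r l.
Qed.

Lemma loop_graph S : loop_algebra mu v0 S -> graph_algebra mu S.
Proof. by case/loop_algebraP. Qed.

Lemma loop_lin (k : R[i]) S T : loop_algebra mu v0 S -> loop_algebra mu v0 T ->
  loop_algebra mu v0 (k *: S + T).
Proof.
have [_ h] := loop_submod mu v0.
by move=> lS lT; have := h k S T; rewrite !inE; apply.
Qed.

Lemma loop_comp S T : loop_algebra mu v0 S -> loop_algebra mu v0 T ->
  loop_algebra mu v0 (S \o T).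
Proof.
move=> lS lT; apply: loop_intro => [|x|x] /=.
- by have [[_ gM _] _] := graph_algebra_cstar mu; apply: (gM S); apply: loop_graph.
- by rewrite loop_left.
- by rewrite loop_right.
Qed.

Lemma loop_proj : loop_algebra mu v0 p0.
Proof. by have := loop_one_subproof mu v0; rewrite inE. Qed.

Lemma loop_adjointable S : loop_algebra mu v0 S -> adjointable S.
Proof. by move=> /loop_graph; exact: graph_algebra_adjointable. Qed.

Lemma loop_linear S (k : R[i]) x y : loop_algebra mu v0 S ->
  S (k *: x + y) = k *: S x + S y.
Proof. by move=> /loop_adjointable [[T ST] _]; exact: adjoint_linear ST. Qed.

Lemma adjoint_fproj S T : is_adjoint S T -> (forall x, S (p0 x) = S x) ->
  forall x, p0 (T x) = T x.
Proof.
move=> /is_adjointP ST h x; apply: finner_inj => z v.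
have /is_adjointP pp := @fproj_adjoint R G v0.
by rewrite -pp -!ST h.
Qed.

Lemma loop_adjoint S T : loop_algebra mu v0 S -> is_adjoint S T ->
  loop_algebra mu v0 T.
Proof.
move=> lS ST; apply: loop_intro => [|x|x].
- by have [[_ _ gA] _] := graph_algebra_cstar mu; apply: gA ST; apply: loop_graph.
- by apply: (adjoint_fproj ST) => y; rewrite loop_right.
- apply: finner_inj => z v.
  have /is_adjointP pp := @fproj_adjoint R G v0; have /is_adjointP ST' := ST.
  by rewrite -!ST' -pp loop_left.
Qed.

(** The two identities that characterize the corner pass to the limit because [p0] is a
    contraction. *)
Lemma loop_closed T : (forall e : R, 0 < e ->
    exists2 S, loop_algebra mu v0 S & forall x, fnorm (T x - S x) <= e * fnorm x) ->
  loop_algebra mu v0 T.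
Proof.
move=> h.
have small x y : (forall e : R, 0 < e -> fnorm (x - y) <= e) -> x = y.
  move=> xy; apply/eqP; rewrite -subr_eq0; apply/eqP/fnorm_eq0/eqP.
  rewrite eq_le fnorm_ge0 andbT; apply/ler_addgt0Pl => e e0.
  by rewrite addr0; exact: xy.
have p01 := @pull_op_bounded R G _ (@fproj_tgt G v0) (@fproj_inj G v0).
have p0B x y : p0 (x - y) = p0 x - p0 y.
  by rewrite addrC -scaleN1r fproj_linear scaleN1r addrC.
have ez x (e : R) : 0 < e -> exists2 d, 0 < d & e = d * (2 * (fnorm x + 1)).
  move=> e0; have x0 : 0 < 2 * (fnorm x + 1).
    by rewrite mulr_gt0 // ltr_wpDl // fnorm_ge0.
  by exists (e / (2 * (fnorm x + 1))); rewrite ?divr_gt0 // divfK // gt_eqF.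
apply: loop_intro => [|x|x].
- have [_ gC] := graph_algebra_cstar mu; apply: gC => e e0.
  by have [S lS hS] := h e e0; exists S => //; exact: loop_graph.
- apply: small => e e0; have [d d0 ->] := ez x e e0; have [S lS hS] := h _ d0.
  apply: le_trans (fnorm_tri _ (S x) _) _.
  have h1 : fnorm (p0 (T x) - S x) <= fnorm (T x - S x).
    by rewrite -{1}(loop_left x lS) -p0B; apply: le_trans (p01 _) _; rewrite mul1r.
  rewrite [X in _ + X]fnormB.
  apply: le_trans (lerD (le_trans h1 (hS x)) (hS x)) _.
  by rewrite -mulrDr ler_pM2l // mulrDr mulr_natl mulr2n lerDl mulr1.
- apply: small => e e0; have [d d0 ->] := ez x e e0; have [S lS hS] := h _ d0.
  apply: le_trans (fnorm_tri _ (S x) _) _.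
  have h1 : fnorm (T (p0 x) - S x) <= d * fnorm (p0 x).
    by rewrite -{1}(loop_right x lS) hS.
  rewrite [X in _ + X]fnormB; apply: le_trans (lerD h1 (hS x)) _.
  rewrite -mulrDr ler_pM2l // mulrDr mulr_natl mulr2n mulr1 -addrA lerD //.
    by have := p01 x; rewrite mul1r.
  by rewrite lerDl.
Qed.

End LoopAlgebra.

(** * Square roots and states *)

Section SquareRoot.
Variables (R : realType) (G : ugraph) (mu : vert G -> R) (v0 : vert G).
Implicit Types (x y z : fock R G) (S T U : fop R G).
Local Notation p0 := (@fproj R G v0).
Local Notation loop := (loop_algebra mu v0).
Local Notation half := ((2^-1 : R)%:C).

Variable h : fop R G.
Hypotheses (lh : loop h) (hh : is_adjoint h h) (bh : bounded_by 4^-1 h).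

(* The iteration converges to the solution [w] of [w = (h + w^2) / 2], so that
   [(1 - w)^2 = 1 - h]. *)
Let w n := iter n (fun S : fop R G => half *: (h + (S \o S))) 0.

Let wS n x : w n.+1 x = half *: (h x + w n (w n x)).
Proof. by []. Qed.

Let w0 x : w 0 x = 0. Proof. by []. Qed.

Let loop0 : loop 0.
Proof. by have [+ _] := loop_submod mu v0; rewrite inE. Qed.

Let loop_w n : loop (w n).
Proof.
elim: n => [|n IH]; first exact: loop0.
have -> : w n.+1 = half *: (1 *: h + (w n \o w n)) + 0 by rewrite scale1r addr0.
by apply: loop_lin => //; apply: loop_lin => //; exact: loop_comp.
Qed.

Let adj_w n : is_adjoint (w n) (w n).
Proof.
elim: n => [|n IH]; first exact: adjoint0.
have -> : w n.+1 = half *: (1 *: h + (w n \o w n)) + 0 by rewrite scale1r addr0.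
rewrite -{2}(conjc_real (2^-1 : R)) -{2}(conjc1 R).
apply: adjoint_comb; last exact: adjoint0.
by apply: adjoint_comb; [exact: hh|exact: adjoint_comp].
Qed.

Let bound_w n : bounded_by 4^-1 (w n).
Proof.
elim: n => [|n IH] x.
  by rewrite w0 fnorm0 mulr_ge0 ?fnorm_ge0.
rewrite wS fnormZ cabs_real ger0_norm ?invr_ge0 //.
have := fnormD (h x) (w n (w n x)); have := bh x; have := IH (w n x); have := IH x.
have := fnorm_ge0 x; nra.
Qed.

Let wB n x y : w n (x - y) = w n x - w n y.
Proof.
by rewrite addrC -scaleN1r (loop_linear _ _ _ (loop_w n)) scaleN1r addrC.
Qed.

(** With w' the next iterate after w, w'^2 - w^2 = w'(w' - w) + (w' - w)w. Since w and w' have norm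
    at most 1/4, increments shrink at least by the factor 1/2. *)
Let step_w n x : fnorm (w n.+1 x - w n x) <= 2^-1 ^+ n.+1 * fnorm x.
Proof.
elim: n x => [|n IH] x.
  rewrite wS !w0 subr0 addr0 fnormZ cabs_real ger0_norm ?invr_ge0 //.
  rewrite expr1 ler_wpM2l ?invr_ge0 //; apply: le_trans (bh x) _.
  by rewrite ler_piMl ?fnorm_ge0 // invf_le1 // ler1n.
rewrite wS [w n.+1 x in X in _ - X]wS -scalerBr fnormZ cabs_real ger0_norm ?invr_ge0 //.
rewrite [2^-1 ^+ n.+2]exprS -mulrA ler_wpM2l ?invr_ge0 //.
rewrite opprD addrACA subrr add0r.
have -> : w n.+1 (w n.+1 x) - w n (w n x) =
  w n.+1 (w n.+1 x - w n x) + (w n.+1 (w n x) - w n (w n x)).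
  by rewrite wB addrA subrK.
apply: le_trans (fnormD _ _) _.
have := bound_w n.+1 (w n.+1 x - w n x); have := IH x; have := IH (w n x).
have := bound_w n x; have := fnorm_ge0 x; have : 0 <= 2^-1 ^+ n.+1 :> R by rewrite exprn_ge0.
move: (2^-1 ^+ n.+1) (fnorm (w n.+1 (w n x) - w n (w n x))) (fnorm (w n.+1 x - w n x)) => r a b.
move: (fnorm (w n x)) (fnorm x) (fnorm (w n.+1 (w n.+1 x - w n x))) => c d e.
move=> r0 d0 hc hw hx hb.
have : r * c <= r * (4^-1 * d) by rewrite ler_wpM2l.
have : 0 <= r * d by rewrite mulr_ge0.
lra.
Qed.

Let cauchy_w n m : (n <= m)%N -> forall x, fnorm (w m x - w n x) <= 2^-1 ^+ n * fnorm x.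
Proof.
move=> nm x.
suff : fnorm (w m x - w n x) <= (2^-1 ^+ n - 2^-1 ^+ m) * fnorm x.
  move=> /le_trans; apply; rewrite ler_wpM2r ?fnorm_ge0 // gerBl.
  by rewrite exprn_ge0.
elim: m nm => [|m IH]; first by rewrite leqn0 => /eqP ->; rewrite !subrr fnorm0 mul0r.
rewrite leq_eqVlt => /predU1P[->|/IH {}IH]; first by rewrite !subrr fnorm0 mul0r.
apply: le_trans (fnorm_tri _ (w m x) _) _.
apply: le_trans (lerD (step_w m x) IH) _.
rewrite -mulrDl ler_wpM2r ?fnorm_ge0 // exprS; lra.
Qed.

Lemma exp2_small (e : R) : 0 < e -> exists n, 2^-1 ^+ n <= e :> R.
Proof.
move=> e0; have [n hn] := invn_small e0; exists n; apply: le_trans hn.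
by rewrite exprVn lef_pV2 ?posrE ?exprn_gt0 // -natrX ler_nat ltn_expl.
Qed.

Lemma loop_sqrt : exists2 z : fop R G, loop z /\ is_adjoint z z &
  forall x, z (z x) = p0 x - h x.
Proof.
have [W hW] := fop_complete cauchy_w exp2_small.
have lW : loop W.
  apply: loop_closed => e e0; have [n hn] := exp2_small e0.
  exists (w n) => // x; apply: le_trans (hW n x) _.
  by rewrite ler_wpM2r ?fnorm_ge0.
have aW : is_adjoint W W.
  apply: adjoint_limit => e e0; have [n hn] := exp2_small e0.
  by exists (w n), (w n); split => // x; apply: le_trans (hW n x) _;
    rewrite ler_wpM2r ?fnorm_ge0.
have bW x : fnorm (W x) <= fnorm x.
  by have := hW 0%N x; rewrite w0 subr0 expr0 mul1r.
have eqW x : 2 *: W x = h x + W (W x).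
  apply/eqP; rewrite -subr_eq0; apply/eqP/fnorm_eq0/eqP.
  rewrite eq_le fnorm_ge0 andbT; apply/ler_addgt0Pl => e e0; rewrite addr0.
  have x0 : 0 < 4 * (fnorm x + 1) by rewrite mulr_gt0 // ltr_wpDl // fnorm_ge0.
  have [n hn] := exp2_small (divr_gt0 e0 x0).
  (* The recursion for [w n.+1] is inserted, so that each of the three remaining terms is a distance
     from the limit, of order 2^-n. *)
  have -> : 2 *: W x - (h x + W (W x)) =
     2 *: (W x - w n.+1 x) + ((w n (w n x - W x)) - (W (W x) - w n (W x))).
    rewrite scalerBr wS wB scalerA.
    have -> : 2 * half = 1 :> R[i].
      by apply/eqP; rewrite eq_complex /=; apply/andP; split; apply/eqP; field.
    rewrite scale1r; apply: fock_eq => p; rewrite !(fockDE, fockNE, fockZE).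
    by move: (W x p) (h x p) => /= a b; ring.
  apply: le_trans (fnormD _ _) _.
  apply: le_trans (lerD (lexx _) (fnormD _ _)) _; rewrite fnormN fnormZ.
  have -> : cabs (2 : R[i]) = 2.
    rewrite (_ : (2 : R[i]) = (2 : R)%:C) ?cabs_real ?ger0_norm //.
    by rewrite rmorphMn.
  have := hW n.+1 x; have := bound_w n (w n x - W x); rewrite fnormB.
  have := hW n x; have := hW n (W x); have := bW x; have := fnorm_ge0 x.
  have : 0 <= 2^-1 ^+ n :> R by rewrite exprn_ge0.
  move: hn; rewrite ler_pdivlMr // exprS fnormB.
  move: (2^-1 ^+ n) (fnorm (W x - w n.+1 x)) => r a.
  move: (fnorm (W x - w n x)) (fnorm (w n (w n x - W x))) => c b.
  move: (fnorm (w n (W x) - W (W x))) (fnorm (W x)) (fnorm x) => d y t.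
  move=> h1 r0 t0 yt hd hc hb ha.
  have : r * y <= r * t by rewrite ler_wpM2l.
  have : 0 <= r * t by rewrite mulr_ge0.
  lra.
have WB x y : W (x - y) = W x - W y.
  by rewrite addrC -scaleN1r (loop_linear _ _ _ lW) scaleN1r addrC.
have lz : loop (-1 *: W + p0) by apply: loop_lin => //; exact: loop_proj.
exists (-1 *: W + p0) => [|x].
  split => //; rewrite -{2}conjcN1; apply: adjoint_comb => //.
  exact: fproj_adjoint.
have zE y : (-1 *: W + p0 : fop R G) y = p0 y - W y.
  by rewrite fopDE fopZE scaleN1r addrC.
rewrite [LHS]zE (loop_left _ lz) zE WB (loop_right _ lW).
have -> : h x = 2 *: W x - W (W x) by rewrite eqW addrK.
apply: fock_eq => p; rewrite !(fockDE, fockNE, fockZE).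
by move: (W x p) (W (W x) p) (p0 x p) => /= a b c; ring.
Qed.

End SquareRoot.

Lemma finnerZl (R : realType) (G : ugraph) (k : R[i]) (x y : fock R G) v :
  finner (k *: x) y v = conjc k * finner x y v.
Proof. by rewrite finner_conj finnerZr (finner_conj y x) (rmorphM (@conjc R)). Qed.

Lemma adjointZ (R : realType) (G : ugraph) (k : R[i]) (S T : fop R G) :
  is_adjoint S T -> is_adjoint (k *: S) (conjc k *: T).
Proof.
move=> /is_adjointP h; apply/is_adjointP => x y v.
by rewrite !fopZE finnerZl finnerZr h.
Qed.

(** * Boundedness and Cauchy-Schwarz for states *)

Section States.
Variables (R : realType) (G : ugraph) (mu : vert G -> R) (v0 : vert G).
Implicit Types (X Y : loop_alg mu v0) (phi : state mu v0).
Local Notation p0 := (@fproj R G v0).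
Local Notation one := (loop_one mu v0).

Lemma loop_algP X : loop_algebra mu v0 (lval X).
Proof. by have := lvalP X; rewrite inE. Qed.

Lemma loop_predI (S : fop R G) : loop_algebra mu v0 S -> S \in @loop_pred R G mu v0.
Proof. by rewrite inE. Qed.

Definition mkloop (S : fop R G) (lS : loop_algebra mu v0 S) : loop_alg mu v0 :=
  LoopAlg (loop_predI lS).

Definition lmul X Y : loop_alg mu v0 := mkloop (loop_comp (loop_algP X) (loop_algP Y)).

Lemma loop_alg_eq X Y : (forall x, lval X x = lval Y x) -> X = Y.
Proof. by move=> h; apply: val_inj; apply/funext. Qed.

Lemma lvalDE X Y x : lval (X + Y) x = lval X x + lval Y x. Proof. by []. Qed.
Lemma lvalNE X x : lval (- X) x = - lval X x. Proof. by []. Qed.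
Lemma lvalZE (k : R[i]) X x : lval (k *: X) x = k *: lval X x. Proof. by []. Qed.

Lemma lmulE X Y x : lval (lmul X Y) x = lval X (lval Y x). Proof. by []. Qed.
Lemma loneE x : lval one x = p0 x. Proof. by []. Qed.

Lemma lval_linear X (k : R[i]) x y : lval X (k *: x + y) = k *: lval X x + lval X y.
Proof. exact: loop_linear (loop_algP X). Qed.

Lemma lval_add X x y : lval X (x + y) = lval X x + lval X y.
Proof. by rewrite -[x]scale1r lval_linear !scale1r. Qed.

Lemma lval0 X : lval X 0 = 0.
Proof. by have := lval_linear X (-1) 0 0; rewrite scaler0 addr0 scaleN1r addNr. Qed.

Lemma lval_scale X (k : R[i]) x : lval X (k *: x) = k *: lval X x.
Proof. by rewrite -[k *: x]addr0 lval_linear lval0 addr0. Qed.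

(** A state is only assumed nonnegative on elements x^* x; the square root exhibits 1 - X in this
    form. *)
Lemma state_lt1 phi X : is_adjoint (lval X) (lval X) -> bounded_by 4^-1 (lval X) ->
  phi X <= 1.
Proof.
move=> aX bX; have [z [lz az] zz] := loop_sqrt (loop_algP X) aX bX.
have := @state_pos _ _ _ _ phi (mkloop lz) (one - X) z az.
rewrite linearB state_one subr_ge0; apply.
by apply/funext => x /=; rewrite zz.
Qed.

Lemma state_mul_ge0 phi X Y : is_adjoint (lval X) (lval Y) -> 0 <= phi (lmul Y X).
Proof. by move=> a; apply: (@state_pos _ _ _ _ phi X (lmul Y X) (lval Y) a). Qed.

(** The adjoint [Y] is bounded by 2K, so Y X is bounded by 2K^2; division by 8K^2 brings it into the
    range 1/4 of [state_lt1]. *)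
Lemma state_sq_bound phi X Y K : 0 < K -> is_adjoint (lval X) (lval Y) ->
  bounded_by K (lval X) -> complex.Re (phi (lmul Y X)) <= 8 * K ^+ 2.
Proof.
move=> K0 a b.
have K8 : 0 < 8 * K ^+ 2 by rewrite mulr_gt0 // exprn_gt0.
have : phi ((8 * K ^+ 2)^-1%:C *: lmul Y X) <= 1.
  have aM : is_adjoint (lval (lmul Y X)) (lval (lmul Y X)).
    exact: (adjoint_comp (is_adjoint_sym a) a).
  apply: state_lt1.
    have := adjointZ ((8 * K ^+ 2)^-1%:C) aM; rewrite conjc_real.
    by have -> : (8 * K ^+ 2)^-1%:C *: lval (lmul Y X) =
      lval ((8 * K ^+ 2)^-1%:C *: lmul Y X) by [].
  move=> x; rewrite lvalZE fnormZ cabs_real ger0_norm ?invr_ge0 ?(ltW K8) //.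
  rewrite mulrC ler_pdivrMr // mulrAC.
  have -> : 4^-1 * (8 * K ^+ 2) = (2 * K) * K :> R by field.
  have bY := adjoint_bounded (ltW K0) a b.
  have K2 : 0 <= 2 * K by rewrite mulr_ge0 // ltW.
  exact: (bounded_comp K2 bY b x).
rewrite linearZ /= lecE => /andP[_] /=.
case: (phi _) => r i /=.
by rewrite mul0r subr0 mulrC ler_pdivrMr // mul1r.
Qed.

Lemma state_cs phi X Y : is_adjoint (lval X) (lval Y) ->
  cabs (phi X) ^+ 2 <= complex.Re (phi (lmul Y X)).
Proof.
move=> a.
have pos (l : R[i]) : 0 <= phi (lmul Y X) - conjc l * phi X - l * phi Y + conjc l * l.
  have aa : is_adjoint (lval (X - l *: one)) (lval (Y - conjc l *: one)).
    rewrite (_ : lval (X - l *: one) = (- l) *: p0 + lval X); last first.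
      by apply/funext => x; rewrite fopDE fopZE addrC scaleNr.
    rewrite (_ : lval (Y - _) = conjc (- l) *: p0 + lval Y); last first.
      apply/funext => x; rewrite fopDE fopZE addrC.
      by rewrite (rmorphN (@conjc R)) scaleNr.
    by apply: adjoint_comb => //; exact: fproj_adjoint.
  have := state_mul_ge0 phi aa.
  have -> : lmul (Y - conjc l *: one) (X - l *: one) =
     lmul Y X - conjc l *: X - l *: Y + (conjc l * l) *: one.
    apply: loop_alg_eq => x; rewrite !(lmulE, lvalDE, lvalNE, lvalZE, loneE).
    have lX z : p0 (lval X z) = lval X z by exact: loop_left (loop_algP X).
    have rY z : lval Y (p0 z) = lval Y z by exact: loop_right (loop_algP Y).
    rewrite -!scaleNr lval_add lval_scale (addrC (lval X x)) fproj_linear.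
    rewrite lX fproj_fproj rY.
    apply: fock_eq => p; rewrite !(fockDE, fockNE, fockZE) /=.
    move: (lval Y x p) (lval Y (lval X x) p) (lval X x p) (p0 x p) => /= b c d e.
    by ring.
  by rewrite !linearD !linearN !linearZ /= state_one mulr1.
(* The values 0, 1 and i of [l] show that phi(Y X) is real and phi(Y) is the conjugate of phi(X);
   the optimal value phi(X) then gives the inequality. *)
move: (pos 0) (pos 1) (pos 'i%C) (pos (phi X)); move=> {pos}.
case: (phi (lmul Y X)) => a1 a2; case: (phi X) => u1 u2; case: (phi Y) => w1 w2.
rewrite cabs2E !lecE /=.
move=> /andP[/eqP h1 _] /andP[/eqP h2 _] /andP[/eqP h3 _] /andP[_ h4].
move: h1 h2 h3 h4; rewrite !(mul0r, mul1r, mulr0, mulr1, subr0, addr0, sub0r, add0r, oppr0, opprK) => h1 h2 h3 h4.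
nra.
Qed.

Lemma state_bounded phi X K : 0 < K -> bounded_by K (lval X) ->
  cabs (phi X) <= 3 * K.
Proof.
move=> K0 bX; have [[T XT] _] := loop_adjointable (loop_algP X).
pose Y := mkloop (loop_adjoint (loop_algP X) XT).
have aXY : is_adjoint (lval X) (lval Y) := XT.
rewrite -(ler_pXn2r (n := 2)) ?nnegrE ?cabs_ge0 ?mulr_ge0 ?(ltW K0) //.
apply: le_trans (state_cs phi aXY) _; apply: le_trans (state_sq_bound phi K0 aXY bX) _.
by rewrite exprMn ler_wpM2r ?sqr_ge0 // -natrX ler_nat.
Qed.

(** If r > k, then r/k = 1 + t with t > 0, and its powers outgrow every quadratic factor. *)
Lemma exp_growth (r k C : R) (d : nat) : 0 <= r -> 0 < k ->
  (forall n, r ^+ (2 ^ n) <= C * ((2 ^ n * d).+1%:R) ^+ 2 * k ^+ (2 ^ n)) -> r <= k.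
Proof.
move=> r0 k0 h; rewrite leNgt; apply/negP => kr.
have C0 : 0 <= C.
  have := le_trans (exprn_ge0 (2 ^ 0) r0) (h 0%N).
  by rewrite pmulr_lge0 ?exprn_gt0 // pmulr_lge0 ?exprn_gt0.
pose t := r / k - 1.
have t0 : 0 < t by rewrite subr_gt0 ltr_pdivlMr // mul1r.
have hM m : (2 ^ m)%:R * t ^+ 4 <= C * ((4 * d).+1%:R) ^+ 2.
  set M := (2 ^ m)%N; have M0 : (0 < M)%N by rewrite expn_gt0.
  have M1 : 1 <= M%:R :> R by rewrite ler1n.
  have : (M%:R * t) ^+ 4 <= C * (M%:R * ((4 * d).+1%:R)) ^+ 2.
    (* With the exponent 4M, the fourth power of Bernoulli's bound (1 + t)^M >= M t is of order M^4
       and beats the right side, which is of order M^2. *)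
    have := h (m.+2); have -> : (2 ^ m.+2 = M * 4)%N by rewrite !expnS /M; lia.
    have kM : 0 < k ^+ (M * 4) by rewrite exprn_gt0.
    rewrite -ler_pdivrMr // -expr_div_n => h'.
    apply: (@le_trans _ _ (C * ((M * 4 * d).+1%:R) ^+ 2)); last first.
      rewrite ler_wpM2l // ler_pXn2r ?nnegrE ?mulr_ge0 //.
      by rewrite -natrM ler_nat; nia.
    apply: le_trans h'; rewrite exprM ler_pXn2r ?nnegrE //; last 2 first.
      by rewrite mulr_ge0 // ltW.
      by rewrite exprn_ge0 // divr_ge0 // ltW.
    have -> : r / k = 1 + t by rewrite /t addrC subrK.
    elim: (M) => [|i IH]; first by rewrite mul0r.
    rewrite exprS -natr1 mulrDl mul1r.
    have e1 : 1 <= (1 + t) ^+ i.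
      by rewrite exprn_ege1 // lerDl ltW.
    rewrite mulrDl mul1r lerD //.
    by rewrite ler_peMr // ltW.
  have -> : (M%:R * t) ^+ 4 = M%:R ^+ 2 * (M%:R ^+ 2 * t ^+ 4) by ring.
  have -> : C * (M%:R * (4 * d).+1%:R) ^+ 2 = M%:R ^+ 2 * (C * (4 * d).+1%:R ^+ 2).
    by ring.
  rewrite ler_pM2l ?exprn_gt0 ?(lt_le_trans _ M1) //.
  apply: le_trans; rewrite ler_wpM2r ?exprn_ge0 ?(ltW t0) //.
  by rewrite expr2 ler_peMl // ltW // (lt_le_trans _ M1).
have t4 : 0 < t ^+ 4 by rewrite exprn_gt0.
pose m := Num.truncn (C * ((4 * d).+1%:R) ^+ 2 / t ^+ 4).
have := hM m; rewrite -ler_pdivlMr //; apply/negP; rewrite -ltNge.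
apply: lt_le_trans (truncnS_gt _) _; rewrite ler_nat.
exact: ltn_expl.
Qed.

(** Powers by repeated squaring, since each use of [state_cs] doubles the exponent. *)
Fixpoint dyadic_power X n := if n is n'.+1 then
  lmul (dyadic_power X n') (dyadic_power X n') else X.

(* Cauchy-Schwarz for the state only loses a factor subexponential in the power,
   so polynomial growth of the norms of the powers is harmless. *)
Lemma state_power phi X Y (C k : R) (d : nat) : 0 < C -> 0 < k ->
  is_adjoint (lval X) (lval Y) ->
  (forall n, bounded_by (C * ((2 ^ n * d).+1%:R) ^+ 2 * k ^+ (2 ^ n))
     (lval (dyadic_power (lmul Y X) n))) ->
  cabs (phi X) ^+ 2 <= k.
Proof.
move=> C0 k0 a h; pose B := dyadic_power (lmul Y X).
have aB n : is_adjoint (lval (B n)) (lval (B n)).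
  elim: n => [|n IH]; first exact: (adjoint_comp (is_adjoint_sym a) a).
  exact: (adjoint_comp IH IH).
have ReB Z : complex.Re Z <= cabs Z :> R by apply: le_trans (Re_le_cabs Z); exact: ler_norm.
apply: (@exp_growth _ _ (3 * C) d) => // [|n]; first exact: sqr_ge0.
apply: (@le_trans _ _ (cabs (phi (B n)))).
  elim: n => [|n IH].
    by rewrite expr1; apply: le_trans (ReB _); exact: state_cs.
  rewrite expnS mulnC exprM.
  apply: (@le_trans _ _ (cabs (phi (B n)) ^+ 2)).
    by rewrite ler_pXn2r ?nnegrE ?cabs_ge0 ?exprn_ge0 ?cabs_ge0.
  by apply: le_trans (ReB _); exact: state_cs.
have := @state_bounded phi (B n) _ _ (h n); rewrite -!mulrA; apply.
by rewrite !mulr_gt0 ?exprn_gt0.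
Qed.

End States.

(** * Wick words *)

Section Evaluation.
Variables (R : realType) (G : ugraph).
Implicit Types (x y : fock R G) (v w u : vert G) (e : dedge G) (s q r t : seq (dedge G)).

(* The value at the path [s] from [v], extended by 0 to lists that are not paths. *)
Definition ev x v s : R[i] := oapp (x : gpath G -> R[i]) 0 (insub (v, s)).

Lemma ev_path x p : ev x (pval p).1 (pval p).2 = x p.
Proof. by rewrite /ev -surjective_pairing (_ : pval p = val p) // valK. Qed.

Lemma ev_inj x y : (forall v s, ev x v s = ev y v s) -> x = y.
Proof. by move=> h; apply: fock_eq => p; rewrite -!ev_path h. Qed.

Lemma evD x y v s : ev (x + y) v s = ev x v s + ev y v s.
Proof. by rewrite /ev; case: insub => [p|] //=; rewrite addr0. Qed.

Lemma evZ (k : R[i]) x v s : ev (k *: x) v s = k * ev x v s.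
Proof. by rewrite /ev; case: insub => [p|] //=; rewrite mulr0. Qed.

Lemma ev0 v s : ev (0 : fock R G) v s = 0.
Proof. by rewrite /ev; case: insub. Qed.

Lemma ev_sum (I : Type) (l : seq I) (P : pred I) (F : I -> fock R G) v s :
  ev (\sum_(i <- l | P i) F i) v s = \sum_(i <- l | P i) ev (F i) v s.
Proof.
by elim/big_rec2: _ => [|i y z _ <-]; [rewrite ev0|rewrite evD].
Qed.

Lemma ev_fproj w x v s : ev (fproj R w x) v s = if v == w then ev x v s else 0.
Proof.
rewrite /ev; case: insubP => [p _ pv|_]; last by case: ifP.
have -> : oapp (fproj R w x : gpath G -> R[i]) 0 (Some p) =
  oapp (x : gpath G -> R[i]) 0 (fproj_map w p) by [].
by rewrite /fproj_map /psrc -[pval p]/(val p) pv /=; case: ifP.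
Qed.

Lemma ev_creat e x v s : ev (creat R e x) v s =
  if s is e' :: s' then if (e' == e) && (v == src e) then ev x (tgt e) s' else 0
  else 0.
Proof.
rewrite /ev; case: insubP => [p wp pv|].
  have -> : oapp (creat R e x : gpath G -> R[i]) 0 (Some p) =
     oapp (x : gpath G -> R[i]) 0 (puncons e p) by [].
  rewrite /puncons -[pval p]/(val p) pv /=.
  case: s wp pv => // e' s /= /andP[/eqP ve _] _.
  by case: eqP => //= e'e; rewrite -ve e'e eqxx.
case: s => // e' s /=; case: (e' =P e) => //= ->; case: (v =P src e) => //= ->.
by rewrite eqxx /= => h; rewrite insubF //; apply: negbTE.
Qed.

Lemma ev_annih e x v s : ev (annih R e x) v s =
  if v == tgt e then ev x (src e) (e :: s) else 0.
Proof.
rewrite /ev; case: insubP => [p wp pv|h].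
  have -> : oapp (annih R e x : gpath G -> R[i]) 0 (Some p) =
     oapp (x : gpath G -> R[i]) 0 (pcons e p) by [].
  by rewrite /pcons /psrc -[pval p]/(val p) pv /=; case: ifP.
case: eqP => // ve; rewrite insubF //= eqxx /= -ve; exact: negbTE.
Qed.

Lemma walk_cat v s t : walk v (s ++ t) = walk v s && walk (endpt v s) t.
Proof. by elim: s v => //= e s IH v; rewrite IH andbA. Qed.

Lemma endpt_cat v s t : endpt v (s ++ t) = endpt (endpt v s) t.
Proof. by rewrite /endpt map_cat last_cat. Qed.

Definition revop s : seq (dedge G) := rev (map (@dop G) s).

Lemma revop_cons e s : revop (e :: s) = rcons (revop s) (dop e).
Proof. by rewrite /revop /= rev_cons. Qed.

Lemma size_revop s : size (revop s) = size s.
Proof. by rewrite /revop size_rev size_map. Qed.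

Lemma revop_path w t : walk w t ->
  walk (endpt w t) (revop t) /\ endpt (endpt w t) (revop t) = w.
Proof.
elim: t w => //= e t IH w /andP[/eqP <- /IH [h1 h2]].
rewrite revop_cons -cats1 walk_cat endpt_cat /= [endpt (src e) (e :: t)]/(endpt (tgt e) t).
by rewrite h1 h2 src_dop eqxx /endpt /= tgt_dop.
Qed.

Lemma ev_creat_path x v r v' q : walk v r ->
  ev (@creat_path R G v r x) v' q =
  if (v' == v) && (take (size r) q == r) then ev x (endpt v r) (drop (size r) q)
  else 0.
Proof.
have foldP : forall w r' q', walk w r' ->
    ev (foldr (fun e T => creat R e \o T) id r' x) w q' =
    if take (size r') q' == r' then ev x (endpt w r') (drop (size r') q') else 0.
  move=> w r'; elim: r' w => [|e r' IH] w q' /=; first by rewrite take0 drop0.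
  move=> /andP[/eqP <- wr]; rewrite ev_creat.
  case: q' => [|e' q'] //=; rewrite eqxx andbT eqseq_cons.
  by case: eqP => //= _; rewrite IH.
rewrite /creat_path; case: r => [|e r] wr; first by rewrite /= ev_fproj take0 drop0 andbT; case: eqP => // ->.
case: eqP => [->|vv]; first exact: foldP.
rewrite /= ev_creat; case: q => // e' q; move: wr => /= /andP[/eqP -> _].
by case: (v' =P v) vv; rewrite ?andbF.
Qed.

Lemma ev_annih_path x u s w q : walk u s ->
  ev (@annih_path R G u s x) w q = if w == endpt u s then ev x u (s ++ q) else 0.
Proof.
have foldP : forall s' q', walk u s' ->
    ev (foldl (fun T e => annih R e \o T) id s' x) (endpt u s') q' = ev x u (s' ++ q').
  move=> s'; elim/last_ind: s' => [|s' e IH] q' //.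
  rewrite -cats1 walk_cat endpt_cat /= andbT => /andP[ws /eqP es].
  rewrite foldl_cat /= ev_annih /endpt /= eqxx es IH //.
  by rewrite -catA.
rewrite /annih_path; case: s => [|e s] ws; first by rewrite /= ev_fproj; case: eqP => // ->.
case: eqP => [->|ww]; first exact: foldP.
have : w <> tgt (last e s).
  by move=> h; apply: ww; rewrite h /endpt /= last_map.
move=> h; rewrite (lastI e s) foldl_rcons /= ev_annih.
by case: eqP.
Qed.

Variable mu : vert G -> R.
Hypothesis mu_pos : forall v, 0 < mu v.

Definition mu4 v : R := mu v `^ 4%:R^-1.

Lemma mu4_gt0 v : 0 < mu4 v. Proof. exact: powR_gt0. Qed.

(** In this form the weights visibly telescope along concatenated paths. *)
Lemma awtE v s : awt mu v s = mu4 v / mu4 (endpt v s).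
Proof.
rewrite /awt /mu4 powRM ?invr_ge0 ?(ltW (mu_pos _)) //; congr (_ * _).
by rewrite -powR_inv1 ?(ltW (mu_pos _)) // -powRrM mulrC powRrM powR_inv1 // powR_ge0.
Qed.

(** The weight $a_\rho a_\tau^{-1}$ of the factorization after [i] edges: with u the vertex reached
    there and w the end, $a_\rho$ is mu4(v)/mu4(u) and $a_\tau$ is mu4(u)/mu4(w). *)
Definition wwt v s (i : nat) : R :=
  mu4 v * mu4 (endpt v s) / mu4 (endpt v (take i s)) ^+ 2.

(** The value at [q] of the term $\ell(\rho)\ell(\tau^{op})^*$ applied to [x]: the path [q] must
    begin with $\rho$, which is replaced by $\tau^{op}$. *)
Definition wterm v s x q (i : nat) : R[i] :=
  if take i q == take i s
  then (wwt v s i)%:C * ev x (endpt v s) (revop (drop i s) ++ drop i q) else 0.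

Lemma ev_wick p x v' q : ev (wick mu p x) v' q =
  if v' == psrc p then
    \sum_(i < (plen p).+1) wterm (psrc p) (pval p).2 x q i
  else 0.
Proof.
rewrite /psrc /plen /wick; case: p => -[v s] /= ws.
rewrite fop_sumE ev_sum.
have termE (i : 'I_(size s).+1) :
  ev (((awt mu v (take i s) * (awt mu (endpt v (take i s)) (drop i s))^-1)%:C *:
      (@creat_path R G v (take i s) \o
       @annih_path R G (endpt (endpt v (take i s)) (drop i s)) (rev (map (@dop G) (drop i s))))) x) v' q =
  if v' == v then wterm v s x q i else 0.
  have [w1 w2] : walk v (take i s) /\ walk (endpt v (take i s)) (drop i s).
    by apply/andP; rewrite -walk_cat cat_take_drop.
  have [h1 h2] := revop_path w2.
  rewrite -/(revop _) fopZE evZ /= ev_creat_path // size_takel -1?ltnS //.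
  rewrite !awtE /wterm /wwt -endpt_cat cat_take_drop.
  case: eqP => //= _; last by rewrite mulr0.
  case: eqP => // _; last by rewrite mulr0.
  have es : endpt (endpt v (take i s)) (drop i s) = endpt v s.
    by rewrite -endpt_cat cat_take_drop.
  rewrite -es ev_annih_path // h2 eqxx es; congr (_%:C * _).
  by field; rewrite !gt_eqF ?mu4_gt0.
transitivity (\sum_(i < (size s).+1) if v' == v then wterm v s x q i else 0).
  by apply: eq_bigr => i _; exact: termE.
by case: (v' == v) => //; rewrite big1.
Qed.

End Evaluation.

Section LinearSpan.
Variables (K : pzRingType) (W : lmodType K) (P : set W).

Lemma lspan_gen x : P x -> lspan P x.
Proof.
move=> Px; exists 1%N, (fun=> 1), (fun=> x).
by split => //; rewrite big_ord1 scale1r.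
Qed.

Lemma lspan0 : lspan P 0.
Proof.
exists 0%N, (fun=> 0), (fun=> 0); split; last by rewrite big_ord0.
by case.
Qed.

Lemma lspan_lin k x y : lspan P x -> lspan P y -> lspan P (k *: x + y).
Proof.
move=> [n [c [p [Pp ->]]]] [m [d [q [Pq ->]]]].
exists (n + m)%N, (fun i => match fintype.split (i : 'I_(n + m)) with inl i => k * c i | inr j => d j end),
  (fun i => match fintype.split i with inl i => p i | inr j => q j end).
split; first by move=> i; case: (fintype.split i).
rewrite big_split_ord scaler_sumr; congr (_ + _); apply: eq_bigr => i _.
  by rewrite -[lshift m i]/(unsplit (inl i)) unsplitK scalerA.
by rewrite -[rshift n i]/(unsplit (inr i)) unsplitK.
Qed.

Lemma lspan_ind (Q : W -> Prop) : Q 0 ->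
  (forall k x y, Q x -> Q y -> Q (k *: x + y)) ->
  (forall x, P x -> Q x) -> forall x, lspan P x -> Q x.
Proof.
move=> Q0 Ql PQ _ [n [c [p [Pp ->]]]].
by elim/big_rec: _ => // i x _ Qx; apply: Ql => //; exact: PQ.
Qed.

End LinearSpan.

(** * The recursion for Wick words *)

Section WickRecursion.
Variables (R : realType) (G : ugraph) (mu : vert G -> R).
Hypothesis mu_pos : forall v, 0 < mu v.
Implicit Types (x y : fock R G) (v w u : vert G) (e : dedge G) (s q r t : seq (dedge G)).
Local Notation m4 := (mu4 mu).

Let m4_gt0 v : 0 < m4 v := mu4_gt0 mu_pos v.

(** The values of a Wick word applied to [x], for bare lists of edges, so that the recursion can be
    stated without proofs that the lists are walks. *)
Definition wev v s x v' q : R[i] :=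
  if v' == v then \sum_(i < (size s).+1) wterm mu v s x q i else 0.

Lemma aedgeE e : aedge mu e = m4 (src e) / m4 (tgt e).
Proof. by rewrite /aedge awtE. Qed.

Lemma wterm_cons0 e s x q :
  wterm mu (src e) (e :: s) x q 0 =
  ((aedge mu e)^-1)%:C * wterm mu (tgt e) s x (dop e :: q) 0.
Proof.
rewrite /wterm !take0 !drop0 !eqxx mulrA -rmorphM /=.
rewrite revop_cons cat_rcons; congr (_%:C * _).
rewrite aedgeE /wwt /= take0 /endpt /=.
by field; rewrite !gt_eqF.
Qed.

Lemma wterm_consS e s x q i : wterm mu (src e) (e :: s) x q i.+1 =
  if q is e' :: q' then
    if e' == e then (aedge mu e)%:C * wterm mu (tgt e) s x q' i else 0
  else 0.
Proof.
rewrite /wterm; case: q => [|e' q] //=; rewrite eqseq_cons.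
case: (e' == e) => //=; case: ifP => _; last by rewrite mulr0.
rewrite mulrA -rmorphM /=; congr (_%:C * _).
rewrite aedgeE /wwt /= -[endpt (src e) (e :: take i s)]/(endpt (tgt e) (take i s)).
rewrite -[endpt (src e) (e :: s)]/(endpt (tgt e) s).
by field; rewrite !gt_eqF.
Qed.

Lemma wterm_cancel e s x q i :
  wterm mu (tgt e) (dop e :: s) x (dop e :: q) i.+1 =
  ((aedge mu e)^-1)%:C * wterm mu (src e) s x q i.
Proof.
rewrite -(src_dop e) wterm_consS eqxx tgt_dop; congr (_%:C * _).
by rewrite !aedgeE src_dop tgt_dop invf_div.
Qed.

(** The recursion $X_e Y_s = Y_{es} + a_e^{-2} Y_{s_1}$, the last term occurring only for $s =
    e^{op} s_1$. Creation gives the factorizations of e s with nonempty left factor, annihilation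
    the one with empty left factor; if s begins with $e^{op}$, annihilation also removes this edge
    from nonempty left factors of s. *)
Lemma wev_Xop e s x v' q :
  ((aedge mu e)%:C * (if q is e' :: q' then
     if (e' == e) && (v' == src e) then wev (tgt e) s x (tgt e) q' else 0 else 0)
  + ((aedge mu e)^-1)%:C *
     (if v' == src e then wev (tgt e) s x (tgt e) (dop e :: q) else 0)) =
  wev (src e) (e :: s) x v' q +
    (if s is e1 :: s1 then
       if e1 == dop e then ((aedge mu e)^-2)%:C * wev (src e) s1 x v' q else 0
     else 0).
Proof.
rewrite /wev eqxx; case: (v' =P src e) => [_|ve]; last first.
  rewrite !mulr0 add0r addr0; case: q => [|e' q]; rewrite ?andbF ?mulr0;
  by case: s => // e1 s1; case: ifP => _ //; rewrite mulr0.
have -> : \sum_(i < (size s).+1) wterm mu (tgt e) s x (dop e :: q) i =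
    wterm mu (tgt e) s x (dop e :: q) 0 +
    \sum_(i < size s) wterm mu (tgt e) s x (dop e :: q) i.+1.
  by rewrite big_ord_recl.
have -> : \sum_(i < (size (e :: s)).+1) wterm mu (src e) (e :: s) x q i =
    wterm mu (src e) (e :: s) x q 0 +
    \sum_(i < (size s).+1) wterm mu (src e) (e :: s) x q i.+1.
  by rewrite big_ord_recl.
rewrite wterm_cons0 mulrDr addrCA -addrA; congr (_ + _).
congr (_ + _).
  case: q => [|e' q].
    by rewrite mulr0 big1 // => i _; rewrite wterm_consS.
  rewrite andbT; case: (eqVneq e' e) => [->|ee].
    by rewrite mulr_sumr; apply: eq_bigr => i _; rewrite wterm_consS eqxx.
  by rewrite mulr0 big1 // => i _; rewrite wterm_consS (negPf ee).
case: s => [|e1 s1]; first by rewrite big_ord0 mulr0.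
case: (eqVneq e1 (dop e)) => [->|e1e].
  rewrite !mulr_sumr; apply: eq_bigr => i _; rewrite wterm_cancel mulrA.
  by rewrite -rmorphM /= -invfM -expr2.
rewrite big1 ?mulr0 // => i _; rewrite /wterm /= eqseq_cons eq_sym.
by rewrite (negPf e1e).
Qed.

Lemma ev_wickE p x v' q : ev (wick mu p x) v' q = wev (psrc p) (pval p).2 x v' q.
Proof. exact: ev_wick. Qed.

Lemma ev_Xop e x v' q : ev (Xop mu e x) v' q =
  (aedge mu e)%:C * (if q is e' :: q' then
     if (e' == e) && (v' == src e) then ev x (tgt e) q' else 0 else 0)
  + ((aedge mu e)^-1)%:C *
     (if v' == src e then ev x (tgt e) (dop e :: q) else 0).
Proof.
by rewrite /Xop fopDE !fopZE evD !evZ ev_creat ev_annih tgt_dop src_dop.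
Qed.

Lemma Xop_wick0 e p : psrc p <> tgt e -> Xop mu e \o wick mu p = 0.
Proof.
move=> pe; have {}pe : (tgt e == psrc p) = false by apply/eqP => /esym.
apply/funext => x; apply: ev_inj => v q /=.
rewrite fop0E ev0 ev_Xop !ev_wickE /wev pe.
case: q => [|e' q]; first by rewrite !mulr0 if_same mulr0 addr0.
by rewrite ev_wickE /wev pe !if_same !mulr0 addr0.
Qed.

Lemma Xop_wick e p pe : psrc p = tgt e -> pval pe = (src e, e :: (pval p).2) ->
  (forall s, (pval p).2 <> dop e :: s) -> Xop mu e \o wick mu p = wick mu pe.
Proof.
move=> sp vpe ns; apply/funext => x; apply: ev_inj => v q /=.
have -> : ev (wick mu pe x) v q = wev (src e) (e :: (pval p).2) x v q +
    (if (pval p).2 is e1 :: s1 then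
       if e1 == dop e then ((aedge mu e)^-2)%:C * wev (src e) s1 x v q else 0
     else 0).
  rewrite ev_wickE /psrc vpe /=; case: (pval p).2 ns => [|e1 s1] ns; first by rewrite addr0.
  by case: eqP => [e1e|]; [case: (ns s1); rewrite e1e|rewrite addr0].
rewrite -wev_Xop ev_Xop ev_wickE sp; congr (_ * _ + _).
by case: q => // e' q; rewrite ev_wickE sp.
Qed.

Lemma Xop_wick_cancel e p pe p1 : psrc p = tgt e ->
  pval pe = (src e, e :: (pval p).2) -> psrc p1 = src e ->
  (pval p).2 = dop e :: (pval p1).2 ->
  Xop mu e \o wick mu p = ((aedge mu e)^-2)%:C *: wick mu p1 + wick mu pe.
Proof.
move=> sp vpe sp1 vp1; apply/funext => x; apply: ev_inj => v q /=.
rewrite fopDE fopZE evD evZ addrC.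
have -> : ev (wick mu pe x) v q + ((aedge mu e)^-2)%:C * ev (wick mu p1 x) v q =
  wev (src e) (e :: (pval p).2) x v q +
    (if (pval p).2 is e1 :: s1 then
       if e1 == dop e then ((aedge mu e)^-2)%:C * wev (src e) s1 x v q else 0
     else 0).
  by rewrite !ev_wickE /psrc vpe vp1 eqxx /= -sp1.
rewrite -wev_Xop ev_Xop ev_wickE sp; congr (_ * _ + _).
by case: q => // e' q; rewrite ev_wickE sp.
Qed.

Lemma wick_pnil v : wick mu (pnil v) = fproj R v.
Proof.
apply/funext => x; apply: ev_inj => w q; rewrite ev_wickE /wev ev_fproj /=.
rewrite big_ord1 /wterm take0 eqxx drop0 /wwt /= /endpt /=.
have -> : m4 v * m4 v / m4 v ^+ 2 = 1 by field; rewrite gt_eqF.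
by rewrite -[psrc (pnil v)]/v drop0 mul1r; case: eqP => // ->.
Qed.

(** The recursion, solved for the longest word, expresses it by words shorter by one and two edges,
    whence the strong induction on the length. *)
Lemma wick_ind (Q : fop R G -> Prop) :
  (forall k S T, Q S -> Q T -> Q (k *: S + T)) ->
  (forall v, Q (fproj R v)) -> (forall e T, Q T -> Q (Xop mu e \o T)) ->
  forall p, Q (wick mu p).
Proof.
move=> Ql Qp QX p; move: {2}(plen p).+1 (ltnSn (plen p)) => n.
elim: n p => // n IH [[v [|e s]] wp].
  move=> _; rewrite (_ : GPath _ = pnil v) ?wick_pnil; last exact: val_inj.
  exact: Qp.
rewrite ltnS /plen /= => sn; have h : (src e == v) && walk (tgt e) s := wp.
case/andP: h => /eqP ve ws; subst v.
have Qs : forall (w0 : walk (tgt e) s), Q (wick mu (GPath (pval := (tgt e, s)) w0)).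
  by move=> w0; exact: IH.
case: s ws sn wp Qs => [|e1 s1] ws sn wp /(_ ws) Qs.
  by rewrite -(@Xop_wick e (GPath (pval := (tgt e, [::])) ws)) //; exact: QX.
pose p := GPath (pval := (tgt e, e1 :: s1)) ws.
case: (eqVneq e1 (dop e)) => [e1e|e1e].
  have ws1 : walk (src e) s1 by have := ws; rewrite /= e1e tgt_dop => /andP[].
  pose p1 := GPath (pval := (src e, s1)) ws1.
  have Q1 : Q (wick mu p1) by apply: IH; rewrite /plen /=; apply: leq_trans sn; rewrite ltnS leqnSn.
  have h := @Xop_wick_cancel e p (GPath (pval := (src e, e :: e1 :: s1)) wp) p1 erefl erefl erefl.
  have {}h := h (congr1 (cons^~ s1) e1e).
  have -> : wick mu (GPath (pval := (src e, e :: e1 :: s1)) wp) =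
     (- ((aedge mu e)^-2)%:C) *: wick mu p1 + (Xop mu e \o wick mu p).
    by rewrite h scaleNr addKr.
  apply: Ql => //; exact: QX.
rewrite -(@Xop_wick e p) //; first exact: QX.
by move=> s' [e1']; rewrite e1' eqxx in e1e.
Qed.

Lemma wick_edge e : exists p, wick mu p = Xop mu e.
Proof.
have w1 : walk (src e) [:: e] by rewrite /= eqxx.
exists (GPath (pval := (src e, [:: e])) w1).
rewrite -(@Xop_wick e (pnil (tgt e))) // wick_pnil.
apply/funext => x; apply: ev_inj => v q /=; rewrite !ev_Xop ev_fproj eqxx.
by case: q => // e' q; rewrite ev_fproj eqxx.
Qed.

Lemma dopK e : dop (dop e) = e.
Proof.
case: e => -[e0 b] h; case: (boolP (is_loop e0)) => el.
  have b0 : b = false by move: h => /=; rewrite el andbT => /negPf.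
  (* A loop is its own opposite, by the default value of [insubd]. *)
  have d : dop (DEdge h) = DEdge h by rewrite /dop /insubd insubN //= b0 el.
  by rewrite !d.
have d (b' : bool) (h' : ~~ (b' && is_loop e0)) :
    dval (dop (DEdge (dval := (e0, b')) h')) = (e0, ~~ b').
  by rewrite /dop -[dval _]/(val _) insubdK // unfold_in /= (negPf el) andbF.
apply: val_inj => /=; have := d b h.
case: (dop (DEdge h)) => -[e1 b1] h1 /= [e10 b10].
by move: h1; rewrite e10 b10 => h1; rewrite d negbK.
Qed.

(** Reversing an edge inverts its weight, so the creation and annihilation parts are exchanged with
    the right coefficients. *)
Lemma Xop_adjoint e : is_adjoint (Xop mu e) (Xop mu (dop e)).
Proof.
have -> : Xop mu (dop e) = (conjc (aedge mu e)%:C) *: annih R e +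
    (conjc ((aedge mu e)^-1)%:C) *: creat R (dop e).
  rewrite /Xop dopK addrC !conjc_real !aedgeE src_dop tgt_dop invf_div.
  by rewrite -[X in _ = (_ / _)%:C *: _ + X *: _]/((_ / _)^-1)%:C invf_div.
apply/is_adjointP => x y v; rewrite !fopDE !fopZE finnerDr !finnerZr.
have /is_adjointP h1 := @creat_adjoint R G e.
have /is_adjointP h2 := is_adjoint_sym (@creat_adjoint R G (dop e)).
rewrite -h1 -h2 finner_conj finnerDr !finnerZr.
rewrite (finner_conj y (creat R e x)) (finner_conj y (annih R (dop e) x)).
by rewrite (rmorphD (@conjc R)) !(rmorphM (@conjc R)).
Qed.

End WickRecursion.

(** * The span of all Wick words is a dense star-algebra *)

Section WickAlgebra.
Variables (R : realType) (G : ugraph) (mu : vert G -> R).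
Hypothesis mu_pos : forall v, 0 < mu v.
Implicit Types (S T : fop R G).

Definition wick_span : set (fop R G) := lspan [set wick mu p | p in setT].

Lemma wick_span_gen p : wick_span (wick mu p).
Proof. by apply: lspan_gen; exists p. Qed.

Lemma wick_span_fproj v : wick_span (fproj R v).
Proof. by rewrite -(wick_pnil mu_pos); exact: wick_span_gen. Qed.

Lemma wick_span_Xop0 e : wick_span (Xop mu e).
Proof. by have [p <-] := wick_edge mu_pos e; exact: wick_span_gen. Qed.

Lemma comp_left_lin (S T T' : fop R G) (k : R[i]) :
  (forall (c : R[i]) x y, S (c *: x + y) = c *: S x + S y) ->
  S \o (k *: T + T') = k *: (S \o T) + (S \o T').
Proof. by move=> h; apply/funext => x; rewrite /= h. Qed.

Lemma linear_map0 (S : fop R G) :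
  (forall (c : R[i]) x y, S (c *: x + y) = c *: S x + S y) -> S 0 = 0.
Proof. by move=> h; have := h (-1) 0 0; rewrite scaler0 addr0 scaleN1r addNr. Qed.

Lemma Xop_linear e (c : R[i]) (x y : fock R G) :
  Xop mu e (c *: x + y) = c *: Xop mu e x + Xop mu e y.
Proof. exact: adjoint_linear (Xop_adjoint mu_pos e). Qed.

Lemma wick_span_Xop e T : wick_span T -> wick_span (Xop mu e \o T).
Proof.
move: T; apply: lspan_ind => [|k S T hS hT|_ [p _ <-]].
- have -> : Xop mu e \o (0 : fop R G) = 0.
    by apply/funext => x /=; rewrite fop0E linear_map0 //; exact: Xop_linear.
  exact: lspan0.
- by rewrite comp_left_lin; [exact: lspan_lin|exact: Xop_linear].
- case: (eqVneq (psrc p) (tgt e)) => [pe|/eqP pe]; last first.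
    by rewrite Xop_wick0 //; exact: lspan0.
  have wpe : walk (src e) (e :: (pval p).2).
    by rewrite /= eqxx -pe; case: p {pe}.
  pose q := GPath (pval := (src e, e :: (pval p).2)) wpe.
  case E : (pval p).2 => [|e1 s1].
    rewrite (@Xop_wick _ _ mu mu_pos e p q) //; first exact: wick_span_gen.
    by move=> s; rewrite E.
  case: (eqVneq e1 (dop e)) => [e1e|e1e].
    have ws1 : walk (src e) s1.
      have : walk (pval p).1 (pval p).2 by case: (p).
      by rewrite E /= e1e tgt_dop => /andP[].
    rewrite (@Xop_wick_cancel _ _ mu mu_pos e p q (GPath (pval := (src e, s1)) ws1)) //.
      by apply: lspan_lin; exact: wick_span_gen.
    by rewrite E e1e.
  rewrite (@Xop_wick _ _ mu mu_pos e p q) //; first exact: wick_span_gen.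
  by move=> s; rewrite E => -[e1']; rewrite e1' eqxx in e1e.
Qed.

Lemma fproj_wick v p : fproj R v \o wick mu p = if psrc p == v then wick mu p else 0.
Proof.
apply/funext => x; apply: ev_inj => w q /=; rewrite ev_fproj ev_wickE // /wev.
case: (psrc p =P v) => [pv|pv].
  by rewrite ev_wickE // /wev pv; case: (w == v).
by rewrite fop0E ev0; case: (w =P v) => // ->; case: eqP => // /esym.
Qed.

Lemma wick_fproj v p : wick mu p \o fproj R v = if ptgt p == v then wick mu p else 0.
Proof.
apply/funext => x; apply: ev_inj => w q /=; rewrite ev_wickE // /wev.
transitivity (if w == psrc p then \sum_(i < (size (pval p).2).+1)
   (if ptgt p == v then wterm mu (psrc p) (pval p).2 x q i else 0) else 0).
  case: eqP => // _; apply: eq_bigr => i _; rewrite /wterm ev_fproj.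
  by rewrite -[endpt (psrc p) _]/(ptgt p); case: ifP => // _; case: ifP; rewrite ?mulr0.
case: (ptgt p == v); first by rewrite ev_wickE.
by rewrite fop0E ev0; case: ifP => // _; rewrite big1.
Qed.

Lemma wick_span_comp S T : wick_span S -> wick_span T -> wick_span (S \o T).
Proof.
move=> hS; move: S hS T; apply: lspan_ind => [T _|k S S' hS hS' T hT|_ [p _ <-]].
- exact: lspan0.
- by apply: (@lspan_lin _ _ _ k (S \o T) (S' \o T)); [exact: hS|exact: hS'].
apply: (wick_ind mu_pos (Q := fun S => forall T, wick_span T -> wick_span (S \o T))).
- move=> k S S' hS hS' T hT.
  by apply: (@lspan_lin _ _ _ k (S \o T) (S' \o T)); [exact: hS|exact: hS'].
- move=> v T hT; move: T hT; apply: lspan_ind => [|k S T hS hT|_ [q _ <-]].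
  + have -> : fproj R v \o (0 : fop R G) = 0.
      by apply/funext => x /=; rewrite fop0E linear_map0 // => c y z; exact: fproj_linear.
    exact: lspan0.
  + rewrite comp_left_lin; first exact: lspan_lin.
    by move=> c y z; exact: fproj_linear.
  + rewrite fproj_wick; case: ifP => _; [exact: wick_span_gen|exact: lspan0].
- by move=> e S hS T hT; apply: (@wick_span_Xop e (S \o T)); exact: hS.
Qed.

Lemma wick_span_adjoint S : wick_span S -> exists2 T, wick_span T & is_adjoint S T.
Proof.
have lin k (S1 S2 : fop R G) : (exists2 T, wick_span T & is_adjoint S1 T) ->
    (exists2 T, wick_span T & is_adjoint S2 T) ->
    exists2 T, wick_span T & is_adjoint (k *: S1 + S2) T.
  move=> [T1 hT1 a1] [T2 hT2 a2]; exists (conjc k *: T1 + T2); first exact: lspan_lin.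
  exact: adjoint_comb.
move: S; apply: lspan_ind => [|k S T|_ [p _ <-]].
- by exists 0; [exact: lspan0|exact: adjoint0].
- exact: lin.
apply: (wick_ind mu_pos (Q := fun S => exists2 T, wick_span T & is_adjoint S T)).
- exact: lin.
- by move=> v; exists (fproj R v); [exact: wick_span_fproj|exact: fproj_adjoint].
- move=> e S [T hT a]; exists (T \o Xop mu (dop e)).
    by apply: wick_span_comp => //; exact: wick_span_Xop0.
  exact: adjoint_comp (Xop_adjoint mu_pos e) a.
Qed.

Lemma wick_span_graph (v0 : vert G) S : wick_span S -> graph_algebra mu S.
Proof.
have [[gl gM gA] gC] := graph_algebra_cstar mu.
have g0 : graph_algebra mu (0 : fop R G).
  have gp := @graph_algebra_proj R G mu v0.
  by have := gl (-1) _ _ gp gp; rewrite scaleN1r addNr.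
move: S; apply: lspan_ind => [//|//|_ [p _ <-]].
apply: (wick_ind mu_pos) => [//|v|e S gS]; first exact: graph_algebra_proj.
apply: gM => //; apply: sub_gen_smallest; right; by exists e.
Qed.

(** The operators approximable from the span form a C*-algebra that contains the generators, so
    minimality of [graph_algebra] applies. *)
Lemma graph_algebra_approx S : graph_algebra mu S ->
  forall e : R, 0 < e -> exists2 T, wick_span T & bounded_by e (S - T).
Proof.
have adjble T : wick_span T -> adjointable T.
  move: T; apply: lspan_ind => [|k T T'|_ [p _ <-]].
  - exact: adjointable0.
  - exact: adjointable_lin.
  - apply: (wick_ind mu_pos) => [||e T]; first exact: adjointable_lin.
      exact: adjointable_fproj.
    by apply: adjointable_comp; exact: adjointable_Xop.
pose C := [set S : fop R G | forall e : R, 0 < e ->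
  exists2 T, wick_span T & bounded_by e (S - T)].
move=> gS; apply: (smallest_sub (X := C) _ _ gS) => [|T [[v _ <-]|[e _ <-]] d d0]; last first.
- exists (Xop mu e); first exact: wick_span_Xop0.
  by move=> x; rewrite subrr fop0E fnorm0 mulr_ge0 ?fnorm_ge0 // ltW.
- exists (fproj R v); first exact: wick_span_fproj.
  by move=> x; rewrite subrr fop0E fnorm0 mulr_ge0 ?fnorm_ge0 // ltW.
have weak (S1 : fop R G) (a b : R) : a <= b -> bounded_by a S1 -> bounded_by b S1.
  by move=> ab h x; apply: le_trans (h x) _; rewrite ler_wpM2r ?fnorm_ge0.
split; first split.
- move=> k S1 S2 C1 C2 d d0.
  have d1 : 0 < d / (2 * (cabs k + 1)) by rewrite divr_gt0 // mulr_gt0 // ltr_wpDl ?cabs_ge0.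
  have [T1 w1 b1] := C1 _ d1; have [T2 w2 b2] := C2 _ (divr_gt0 d0 (ltr0Sn R 1)).
  exists (k *: T1 + T2); first exact: lspan_lin.
  rewrite opprD addrACA -scalerBr; apply: weak (bounded_comb k b1 b2).
  have k1 : 0 < cabs k + 1 by rewrite ltr_wpDl ?cabs_ge0.
  have : cabs k * (d / (2 * (cabs k + 1))) <= d / 2.
    rewrite mulrA ler_pdivrMr ?mulr_gt0 //.
    have -> : d / 2 * (2 * (cabs k + 1)) = d * (cabs k + 1) by field.
    by rewrite mulrC ler_wpM2l ?(ltW d0) // lerDl.
  by move: (cabs k * _) => t; lra.
- move=> S1 S2 C1 C2 d d0.
  (* An approximant within distance 1 supplies a bound for [S2]. The error of the product is (S1 -
     T1) S2 + T1 (S2 - T2), so [T1] is chosen before the accuracy of [T2]. *)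
  have [T2' w2' b2'] := C2 1 ltr01; have [_ [K2 K20 bK2]] := adjble _ w2'.
  have bS2 : bounded_by (1 + K2) S2.
    move=> x; have -> : S2 x = (S2 - T2') x + T2' x by rewrite fopDE fopNE subrK.
    by apply: le_trans (fnormD _ _) _; rewrite mulrDl lerD.
  have c2 : 0 < 2 * (1 + K2) by rewrite mulr_gt0 // ltr_wpDr.
  have [T1 w1 b1] := C1 _ (divr_gt0 d0 c2).
  have [[T1' a1] [K1 K10 bK1]] := adjble _ w1.
  have c1 : 0 < 2 * (K1 + 1) by rewrite mulr_gt0 // ltr_wpDl.
  have [T2 w2 b2] := C2 _ (divr_gt0 d0 c1).
  exists (T1 \o T2); first exact: wick_span_comp.
  move=> x.
  have -> : ((S1 \o S2) - (T1 \o T2)) x = (S1 - T1) (S2 x) + T1 ((S2 - T2) x).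
    have T1B y z : T1 (y - z) = T1 y - T1 z.
      by rewrite addrC -scaleN1r (adjoint_linear _ _ _ a1) scaleN1r addrC.
    rewrite -[(S2 - T2) x]/(S2 x - T2 x) T1B.
    rewrite -[(S1 - T1) (S2 x)]/(S1 (S2 x) - T1 (S2 x)).
    by rewrite -[LHS]/(S1 (S2 x) - T1 (T2 x)) addrA subrK.
  apply: le_trans (fnormD _ _) _.
  apply: (@le_trans _ _ (d / (2 * (1 + K2)) * ((1 + K2) * fnorm x) +
     K1 * (d / (2 * (K1 + 1)) * fnorm x))).
    apply: lerD; first by apply: le_trans (b1 _) _; rewrite ler_wpM2l ?(ltW (divr_gt0 d0 c2)).
    by apply: le_trans (bK1 _) _; rewrite ler_wpM2l.
  have -> : d / (2 * (1 + K2)) * ((1 + K2) * fnorm x) = d / 2 * fnorm x.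
    by field; rewrite gt_eqF // ltr_wpDr.
  have -> : K1 * (d / (2 * (K1 + 1)) * fnorm x) = K1 / (K1 + 1) * (d / 2) * fnorm x.
    by field; rewrite gt_eqF // ltr_wpDl.
  rewrite -mulrDl ler_wpM2r ?fnorm_ge0 //.
  have : K1 / (K1 + 1) <= 1 by rewrite ler_pdivrMr ?ltr_wpDl // mul1r lerDl.
  by move: (K1 / (K1 + 1)) => t; nra.
- move=> S1 S2 C1 a d d0.
  have [T w b] := C1 _ (divr_gt0 d0 (ltr0Sn R 1)).
  have [T' w' a'] := wick_span_adjoint w; exists T' => //.
  have -> : d = 2 * (d / 2) by field.
  apply: (@adjoint_bounded _ _ (S1 - T)) b; first by rewrite divr_ge0 // ltW.
  rewrite addrC -scaleN1r [S2 - _]addrC -(scaleN1r T') -{2}conjcN1.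
  exact: adjoint_comb.
- move=> S1 h d d0; have d2 := divr_gt0 d0 (ltr0Sn R 1).
  have [S2 C2 b2] := h _ d2; have [T w b] := C2 _ d2; exists T => // x.
  have -> : (S1 - T) x = (S1 x - S2 x) + (S2 - T) x.
    by rewrite !fopDE !fopNE addrA subrK.
  apply: le_trans (fnormD _ _) _; apply: le_trans (lerD (b2 x) (b x)) _.
  by rewrite -mulrDl -splitr.
Qed.

End WickAlgebra.

(** * Wick words of loops *)

Section LoopWick.
Variables (R : realType) (G : ugraph) (mu : vert G -> R) (v0 : vert G).
Hypothesis mu_pos : forall v, 0 < mu v.
Implicit Types (S T : fop R G) (p q : gpath G).
Local Notation p0 := (@fproj R G v0).
Local Notation vac := (vac R v0).

Definition loop_wick_span : set (fop R G) := lspan [set wick mu p | p in loops_at v0].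

Lemma compress_wick p : loops_at v0 p -> p0 \o wick mu p \o p0 = wick mu p.
Proof.
move=> [sp tp]; have := fproj_wick mu_pos v0 p; rewrite sp eqxx => ->.
by rewrite wick_fproj // tp eqxx.
Qed.

Lemma compress_span S : wick_span mu S -> loop_wick_span (p0 \o S \o p0).
Proof.
move: S; apply: lspan_ind => [|k S T hS hT|_ [p _ <-]].
- have -> : p0 \o (0 : fop R G) \o p0 = 0.
    apply/funext => x /=; rewrite fop0E linear_map0 // => c y z; exact: fproj_linear.
  exact: lspan0.
- have -> : p0 \o (k *: S + T) \o p0 = k *: (p0 \o S \o p0) + (p0 \o T \o p0).
    by apply/funext => x /=; rewrite fopDE fopZE fproj_linear.
  exact: lspan_lin.
- rewrite fproj_wick //; case: eqP => sp; last first.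
    have -> : (0 : fop R G) \o p0 = 0 by apply/funext => x.
    exact: lspan0.
  rewrite wick_fproj //; case: eqP => tp; last exact: lspan0.
  by apply: lspan_gen; exists p.
Qed.

Lemma loop_wick_spanP S : loop_wick_span S <-> wick_span mu S /\ p0 \o S \o p0 = S.
Proof.
split=> [|[hS <-]]; last exact: compress_span.
move: S; apply: lspan_ind => [|k S T [hS eS] [hT eT]|_ [p lp <-]].
- split; first exact: lspan0.
  apply/funext => x /=; rewrite fop0E linear_map0 // => c y z; exact: fproj_linear.
- split; first exact: lspan_lin.
  have -> : p0 \o (k *: S + T) \o p0 = k *: (p0 \o S \o p0) + (p0 \o T \o p0).
    by apply/funext => x /=; rewrite fopDE fopZE fproj_linear.
  by rewrite eS eT.
- by split; [exact: wick_span_gen|exact: compress_wick].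
Qed.

Lemma loop_wick_span_loop S : loop_wick_span S -> loop_algebra mu v0 S.
Proof.
move=> /loop_wick_spanP [hS <-]; exists S => //.
exact: (wick_span_graph mu_pos v0).
Qed.

Lemma loop_wick_span_one : loop_wick_span p0.
Proof.
apply/loop_wick_spanP; split; first exact: wick_span_fproj.
by rewrite !fproj_idem.
Qed.

Lemma loop_wick_span_comp S T : loop_wick_span S -> loop_wick_span T ->
  loop_wick_span (S \o T).
Proof.
move=> hS hT; have lS := loop_wick_span_loop hS; have lT := loop_wick_span_loop hT.
move/loop_wick_spanP: hS => [hS _]; move/loop_wick_spanP: hT => [hT _].
apply/loop_wick_spanP; split; first exact: wick_span_comp.
by have /loop_algebraP [_] := loop_comp lS lT.
Qed.

Lemma loop_wick_span_adjoint S T : loop_wick_span S -> is_adjoint S T ->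
  loop_wick_span T.
Proof.
move=> hS ST; have lS := loop_wick_span_loop hS.
move/loop_wick_spanP: hS => [hS _].
apply/loop_wick_spanP; split.
  have [T' hT' ST'] := wick_span_adjoint mu_pos hS.
  by rewrite (adjoint_unique ST ST').
by have /loop_algebraP [_] := loop_adjoint lS ST.
Qed.

(** The span of the loop words is already a unital star-algebra: it is the corner under [p0] of the
    span of all Wick words, which is closed under products and adjoints. *)
Lemma poly_algebraE : poly_algebra mu v0 = loop_wick_span.
Proof.
apply/seteqP; split=> S.
  move=> hS; apply: (smallest_sub _ _ hS); last first.
    by move=> _ [p lp <-]; apply: lspan_gen; exists p.
  split; last exact: loop_wick_span_one.
  split=> [k S1 S2|S1 S2|S1 S2]; first exact: lspan_lin.
    exact: loop_wick_span_comp.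
  exact: loop_wick_span_adjoint.
have [alg_lin alg_one alg_gen] : [/\ forall k S1 S2, poly_algebra mu v0 S1 ->
    poly_algebra mu v0 S2 -> poly_algebra mu v0 (k *: S1 + S2),
    poly_algebra mu v0 p0 & forall p, loops_at v0 p -> poly_algebra mu v0 (wick mu p)].
  split.
  - move=> k S1 S2 h1 h2 B [sB gB]; case: (sB) => -[l _ _] _.
    by apply: l; [exact: h1|exact: h2].
  - by move=> B [[_ oB] _].
  - by move=> p lp; apply: sub_gen_smallest; exists p.
move: S; apply: lspan_ind => [|k S T|_ [p lp <-]].
- by have := alg_lin (-1) _ _ alg_one alg_one; rewrite scaleN1r addNr.
- exact: alg_lin.
- exact: alg_gen.
Qed.

Lemma loop_approx S : loop_algebra mu v0 S ->
  forall e : R, 0 < e -> exists2 T, loop_wick_span T & bounded_by e (S - T).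
Proof.
move=> lS e e0; have [T hT bT] := graph_algebra_approx mu_pos (loop_graph lS) e0.
exists (p0 \o T \o p0); first exact: compress_span.
have p01 := @pull_op_bounded R G _ (@fproj_tgt G v0) (@fproj_inj G v0).
move=> x; have -> : (S - (p0 \o T \o p0)) x = p0 ((S - T) (p0 x)).
  have p0B y z : p0 (y - z) = p0 y - p0 z.
    by rewrite addrC -scaleN1r fproj_linear scaleN1r addrC.
  rewrite -[LHS]/(S x - p0 (T (p0 x))) (_ : (S - T) (p0 x) = S (p0 x) - T (p0 x)) //.
  by rewrite p0B (loop_left _ lS) (loop_right _ lS).
apply: le_trans (p01 _) _; rewrite mul1r; apply: le_trans (bT _) _.
by rewrite ler_wpM2l ?(ltW e0) //; have := p01 x; rewrite mul1r.
Qed.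

Lemma ev_dvec p v s : ev (dvec R p) v s = ((v, s) == val p)%:R.
Proof.
rewrite /ev; case: insubP => [q _ <-|]; first by rewrite [oapp _ _ _]dvecE val_eqE.
by case: eqP => [->|//]; case: p => /= pv wp; rewrite wp.
Qed.

(** On the vacuum only the factorization with empty right factor survives, and its weight is 1
    because [p] returns to [v0]. *)
Lemma wick_vac p : loops_at v0 p -> wick mu p vac = dvec R p.
Proof.
move=> [sp tp]; apply: ev_inj => w q; rewrite ev_wickE // /wev ev_dvec.
rewrite -[val p]/(pval p) [pval p]surjective_pairing xpair_eqE.
rewrite -[(pval p).1]/(psrc p); case: eqP => // _ /=.
rewrite big_ord_recr /= big1 => [|i _]; last first.
  rewrite /wterm; case: ifP => // _; rewrite /vac pvec_dvec ev_dvec /=.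
  rewrite xpair_eqE; case: eqP => [_|]; last by rewrite mulr0.
  case E : (_ ++ _) => [|? ?]; last by rewrite mulr0.
  move/(congr1 size): E; rewrite size_cat size_revop size_drop /=.
  by have := ltn_ord i; lia.
rewrite add0r /wterm take_size drop_size /= /vac pvec_dvec ev_dvec xpair_eqE.
rewrite -[endpt _ _]/(ptgt p) tp /= eqxx /=.
have -> : wwt mu (psrc p) (pval p).2 (size (pval p).2) = 1.
  rewrite /wwt take_size -[endpt _ _]/(ptgt p) tp sp.
  by field; rewrite gt_eqF // mu4_gt0.
rewrite mul1r; case: eqP => [e|ne].
  case: (eqVneq q (pval p).2) => [->|qn]; first by rewrite drop_size.
  case E : (drop _ q) => //; case/eqP: qn.
  by rewrite -[q](cat_take_drop (size (pval p).2)) e E cats0.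
by case: eqP => // qe; case: ne; rewrite qe take_size.
Qed.

(** By [wick_vac] the coefficients can be read off from the vacuum vector; words occurring several
    times in a given combination are merged. *)
Lemma loop_wick_repr S : loop_wick_span S -> exists F : seq (gpath G),
  [/\ uniq F, forall p, p \in F -> loops_at v0 p,
      forall p, p \notin F -> S vac p = 0 &
      S = \sum_(p <- F) (S vac p : R[i]) *: wick mu p].
Proof.
move=> [n [c [W [WP ->]]]].
have [g hg] : {g : 'I_n -> gpath G & forall i, loops_at v0 (g i) /\ wick mu (g i) = W i}.
  apply: (@boolp.choice _ _ (fun i p => loops_at v0 p /\ wick mu p = W i)) => i.
  by have [p lp <-] := WP i; exists p.
pose F := undup (codom g).
have inF i : g i \in F by rewrite mem_undup codom_f.
have vE q : (\sum_(i < n) c i *: W i : fop R G) vac q = \sum_(i < n | g i == q) c i.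
  rewrite fop_sumE fock_sumE [RHS]big_mkcond; apply: eq_bigr => i _.
  rewrite fopZE fockZE; have [lg <-] := hg i; rewrite wick_vac // dvecE eq_sym.
  by case: eqP => _; rewrite ?mulr1 ?mulr0.
exists F; split.
- exact: undup_uniq.
- by move=> p; rewrite mem_undup => /codomP [i ->]; have [] := hg i.
- move=> p pF; rewrite vE big1 // => i /eqP gi; case/negP: pF.
  by rewrite -gi inF.
- transitivity (\sum_(p <- F) \sum_(i < n | g i == p) c i *: wick mu (g i)).
    rewrite (exchange_big_dep xpredT) //=; apply: eq_bigr => i _.
    rewrite (big_rem (g i)) //= eqxx big_seq_cond big1 ?addr0.
      by have [_ ->] := hg i.
    move=> q /andP[]; rewrite mem_rem_uniq ?undup_uniq // !inE => /andP[+ _] /eqP.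
    by move=> /eqP h e; case: h.
  apply: eq_bigr => p _; rewrite vE scaler_suml.
  by apply: eq_bigr => i /eqP ->.
Qed.

End LoopWick.

(** * Finite truncations of vectors *)

Section Truncation.
Variables (R : realType) (G : ugraph).
Implicit Types (x y : fock R G) (F X : seq (gpath G)).

Lemma sqnorm_tail x v (e : R) : 0 < e -> exists F, [/\ uniq F,
  forall p, p \in F -> ptgt p = v &
  forall X, uniq X -> (forall p, p \in X -> ptgt p = v /\ p \notin F) ->
    \sum_(p <- X) cabs (x p) ^+ 2 <= e].
Proof.
move=> e0; have := sqnorm_val v x; rewrite /sqnorm_at /esum => fin.
have [_ [A [finA AD] <-] hA] := @ub_ereal_sup_adherent R _ e e0 (eq_ind_r
  (fun z => z \is a fin_num) (isT : (fine (sqnorm_at v x))%:E \is a fin_num) fin).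
exists (finmap.enum_fset (fset_set A)); split => [|p pF|X uX XD].
- exact: finmap.fset_uniq.
- by apply: AD; move: (in_fset_set finA p) => e'; move: pF; rewrite [_ \in _]e' inE.
have : ((\sum_(p <- finmap.enum_fset (fset_set A) ++ X) cabs (x p) ^+ 2)%:E <=
    sqnorm_at v x)%E.
  apply: (@seq_le_esum _ _ _ (fun p => cabs (x p) ^+ 2)) => [p||p].
  - exact: sqr_ge0.
  - rewrite cat_uniq uX andbT /=; apply/andP; split; first exact: finmap.fset_uniq.
    by apply/hasPn => p /XD [].
  - rewrite mem_cat => /orP[h|/XD[] //].
    by apply: AD; move: (in_fset_set finA p) => e'; move: h; rewrite [_ \in _]e' inE.
move: hA; rewrite -/(esum _ _) -/(sqnorm_at v x) fsbig_finite //= sumEFin.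
rewrite sqnorm_val -EFinB lte_fin lee_fin big_cat /=; lra.
Qed.

Definition trunc F x : fock R G := \sum_(p <- F) (x p : R[i]) *: dvec R p.

Lemma truncE F x q : uniq F -> trunc F x q = if q \in F then x q else 0.
Proof.
move=> uF; rewrite /trunc fock_sumE.
under eq_bigr do rewrite fockZE dvecE.
case: ifP => qF.
  rewrite (big_rem q) //= eqxx mulr1 big_seq big1 ?addr0 // => p.
  by rewrite mem_rem_uniq // !inE => /andP[/negPf pq _]; rewrite eq_sym pq mulr0.
rewrite big_seq big1 // => p pF; case: eqP => [qp|_]; last by rewrite mulr0.
by move: qF; rewrite qp pF.
Qed.

(** Stability under enlarging the list lets one list serve a vector and its image under N
    simultaneously. *)
Lemma trunc_close x v (e : R) : 0 < e -> (forall p, ptgt p <> v -> x p = 0) ->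
  exists F, [/\ uniq F, forall p, p \in F -> ptgt p = v &
    forall F', uniq F' -> {subset F <= F'} -> fnorm (x - trunc F' x) < e].
Proof.
move=> e0 xv; have e2 : 0 < (e / 2) ^+ 2 by rewrite exprn_gt0 // divr_gt0.
have [F [uF FD hF]] := sqnorm_tail x v e2.
exists F; split => // F' uF' FF'; apply: (@le_lt_trans _ _ (e / 2)); last first.
  by rewrite ltr_pdivrMr // ltr_pMr // ltr1n.
apply: fnorm_le => [|w X uX XD]; first by rewrite divr_ge0 // ltW.
rewrite (bigID (fun p => (ptgt p == v) && (p \notin F'))).
rewrite [X in _ + X <= _]big1 ?addr0; last first.
  move=> p; rewrite negb_and negbK fockBE truncE // => /orP[/eqP /xv xp|pF].
    by rewrite xp; case: ifP => _; rewrite subrr cabs0 expr0n.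
  by rewrite pF subrr cabs0 expr0n.
rewrite -big_filter.
set X' := [seq p <- X | _].
apply: (@le_trans _ _ (\sum_(p <- X') cabs (x p) ^+ 2)).
  rewrite !big_filter; apply: ler_sum => p /andP[_ /andP[_ pF]].
  by rewrite fockBE truncE // (negbTE pF) subr0.
apply: hF => [|p]; first exact: filter_uniq.
rewrite mem_filter => /andP[/andP[_ /andP[/eqP pv pF]] _]; split => //.
by apply: contra pF => /FF'.
Qed.

End Truncation.

(** * The number operator *)

Section NumberOperator.
Variables (R : realType) (G : ugraph) (mu : vert G -> R) (v0 : vert G).
Hypothesis mu_pos : forall v, 0 < mu v.
Implicit Types (S T D : fop R G) (p q : gpath G) (x y z : fock R G).
Local Notation p0 := (@fproj R G v0).
Local Notation vac := (vac R v0).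

Definition loop_supported x := forall p, ~ loops_at v0 p -> x p = 0.

(** The graph of the closure of N, by [number_graphP]. That the product with the length is again a
    Fock vector [y] is the domain condition. *)
Definition npair x y := loop_supported x /\ forall p, y p = (plen p)%:R * x p.

Lemma fprojE v x p : fproj R v x p = if psrc p == v then x p else 0.
Proof.
have -> : fproj R v x p = oapp (x : gpath G -> R[i]) 0 (fproj_map v p) by [].
by rewrite /fproj_map; case: ifP.
Qed.

Lemma loop_supportedP S x : loop_algebra mu v0 S -> loop_supported x ->
  loop_supported (S x).
Proof.
move=> lS sx p np; rewrite -(loop_left x lS) fprojE; case: eqP => // sp.
have [[T ST] _] := loop_adjointable lS.
apply: (adjoint_ptgt (v := v0) ST) => [q tq|tp].
  by apply: sx => -[].
by apply: np.
Qed.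

Lemma vac_supported : loop_supported vac.
Proof.
move=> p np; rewrite /vac pvec_dvec dvecE; case: eqP => // pE.
by case: np; rewrite pE.
Qed.

Lemma trunc_span F x : (forall p, p \in F -> loops_at v0 p) ->
  exists2 S, loop_wick_span mu v0 S & S vac = trunc F x.
Proof.
move=> FL; exists (\sum_(p <- F) (x p : R[i]) *: wick mu p).
  elim: F FL => [|p F IH] FL; first by rewrite big_nil; exact: lspan0.
  rewrite big_cons; apply: lspan_lin.
    by apply: lspan_gen; exists p => //; apply: FL; rewrite inE eqxx.
  by apply: IH => q qF; apply: FL; rewrite inE qF orbT.
rewrite fop_sumE /trunc big_seq [RHS]big_seq; apply: eq_bigr => p pF.
by rewrite fopZE wick_vac //; exact: FL.
Qed.

Lemma loop_trunc x (e : R) : 0 < e -> loop_supported x ->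
  exists F, [/\ uniq F, forall p, p \in F -> loops_at v0 p &
    forall F', uniq F' -> {subset F <= F'} -> fnorm (x - trunc F' x) < e].
Proof.
move=> e0 sx; have [|F [uF FD hF]] := trunc_close (v := v0) e0 (x := x).
  by move=> p tp; apply: sx => -[].
exists [seq p <- F | psrc p == v0]; split => [|p|F' uF' FF'].
- exact: filter_uniq.
- by rewrite mem_filter => /andP[/eqP sp pF]; split => //; exact: FD.
pose F2 := undup (F ++ F').
have -> : trunc F' x = trunc F2 x.
  apply: fock_eq => q; rewrite !truncE ?undup_uniq // /F2 mem_undup mem_cat.
  case qF' : (q \in F'); first by rewrite orbT.
  rewrite orbF; case: ifP => // qF; rewrite sx // => -[sq _].
  by move: qF'; rewrite FF' // mem_filter sq eqxx.
apply: hF; first exact: undup_uniq.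
by move=> q qF; rewrite mem_undup mem_cat qF.
Qed.

(** Coefficients are continuous and the loop algebra preserves the support; conversely, truncations
    come from combinations of Wick words. *)
Lemma gns_spaceP x : gns_space mu v0 x <-> loop_supported x.
Proof.
split=> [h p np|sx e e0].
  apply: cabs_eq0; apply/eqP; rewrite eq_le cabs_ge0 andbT.
  apply/ler_addgt0Pl => e e0; rewrite addr0; have [S lS hS] := h e e0.
  apply: le_trans (ltW hS); apply: le_trans (cabs_le_fnorm _ p).
  by rewrite fockBE (loop_supportedP lS vac_supported) ?subr0.
have [F [uF FL hF]] := loop_trunc e0 sx.
have [S hS eS] := trunc_span x FL.
exists S; first exact: loop_wick_span_loop.
by rewrite eS; exact: hF.
Qed.

Lemma npair_supported x y : npair x y -> loop_supported y.
Proof. by move=> [sx e] p np; rewrite e sx ?mulr0. Qed.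

Lemma number_core_len (z : fock R G * fock R G) : number_core mu v0 z ->
  forall p, z.2 p = (plen p)%:R * z.1 p.
Proof.
move: z; apply: lspan_ind => [p|k z w hz hw p|_ [q lq <-] p].
- by rewrite -[LHS]/(0 : R[i]) -[(0 : fock R G * fock R G).1 p]/(0 : R[i]) mulr0.
- rewrite -[LHS]/(k * z.2 p + w.2 p) -[(k *: z + w).1 p]/(k * z.1 p + w.1 p).
  by rewrite hz hw mulrDr mulrCA.
- rewrite [LHS]fockZE wick_vac // dvecE; case: (eqVneq p q) => [->//|_].
  by rewrite !mulr0.
Qed.

Lemma number_core_trunc x y F : npair x y -> (forall p, p \in F -> loops_at v0 p) ->
  number_core mu v0 (trunc F x, trunc F y).
Proof.
move=> [sx e]; rewrite /trunc; elim: F => [|p F IH] FL.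
  by rewrite !big_nil; exact: lspan0.
rewrite !big_cons.
have -> : ((x p : R[i]) *: dvec R p + \sum_(j <- F) (x j : R[i]) *: dvec R j,
           (y p : R[i]) *: dvec R p + \sum_(j <- F) (y j : R[i]) *: dvec R j) =
   (x p : R[i]) *: ((wick mu p vac, (plen p)%:R *: wick mu p vac) : fock R G * fock R G)
   + (\sum_(j <- F) (x j : R[i]) *: dvec R j, \sum_(j <- F) (y j : R[i]) *: dvec R j).
  rewrite wick_vac //; last by apply: FL; rewrite inE eqxx.
  congr (_, _) => /=; congr (_ + _).
  by rewrite scalerA e mulrC.
apply: lspan_lin.
  by apply: lspan_gen; exists p => //; apply: FL; rewrite inE eqxx.
by apply: IH => q qF; apply: FL; rewrite inE qF orbT.
Qed.

Lemma number_graphP x y : number_graph mu v0 (x, y) <-> npair x y.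
Proof.
split=> [[/= /gns_spaceP sx _ h]|h].
  split => // p; apply/eqP; rewrite -subr_eq0; apply/eqP.
  apply: cabs_eq0; apply/eqP; rewrite eq_le cabs_ge0 andbT.
  apply/ler_addgt0Pl => e e0; rewrite addr0.
  have n0 : 0 < (plen p)%:R + 1 :> R by rewrite ltr_wpDl.
  have [[x' y'] /number_core_len /= c [hx hy]] := h _ (divr_gt0 e0 n0).
  have -> : y p - (plen p)%:R * x p = (y - y') p - (plen p)%:R * (x - x') p.
    by rewrite !fockBE c; move: (x' p) => /= t; ring.
  apply: le_trans (cabsD _ _) _; rewrite cabsN cabsM.
  have -> : cabs ((plen p)%:R : R[i]) = (plen p)%:R.
    by rewrite -[(plen p)%:R](rmorph_nat (real_complex R)) cabs_real ger0_norm.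
  have hy' := le_trans (cabs_le_fnorm (y - y') p) (ltW hy).
  have hx' := le_trans (cabs_le_fnorm (x - x') p) (ltW hx).
  apply: le_trans (lerD hy' (ler_wpM2l (ler0n _ (plen p)) hx')) _.
  by rewrite -[X in X + _]mul1r -mulrDl [1 + _]addrC mulrC divfK ?gt_eqF.
have sy := npair_supported h.
split=> [||e e0] /=; try by apply/gns_spaceP; case: h.
have [F [uF FL hF]] := loop_trunc e0 h.1.
have [F' [uF' FL' hF']] := loop_trunc e0 sy.
pose F2 := undup (F ++ F').
exists (trunc F2 x, trunc F2 y) => /=.
  apply: number_core_trunc => // p; rewrite mem_undup mem_cat => /orP[]; [exact: FL|exact: FL'].
by split; [apply: hF|apply: hF']; rewrite ?undup_uniq // => p pF;
  rewrite mem_undup mem_cat pF ?orbT.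
Qed.

(* [D] is the commutator of the length operator with [S], on vectors where the
   length operator is defined. *)
Definition has_comm S D := forall x y, (forall p, y p = (plen p)%:R * x p) ->
  forall p, D x p = (plen p)%:R * S x p - S y p.

Definition comm_bounded S := exists2 D, has_comm S D & exists2 K, 0 <= K & bounded_by K D.

Lemma has_comm_lin (k : R[i]) S T D E : has_comm S D -> has_comm T E ->
  has_comm (k *: S + T) (k *: D + E).
Proof.
move=> hS hT x y xy p; rewrite !fopDE !fopZE !fockDE !fockZE (hS _ _ xy) (hT _ _ xy).
by move: (S x p) (S y p) (T x p) (T y p) => /= a b c d; ring.
Qed.

Lemma comm_bounded_lin (k : R[i]) S T : comm_bounded S -> comm_bounded T ->
  comm_bounded (k *: S + T).
Proof.
move=> [D cD [K K0 bK]] [E cE [L L0 bL]]; exists (k *: D + E); first exact: has_comm_lin.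
exists (cabs k * K + L); last exact: bounded_comb.
by rewrite addr_ge0 // mulr_ge0 // cabs_ge0.
Qed.

(** The Leibniz rule [N, ST] = [N, S] T + S [N, T]. It is applicable because [T] maps the domain of
    the length operator to itself, with N T x = [N, T] x + T N x. *)
Lemma comm_bounded_comp S T : adjointable S -> adjointable T ->
  comm_bounded S -> comm_bounded T -> comm_bounded (S \o T).
Proof.
move=> [[S' SS'] [KS KS0 bS]] [_ [KT KT0 bT]] [D cD [K K0 bK]] [E cE [L L0 bL]].
exists ((D \o T) + (S \o E)).
  move=> x y xy p.
  have h q : (E x + T y) q = (plen q)%:R * T x q.
    by rewrite fockDE (cE _ _ xy) subrK.
  rewrite fopDE fockDE /= (cD _ _ h).
  by rewrite -[E x]scale1r (adjoint_linear _ _ _ SS') !scale1r fockDE opprD addrA addrAC subrK.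
exists (K * KT + KS * L); first by rewrite addr_ge0 // mulr_ge0.
have h := bounded_comb 1 (bounded_comp K0 bK bT) (bounded_comp KS0 bS bL).
by rewrite scale1r (cabs_real 1) normr1 mul1r in h.
Qed.

Lemma comm_fproj v : has_comm (fproj R v) 0.
Proof.
move=> x y xy p; rewrite fop0E fock0E !fprojE xy.
by case: ifP; rewrite ?subrr // mulr0 subr0.
Qed.

Lemma comm_creat e : has_comm (creat R e) (creat R e).
Proof.
move=> x y xy p.
have E z : creat R e z p = oapp (z : gpath G -> R[i]) 0 (puncons e p) by [].
rewrite !E; case h : (puncons e p) => [q|] /=; last by rewrite mulr0 subr0.
have [/(congr1 snd) /= pq _] := punconsP h.
rewrite xy {1}/plen pq /= -/(plen q) -natr1; ring.
Qed.

Lemma comm_annih e : has_comm (annih R e) (- annih R e).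
Proof.
move=> x y xy p.
have E z : annih R e z p = oapp (z : gpath G -> R[i]) 0 (pcons e p) by [].
rewrite fopNE fockNE !E; case h : (pcons e p) => [q|] /=; last by rewrite mulr0 subr0 oppr0.
have [/(congr1 snd) /= pq _] := pconsP h.
rewrite xy /plen pq /= -natr1; ring.
Qed.

Lemma comm_bounded0 : comm_bounded 0.
Proof.
exists 0; first by move=> x y _ p; rewrite !fop0E !fock0E mulr0 subr0.
by exists 0 => // x; rewrite fop0E fnorm0 mul0r.
Qed.

(** Creation operators are eigenvectors of the commutator with N for the eigenvalue 1, annihilation
    operators for -1; the Leibniz rule does the rest. *)
Lemma comm_bounded_wick p : comm_bounded (wick mu p).
Proof.
suff [] : adjointable (wick mu p) /\ comm_bounded (wick mu p) by [].
move: p; apply: (wick_ind mu_pos (Q := fun S => adjointable S /\ comm_bounded S)).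
- move=> k S T [aS cS] [aT cT].
  by split; [exact: adjointable_lin|exact: comm_bounded_lin].
- move=> v; split; first exact: adjointable_fproj.
  exists 0; first exact: comm_fproj.
  by exists 0 => // x; rewrite fop0E fnorm0 mul0r.
- move=> e T [aT cT]; split.
    by apply: adjointable_comp => //; exact: adjointable_Xop.
  apply: comm_bounded_comp => //; first exact: adjointable_Xop.
  apply: comm_bounded_lin.
    exists (creat R e); first exact: comm_creat.
    by exists 1 => //; exact: pull_op_bounded.
  rewrite -[X in comm_bounded X]addr0; apply: comm_bounded_lin; last exact: comm_bounded0.
  exists (- annih R (dop e)); first exact: comm_annih.
  exists 1 => // x; rewrite fopNE fnormN; exact: pull_op_bounded.
Qed.

Lemma comm_bounded_span S : loop_wick_span mu v0 S -> comm_bounded S.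
Proof.
move: S; apply: lspan_ind => [|k S T|_ [p _ <-]].
- exact: comm_bounded0.
- exact: comm_bounded_lin.
- exact: comm_bounded_wick.
Qed.

Lemma npair_image S D x y : loop_algebra mu v0 S -> has_comm S D -> npair x y ->
  npair (S x) (D x + S y).
Proof.
move=> lS cD [sx xy]; split; first exact: loop_supportedP.
by move=> p; rewrite fockDE (cD _ _ xy) subrK.
Qed.

Lemma comm_graphP S D (z : fock R G * fock R G) : loop_algebra mu v0 S -> has_comm S D ->
  comm_graph mu v0 S z <-> exists2 y, npair z.1 y & z.2 = D z.1.
Proof.
move=> lS cD; split=> [[y [w [/number_graphP zy /number_graphP Sw z2]]]|[y zy z2]].
  exists y => //; rewrite z2; apply: fock_eq => p.
  by rewrite fockBE (cD _ _ zy.2) Sw.2.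
exists y, (D z.1 + S y); split; try apply/number_graphP => //.
  exact: npair_image.
by rewrite z2 addrK.
Qed.

Lemma npair0 : npair 0 0.
Proof. by split=> p; rewrite ?fock0E ?mulr0. Qed.

Lemma npairZ (k : R[i]) x y : npair x y -> npair (k *: x) (k *: y).
Proof.
move=> [sx xy]; split=> p; first by move=> np; rewrite fockZE sx ?mulr0.
by rewrite !fockZE xy mulrCA.
Qed.

Lemma lip_ge0 S : loop_wick_span mu v0 S -> (0 <= lip mu v0 S)%E.
Proof.
move=> hS; have [D cD _] := comm_bounded_span hS.
have lS := loop_wick_span_loop mu_pos hS.
apply: ereal_sup_ubound; exists (0, 0) => /=; last by rewrite fnorm0.
split; last by rewrite /= fnorm0.
apply/(comm_graphP _ lS cD) => /=; exists 0; first exact: npair0.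
apply: fock_eq => p; rewrite (cD 0 0); last by move=> q; rewrite fock0E mulr0.
by rewrite fock0E; have [[T ST] _] := loop_adjointable lS;
  rewrite linear_map0 ?mulr0 ?subr0 // => c u w; exact: (adjoint_linear c u w ST).
Qed.

(** The supremum over the unit ball turns into a homogeneous inequality by rescaling; homogeneity of
    [D] on the domain of N follows from the commutator identity. *)
Lemma lip_leP S D (l : R) : loop_wick_span mu v0 S -> has_comm S D -> 0 <= l ->
  (lip mu v0 S <= l%:E)%E <-> forall x y, npair x y -> fnorm (D x) <= l * fnorm x.
Proof.
move=> hS cD l0; have lS := loop_wick_span_loop mu_pos hS.
split=> [h x y xy|h]; last first.
  apply: ge_ereal_sup => _ [[x z] [/(comm_graphP _ lS cD) /= [y xy ->] x1] <-].
  rewrite lee_fin; apply: le_trans (h _ _ xy) _.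
  by rewrite ler_piMr.
have DZ (k : R[i]) : D (k *: x) = k *: D x.
  have [[T ST] _] := loop_adjointable lS.
  have SZ w : S (k *: w) = k *: S w.
    rewrite -[k *: w]addr0 (adjoint_linear k w 0 ST) linear_map0 ?addr0 //.
    by move=> c u t; exact: (adjoint_linear c u t ST).
  apply: fock_eq => p; rewrite fockZE (cD _ _ xy.2) (cD _ _ (npairZ k xy).2) !SZ !fockZE.
  by move: (S x p) (S y p) => /= a b; ring.
have [x0|x0] := eqVneq (fnorm x) 0.
  by have := DZ 0; rewrite scale0r scale0r -(fnorm_eq0 x0) x0 mulr0 => ->; rewrite (fnorm_eq0 x0) fnorm0.
have xp : 0 < fnorm x by rewrite lt_neqAle eq_sym x0 fnorm_ge0.
pose k : R[i] := ((fnorm x)^-1)%:C.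
have ck : cabs k = (fnorm x)^-1 by rewrite cabs_real ger0_norm // invr_ge0 ltW.
have : ((fnorm (D (k *: x)))%:E <= l%:E)%E.
  apply: le_trans h; apply: ereal_sup_ubound; exists (k *: x, D (k *: x)) => //.
  split; last by rewrite /= fnormZ ck mulVf.
  by apply/(comm_graphP _ lS cD) => /=; exists (k *: y) => //; exact: npairZ.
by rewrite lee_fin DZ fnormZ ck mulrC ler_pdivrMr.
Qed.

Lemma lip_fin S : loop_wick_span mu v0 S -> lip mu v0 S \is a fin_num.
Proof.
move=> hS; have [D cD [K K0 bK]] := comm_bounded_span hS.
rewrite ge0_fin_numE ?lip_ge0 //; apply: (@le_lt_trans _ _ K%:E); last by rewrite ltry.
by apply/(lip_leP hS cD K0) => x y _; exact: bK.
Qed.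

Lemma lip_fine S D : loop_wick_span mu v0 S -> has_comm S D ->
  forall x y, npair x y -> fnorm (D x) <= fine (lip mu v0 S) * fnorm x.
Proof.
move=> hS cD; apply/(lip_leP hS cD); first by rewrite fine_ge0 // lip_ge0.
by rewrite fineK // lip_fin.
Qed.

Lemma lip_add S T : loop_wick_span mu v0 S -> loop_wick_span mu v0 T ->
  (lip mu v0 (S + T)%R <= lip mu v0 S + lip mu v0 T)%E.
Proof.
move=> hS hT; have [D cD _] := comm_bounded_span hS; have [E cE _] := comm_bounded_span hT.
rewrite -(fineK (lip_fin hS)) -(fineK (lip_fin hT)) -EFinD.
rewrite (_ : (S + T)%R = 1 *: S + T); last by rewrite scale1r.
apply/(lip_leP (lspan_lin 1 hS hT) (has_comm_lin 1 cD cE)).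
  by rewrite addr_ge0 // fine_ge0 // lip_ge0.
move=> x y xy; rewrite fopDE fopZE !scale1r mulrDl; apply: le_trans (fnormD _ _) _.
by apply: lerD; [exact: (lip_fine hS cD xy)|exact: (lip_fine hT cE xy)].
Qed.

Lemma lip_scale_le (k : R[i]) S : loop_wick_span mu v0 S ->
  (lip mu v0 (k *: S)%R <= (cabs k)%:E * lip mu v0 S)%E.
Proof.
move=> hS; have [D cD _] := comm_bounded_span hS.
rewrite -(fineK (lip_fin hS)) -EFinM -[k *: S]addr0.
have h0 : loop_wick_span mu v0 (0 : fop R G) by exact: lspan0.
have cE0 : has_comm (0 : fop R G) 0 by move=> x y _ p; rewrite !fop0E !fock0E mulr0 subr0.
apply/(lip_leP (lspan_lin k hS h0) (has_comm_lin k cD cE0)).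
  by rewrite mulr_ge0 ?cabs_ge0 // fine_ge0 // lip_ge0.
move=> x y xy; rewrite addr0 fopZE fnormZ -mulrA ler_wpM2l ?cabs_ge0 //.
exact: (lip_fine hS cD xy).
Qed.

Lemma lspan_scale (k : R[i]) S : loop_wick_span mu v0 S -> loop_wick_span mu v0 (k *: S).
Proof. by move=> hS; rewrite -[k *: S]addr0; apply: lspan_lin => //; exact: lspan0. Qed.

Lemma lip_scale (k : R[i]) S : loop_wick_span mu v0 S ->
  lip mu v0 (k *: S)%R = ((cabs k)%:E * lip mu v0 S)%E.
Proof.
move=> hS; apply/eqP; rewrite eq_le lip_scale_le //=.
have [->|k0] := eqVneq k 0.
  by rewrite cabs0 mul0e lip_ge0 //; exact: lspan_scale.
have ck : 0 < cabs k.
  by rewrite lt_neqAle cabs_ge0 andbT eq_sym; apply: contra_neq k0 => /cabs_eq0.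
rewrite -lee_pdivlMl //.
have := lip_scale_le k^-1 (lspan_scale k hS).
rewrite scalerA mulVf // scale1r.
by rewrite {1}/cabs ComplexField.Normc.normcV.
Qed.

Lemma npair_vac : npair vac 0.
Proof.
split; first exact: vac_supported.
move=> p; rewrite fock0E /vac pvec_dvec dvecE; case: eqP => [->|_].
  by rewrite /plen /= mul0r.
by rewrite mulr0.
Qed.

(** As N annihilates the vacuum, [N, S] sends the vacuum to N S vac; if this is 0, only the
    coefficient of the empty loop survives. *)
Lemma lip_kernel S : loop_wick_span mu v0 S ->
  lip mu v0 S = 0%E <-> exists k : R[i], S = k *: fproj R v0.
Proof.
move=> hS; split=> [l0|[k ->]]; last first.
  rewrite lip_scale; last exact: loop_wick_span_one.
  suff -> : lip mu v0 (fproj R v0) = 0%E by rewrite mule0.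
  apply/eqP; rewrite eq_le lip_ge0 ?andbT; last exact: loop_wick_span_one.
  apply/(lip_leP (loop_wick_span_one v0 mu_pos) (@comm_fproj v0) (lexx 0)) => x y _.
  by rewrite fop0E fnorm0 mul0r.
have [D cD _] := comm_bounded_span hS.
have Dv : D vac = 0.
  apply: fnorm_eq0; apply/eqP; rewrite eq_le fnorm_ge0 andbT.
  by have := lip_fine hS cD npair_vac; rewrite l0 mul0r.
have [F [uF FL F0 eS]] := loop_wick_repr mu_pos hS.
have S0 p : p != pnil v0 -> psrc p = v0 -> S vac p = 0.
  move=> pn sp; have := cD _ _ npair_vac.2 p; rewrite Dv fock0E.
  have [[T ST] _] := loop_adjointable (loop_wick_span_loop mu_pos hS).
  rewrite linear_map0; last by move=> c u t; exact: (adjoint_linear c u t ST).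
  rewrite fock0E subr0 => /esym /eqP; rewrite mulf_eq0 => /orP[|/eqP //].
  rewrite pnatr_eq0 => /eqP pl; case/eqP: pn; apply: val_inj => /=.
  move: sp pl; rewrite /psrc /plen; case: (p) => -[v s] /= _ -> /size0nil -> //.
exists (S vac (pnil v0) : R[i]); rewrite {1}eS -(wick_pnil mu_pos).
have [pF|pF] := boolP (pnil v0 \in F); last first.
  rewrite (F0 _ pF) scale0r big_seq big1 // => q qF; rewrite S0 ?scale0r //.
    by apply: contraNneq pF => <-.
  by have [] := FL _ qF.
rewrite (big_rem _ pF) /= big_seq big1 ?addr0 // => q.
rewrite mem_rem_uniq // !inE => /andP[qn qF]; rewrite S0 ?scale0r //.
by have [] := FL _ qF.
Qed.

End NumberOperator.

(** * Norm estimates *)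

Section FiniteCauchySchwarz.
Variable R : realType.

(** By Lagrange's identity, the double sum of squares is twice the difference of the two sides. *)
Lemma cauchy_schwarz_real (T : Type) (r : seq T) (P : pred T) (u v : T -> R) :
  (\sum_(i <- r | P i) u i * v i) ^+ 2 <=
  (\sum_(i <- r | P i) u i ^+ 2) * (\sum_(i <- r | P i) v i ^+ 2).
Proof.
have : 0 <= \sum_(i <- r | P i) \sum_(j <- r | P j) (u i * v j - u j * v i) ^+ 2.
  by apply: sumr_ge0 => i _; apply: sumr_ge0 => j _; exact: sqr_ge0.
have -> : \sum_(i <- r | P i) \sum_(j <- r | P j) (u i * v j - u j * v i) ^+ 2 =
  2 * ((\sum_(i <- r | P i) u i ^+ 2) * (\sum_(i <- r | P i) v i ^+ 2)) -
  2 * (\sum_(i <- r | P i) u i * v i) ^+ 2.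
  transitivity (\sum_(i <- r | P i) (u i ^+ 2 * (\sum_(j <- r | P j) v j ^+ 2) +
      v i ^+ 2 * (\sum_(j <- r | P j) u j ^+ 2) -
      2 * ((u i * v i) * \sum_(j <- r | P j) u j * v j))).
    apply: eq_bigr => i _; rewrite !mulr_sumr -big_split /= -sumrB.
    by apply: eq_bigr => j _; ring.
  rewrite sumrB big_split /= -!mulr_suml -mulr_sumr -mulr_suml; ring.
by rewrite subr_ge0 ler_pM2l.
Qed.

Lemma cauchy_schwarz (T : Type) (r : seq T) (P : pred T) (a b : T -> R[i]) :
  cabs (\sum_(i <- r | P i) a i * b i) ^+ 2 <=
  (\sum_(i <- r | P i) cabs (a i) ^+ 2) * (\sum_(i <- r | P i) cabs (b i) ^+ 2).
Proof.
apply: le_trans (cauchy_schwarz_real _ _ _ _).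
rewrite ler_pXn2r ?nnegrE ?cabs_ge0 //; last first.
  by apply: sumr_ge0 => i _; rewrite mulr_ge0 ?cabs_ge0.
apply: le_trans (cabs_sum _ _ _) _.
by apply: ler_sum => i _; rewrite cabsM.
Qed.

End FiniteCauchySchwarz.

(** * Haagerup's inequality for a single component *)

Section Haagerup.
Variables (R : realType) (G : ugraph) (mu : vert G -> R) (v0 : vert G).
Hypotheses (mu_pos : forall v, 0 < mu v) (mu_min : forall v, mu v0 <= mu v).
Implicit Types (S T D : fop R G) (p q : gpath G) (x y z : fock R G).
Local Notation vac := (vac R v0).
Local Notation es p := (pval p).2.

(** For a loop the weight is the square of mu4(v0)/mu4(w), with w the vertex reached after [i]
    edges. This is where minimality of mu at [v0] enters. *)
Lemma wwt_le1 s i : endpt v0 s = v0 -> 0 <= wwt mu v0 s i <= 1.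
Proof.
move=> e; rewrite /wwt e; set w := endpt _ _.
have a := mu4_gt0 mu_pos v0; have b := mu4_gt0 mu_pos w.
have ab : mu4 mu v0 <= mu4 mu w.
  by rewrite /mu4 ge0_ler_powR ?invr_ge0 // nnegrE ltW.
have b2 : 0 < mu4 mu w ^+ 2 by rewrite exprn_gt0.
apply/andP; split.
  by apply: divr_ge0; [apply: mulr_ge0|]; apply: ltW.
by rewrite ler_pdivrMr // mul1r -expr2 ler_pXn2r // nnegrE ltW.
Qed.

Lemma ev_sum_le (I : eqType) (J : seq I) (L : I -> seq (dedge G)) x v :
  uniq J -> {in J &, injective L} ->
  (forall j, j \in J -> walk v0 (L j) -> endpt v0 (L j) = v) ->
  \sum_(j <- J) cabs (ev x v0 (L j)) ^+ 2 <= fnorm x ^+ 2.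
Proof.
move=> uJ iL eL.
pose Y : seq (gpath G) := pmap insub [seq (v0, L j) | j <- J].
have -> : \sum_(j <- J) cabs (ev x v0 (L j)) ^+ 2 = \sum_(p <- Y) cabs (x p) ^+ 2.
  rewrite /Y; elim: (J) => [|j J' IH]; first by rewrite !big_nil.
  have -> : pmap insub [seq (v0, L j) | j <- j :: J'] = oapp (cons^~ (pmap insub
      [seq (v0, L j) | j <- J'])) (pmap insub [seq (v0, L j) | j <- J'])
      (insub (v0, L j) : option (gpath G)) by [].
  rewrite big_cons IH /ev; case: insubP => [p _ _|_].
    by rewrite [oapp (cons^~ _) _ _]/= big_cons.
  by rewrite [oapp (x : gpath G -> R[i]) _ _]/= cabs0 expr0n add0r.
apply: (seq_le_fnorm (v := v)) => [|p].
  by apply: pmap_sub_uniq; rewrite map_inj_in_uniq // => i j iJ jJ [] /iL; apply.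
rewrite /Y mem_pmap_sub => /mapP [j jJ pj].
have := eL j jJ; rewrite /ptgt -[pval p]/(val p) pj; apply.
by case: p pj => -[u t] w /= [<- <-].
Qed.

(* The component of degree [k] with [i] creation operators of a combination of
   Wick words. *)
Definition comp_part (F : seq (gpath G)) (c : gpath G -> R[i]) k i x p : R[i] :=
  if psrc p == v0 then
    \sum_(s <- F | plen s == k) c s * wterm mu v0 (es s) x (es p) i
  else 0.

Definition l2_part (F : seq (gpath G)) (c : gpath G -> R[i]) k : R :=
  Num.sqrt (\sum_(s <- F | plen s == k) cabs (c s) ^+ 2).

Lemma dop_inj : injective (@dop G).
Proof. exact: (can_inj (@dopK G)). Qed.

Lemma revop_inj : injective (@revop G).
Proof. by move=> s t /(congr1 rev); rewrite /revop !revK => /inj_map; apply; exact: dop_inj. Qed.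

Lemma gpath_eq p q : psrc p = psrc q -> es p = es q -> p = q.
Proof.
move=> h1 h2; apply: val_inj.
by rewrite -[val p]/(pval p) -[val q]/(pval q) [pval p]surjective_pairing h2 -[(pval p).1]/(psrc p) h1;
  case: (q) => -[].
Qed.

(** Cauchy-Schwarz over the words that share their first [i] edges with [p] separates the
    coefficients of words s from the values of [x] for words t. For fixed s, the pair (p, t) is
    determined by the path at which [x] is evaluated: the reversed tail of t has the known length k
    - i, and the first [i] edges are those of s. So these values contribute at most the squared norm
    of [x]. *)
Lemma comp_part_le F c k i x v X : uniq F -> (forall p, p \in F -> loops_at v0 p) ->
  uniq X -> (forall p, p \in X -> ptgt p = v) ->
  \sum_(p <- X) cabs (comp_part F c k i x p) ^+ 2 <= (l2_part F c k * fnorm x) ^+ 2.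
Proof.
move=> uF FL uX XD.
pose w s q := ev x v0 (revop (drop i (es s)) ++ drop i (es q)).
rewrite exprMn sqr_sqrtr; last by apply: sumr_ge0 => s _; exact: sqr_ge0.
apply: (@le_trans _ _ (\sum_(p <- X | psrc p == v0)
   \sum_(s <- F | (plen s == k) && (take i (es p) == take i (es s))) cabs (c s) ^+ 2 *
   \sum_(t <- F | (plen t == k) && (take i (es p) == take i (es t))) cabs (w t p) ^+ 2)).
  rewrite [leRHS]big_mkcond /=; apply: ler_sum => p _; rewrite /comp_part.
  case: ifP => sp; last by rewrite cabs0 expr0n.
  rewrite (bigID (fun s => take i (es p) == take i (es s))) /= [X in _ + X]big1 ?addr0; last first.
    by move=> s /andP[_ /negPf h]; rewrite /wterm h mulr0.
  apply: le_trans (cauchy_schwarz _ _ _ _) _.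
  rewrite -mulr_suml ler_wpM2l //; first by apply: sumr_ge0 => s _; exact: sqr_ge0.
  rewrite big_seq_cond [leRHS]big_seq_cond; apply: ler_sum => s /andP[sF /andP[_ h]].
  have [ss ts] := FL _ sF.
  have es0 : endpt v0 (es s) = v0 by rewrite -{1}ss.
  rewrite /wterm h es0 cabsM cabs_real exprMn.
  have /andP[w0 w1] := wwt_le1 i es0.
  by rewrite ger0_norm // ler_piMl ?sqr_ge0 // exprn_ile1.
rewrite (exchange_big_dep (fun s => plen s == k)) /=; last by move=> p s _ /andP[].
rewrite mulr_suml big_seq_cond [leRHS]big_seq_cond; apply: ler_sum => s /andP[sF sk].
rewrite -mulr_sumr ler_wpM2l ?sqr_ge0 // sk /=.
pose J := [seq (p, t) | p <- [seq p <- X | (psrc p == v0) && (take i (es p) == take i (es s))],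
   t <- [seq t <- F | (plen t == k) && (take i (es s) == take i (es t))]].
have -> : \sum_(p <- X | (psrc p == v0) && (take i (es p) == take i (es s)))
    \sum_(t <- F | (plen t == k) && (take i (es p) == take i (es t))) cabs (w t p) ^+ 2 =
  \sum_(j <- J) cabs (ev x v0 (revop (drop i (es j.2)) ++ drop i (es j.1))) ^+ 2.
  rewrite big_allpairs big_filter; apply: eq_bigr => p /andP[_ /eqP ->].
  by rewrite big_filter.
have memJ p t : (p, t) \in J -> [/\ p \in X, t \in F, psrc p = v0,
    plen t = k & take i (es p) = take i (es s) /\ take i (es t) = take i (es s)].
  move=> /allpairsP [[p' t'] /= [h1 h2 [-> ->]]].
  move: h1 h2; rewrite !mem_filter => /andP[/andP[/eqP a1 /eqP a2] a3].
  by move=> /andP[/andP[/eqP b1 /eqP b2] b3]; split.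
apply: (@ev_sum_le _ J (fun j => revop (drop i (es j.2)) ++ drop i (es j.1)) x v).
- apply: allpairs_uniq; [exact: filter_uniq|exact: filter_uniq|].
  by move=> [? ?] [? ?] _ _ [-> ->].
- move=> [p t] [p' t'] /memJ [pX tF sp lt [tp tt]] /memJ [pX' tF' sp' lt' [tp' tt']] /= e.
  have sz : size (revop (drop i (es t))) = size (revop (drop i (es t'))).
    by rewrite !size_revop !size_drop -[size (es t)]/(plen t) -[size (es t')]/(plen t') lt lt'.
  have [/revop_inj e1 e2] : revop (drop i (es t)) = revop (drop i (es t')) /\
      drop i (es p) = drop i (es p').
    by move/eqP: e; rewrite eqseq_cat // => /andP[/eqP -> /eqP ->].
  have -> : p = p'.
    apply: gpath_eq; first by rewrite sp sp'.
    by rewrite -(cat_take_drop i (es p)) tp e2 -tp' cat_take_drop.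
  have -> // : t = t'.
  apply: gpath_eq; first by have [-> _] := FL _ tF; have [-> _] := FL _ tF'.
  by rewrite -(cat_take_drop i (es t)) tt e1 -tt' cat_take_drop.
- move=> [p t] /memJ [pX tF sp lt [tp tt]] /= _.
  have [st et] := FL _ tF.
  have wt : walk v0 (take i (es t)) /\ walk (endpt v0 (take i (es t))) (drop i (es t)).
    by apply/andP; rewrite -walk_cat cat_take_drop -{1}st; case: (t).
  have [h1 h2] := revop_path wt.2.
  have ee : endpt (endpt v0 (take i (es t))) (drop i (es t)) = v0.
    by rewrite -endpt_cat cat_take_drop -{1}st.
  rewrite endpt_cat -{1}ee h2 tt -tp -endpt_cat cat_take_drop -{1}sp.
  exact: XD.
Qed.

End Haagerup.

(** * Tails of the sum of inverse squares *)

Section InverseSquares.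
Variable R : realType.

Definition far (N m n : nat) := (n + N < m)%N || (m + N < n)%N.
Definition far_inv (N m n : nat) : R := if far N m n then (m%:R - n%:R)^-1 else 0.

(** Telescopes, so that the inverse squares beyond N sum to at most 1/N. *)
Lemma inv_sq_le (t : R) : 2 <= t -> t ^- 2 <= (t - 1)^-1 - t^-1.
Proof.
move=> t2; have t0 : 0 < t by lra. have t1 : 0 < t - 1 by lra.
have -> : (t - 1)^-1 - t^-1 = (t * (t - 1))^-1 by field; rewrite !gt_eqF.
rewrite lef_pV2 ?posrE ?mulr_gt0 ?exprn_gt0 // expr2; nra.
Qed.

Lemma far_inv_le1 N m n : (0 < N)%N -> `|far_inv N m n| <= 1.
Proof.
move=> N0; rewrite /far_inv /far; case: ifP => h; last by rewrite normr0.
rewrite normfV invf_le1.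
  case/orP: h => h.
    by rewrite ger0_norm ?subr_ge0 ?ler_nat; rewrite -?natrB ?ler1n; lia.
  by rewrite distrC ger0_norm ?subr_ge0 ?ler_nat; rewrite -?natrB ?ler1n; lia.
by rewrite normr_gt0 subr_eq0 eqr_nat; lia.
Qed.

Lemma far_inv_sum N M n : (0 < N)%N ->
  \sum_(m < M) far_inv N m n ^+ 2 <= 2 / N%:R.
Proof.
move=> N0.
have -> : \sum_(m < M) far_inv N m n ^+ 2 =
  \sum_(m < M) (if (n + N < m)%N then (m%:R - n%:R : R) ^- 2 else 0) +
  \sum_(m < M) (if (m + N < n)%N then (n%:R - m%:R : R) ^- 2 else 0).
  rewrite -big_split /=; apply: eq_bigr => m _; rewrite /far_inv /far.
  case: (ltnP (n + N) m) => h1; case: (ltnP (m + N) n) => h2 //=.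
  - lia.
  - by rewrite addr0 exprVn.
  - by rewrite add0r exprVn -(opprB n%:R) sqrrN.
  - by rewrite expr0n addr0.
have N1 : 0 < N%:R :> R by rewrite ltr0n.
suff [h1 h2] : \sum_(m < M) (if (n + N < m)%N then (m%:R - n%:R : R) ^- 2 else 0) <= N%:R^-1 /\
    \sum_(m < M) (if (m + N < n)%N then (n%:R - m%:R : R) ^- 2 else 0) <= N%:R^-1.
  by rewrite mulr_natl mulr2n lerD.
split.
  (* The induction on [M] needs the telescoped bound with its remainder. *)
  apply: (@le_trans _ _ (if (n + N < M)%N then N%:R^-1 - (M%:R - n%:R - 1)^-1 else 0)).
    elim: M => [|M IH]; first by rewrite big_ord0 ltn0.
    rewrite big_ord_recr /=; case: (ltnP (n + N) M) IH => h IH.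
      have -> : (n + N < M.+1)%N by lia.
      have t2 : 2 <= M%:R - n%:R :> R.
        by rewrite -natrB ?ler_nat; lia.
      have := inv_sq_le t2; move: IH; rewrite -natr1.
      have -> : M%:R + 1 - n%:R - 1 = M%:R - n%:R :> R by ring.
      lra.
    rewrite addr0; apply: le_trans IH _; case: ifP => // h'.
    have -> : M = (n + N)%N by lia.
    rewrite -natr1 natrD.
    have -> : n%:R + N%:R + 1 - n%:R - 1 = N%:R :> R by ring.
    by rewrite subrr.
  case: ifP => h; last by rewrite invr_ge0.
  by rewrite gerBl invr_ge0 -addrA -opprD natr1 subr_ge0 ler_nat; lia.
(* Below n the inverse squares increase with m; the telescoped bound grows until [M] reaches n - N
   and stays at 1/N afterwards. *)
apply: (@le_trans _ _ (if (M + N <= n)%N then (n%:R - M%:R)^-1 else N%:R^-1)).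
  elim: M => [|M IH].
    by rewrite big_ord0; case: ifP => _; rewrite invr_ge0 ?subr0.
  rewrite big_ord_recr /=; case: (ltnP (M + N) n) => h.
    move: IH; rewrite (ltnW h).
    have t2 : 2 <= n%:R - M%:R :> R by rewrite -natrB ?ler_nat; lia.
    have := inv_sq_le t2; rewrite -natr1 opprD addrA; lra.
  rewrite addr0; apply: le_trans IH _.
  case: ifP => // h'; have -> : n = (M + N)%N by lia.
  by rewrite natrD addrC addKr.
case: ifP => h //; rewrite lef_pV2 ?posrE // -?natrB ?ltr0n ?ler_nat; lia.
Qed.

End InverseSquares.

(** * Splitting an operator by its change of length *)

Section NormEstimates.
Variables (R : realType) (G : ugraph) (mu : vert G -> R) (v0 : vert G).
Hypotheses (mu_pos : forall v, 0 < mu v) (mu_min : forall v, mu v0 <= mu v).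
Implicit Types (S T D : fop R G) (p q : gpath G) (x y z : fock R G).
Local Notation vac := (vac R v0).
Local Notation es p := (pval p).2.
Local Notation comp := (comp_part mu v0).

Lemma fock_weight (g : gpath G -> R) x : (forall p, `|g p| <= 1) ->
  exists z : fock R G, forall p, z p = (g p)%:C * x p.
Proof.
move=> g1; have zf : ((fun p => (g p)%:C * x p) : gpath G -> R[i]^o) \in @fock_pred R G.
  rewrite inE; have xf := fvalP x; rewrite inE in xf.
  apply: (@in_fock_dominated _ _ 1 x x) => // v; rewrite mul1e.
  apply: (@le_trans _ _ (sqnorm_at v x)); last by rewrite leeDl // sqnorm_ge0.
  apply: le_esum => p _; rewrite lee_fin cabsM cabs_real exprMn ler_piMl ?sqr_ge0 //.
  by rewrite exprn_ile1.
by exists (Fock zf).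
Qed.

Lemma vacE p : vac p = (p == pnil v0)%:R.
Proof. by rewrite /vac pvec_dvec dvecE. Qed.

Lemma vac_norm : fnorm vac <= 1.
Proof.
apply: fnorm_le => // v X uX _; rewrite expr1n.
have -> : \sum_(p <- X) cabs (vac p) ^+ 2 = (count_mem (pnil v0) X)%:R.
  elim: (X) => [|p X' IH]; first by rewrite big_nil.
  rewrite big_cons IH vacE [count_mem _ _]/= natrD; congr (_ + _).
  rewrite -[pred1 _ p]/(p == pnil v0); case: eqP => _; last by rewrite mulr0n cabs0 expr0n.
  by rewrite mulr1n (cabs_real 1) normr1 expr1n.
by rewrite (count_uniq_mem _ uX) lern1 leq_b1.
Qed.

Lemma ev_weight (g : nat -> R) x z : (forall p, z p = (g (plen p))%:C * x p) ->
  forall v s, ev z v s = (g (size s))%:C * ev x v s.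
Proof.
move=> h v s; rewrite /ev; case: insubP => [p _ pv|_]; last by rewrite mulr0.
by rewrite [LHS]h /plen -[pval p]/(val p) pv.
Qed.

(** A component of degree [k] with [i] creations evaluates [x] only at paths of one length: k - i
    edges are removed and [i] created. Hence a weight depending on the length comes out as a factor.
    At paths with fewer than [i] edges the component vanishes. *)
Lemma comp_weight F c k i (g : nat -> R) x z p : (i <= k)%N ->
  (forall p, z p = (g (plen p))%:C * x p) ->
  comp F c k i z p = (if (i <= plen p)%N then g ((k - i) + (plen p - i))%N else 0)%:C *
    comp F c k i x p.
Proof.
move=> ik h; rewrite /comp_part; case: ifP => _; last by rewrite mulr0.
rewrite mulr_sumr; apply: eq_bigr => s /eqP sk; rewrite /wterm.
case: eqP => e; last by rewrite !mulr0.
have ip : (i <= plen p)%N.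
  have := congr1 size e; rewrite !size_take_min -[size (es s)]/(plen s) sk (minn_idPl ik) => h1.
  by rewrite -h1 geq_minr.
rewrite ip (ev_weight h) size_cat size_revop !size_drop -[size (es s)]/(plen s) sk.
by rewrite -/(plen p); ring.
Qed.

Section Decomposition.
Variables (S : fop R G) (F : seq (gpath G)) (d : nat).
Hypotheses (uF : uniq F) (FL : forall p, p \in F -> loops_at v0 p)
  (eS : S = \sum_(p <- F) (S vac p : R[i]) *: wick mu p)
  (Fd : forall p, p \in F -> (plen p <= d)%N).
Local Notation c := (fun p => S vac p : R[i]).

Lemma op_comp x p : S x p = \sum_(k < d.+1) \sum_(i < k.+1) comp F c k i x p.
Proof.
rewrite {1}eS fop_sumE fock_sumE.
transitivity (\sum_(s <- F) if psrc p == v0 then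
    c s * \sum_(i < (plen s).+1) wterm mu v0 (es s) x (es p) i else 0).
  rewrite big_seq [RHS]big_seq; apply: eq_bigr => s sF; have [ss _] := FL sF.
  rewrite fopZE fockZE -(ev_path (wick mu s x)) ev_wick // ss.
  by rewrite -[(pval p).1]/(psrc p); case: ifP => _; rewrite ?mulr0.
transitivity (\sum_(k < d.+1) \sum_(s <- F | plen s == k) if psrc p == v0 then
    c s * \sum_(i < (plen s).+1) wterm mu v0 (es s) x (es p) i else 0).
  rewrite (exchange_big_dep xpredT) //= big_seq [RHS]big_seq.
  apply: eq_bigr => s sF; have sd : (plen s < d.+1)%N by rewrite ltnS Fd.
  rewrite (bigD1 (Ordinal sd)) //= [X in _ + X]big1 ?addr0 // => k /andP[/eqP sk].
  by rewrite -val_eqE /= sk eqxx.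
apply: eq_bigr => k _; rewrite /comp_part; case: (psrc p == v0); last first.
  by rewrite !big1.
rewrite exchange_big /=; apply: eq_bigr => s /eqP ->.
by rewrite mulr_sumr.
Qed.

Lemma l2_part_ge0 k : 0 <= l2_part F c k.
Proof. exact: sqrtr_ge0. Qed.

Lemma haagerup_bound : bounded_by (\sum_(k < d.+1) k.+1%:R * l2_part F c k) S.
Proof.
move=> x; apply: fnorm_le => [|v X uX XD].
  rewrite mulr_ge0 ?fnorm_ge0 // sumr_ge0 // => k _.
  by rewrite mulr_ge0 // l2_part_ge0.
under eq_bigr do rewrite op_comp.
rewrite mulr_suml; apply: minkowski_sum => [k _|k _].
  by rewrite !mulr_ge0 ?l2_part_ge0 ?fnorm_ge0.
have -> : k.+1%:R * l2_part F c k * fnorm x = \sum_(i < k.+1) l2_part F c k * fnorm x.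
  by rewrite sumr_const card_ord -mulrA mulr_natl.
apply: minkowski_sum => [i _|i _]; first by rewrite mulr_ge0 ?l2_part_ge0 ?fnorm_ge0.
exact: (comp_part_le mu_pos mu_min c k i x uF FL uX XD).
Qed.

(** With [i] creations and k - i annihilations the length changes by 2i - k, here by at most [N] in
    absolute value. *)
Definition near (N k i : nat) := (k <= 2 * i + N)%N && (2 * i <= k + N)%N.

Definition near_part N x p := \sum_(k < d.+1) \sum_(i < k.+1 | near N k i) comp F c k i x p.
Definition far_part N x p := \sum_(k < d.+1) \sum_(i < k.+1 | ~~ near N k i) comp F c k i x p.

Lemma near_far N x p : S x p = near_part N x p + far_part N x p.
Proof.
rewrite op_comp -big_split /=; apply: eq_bigr => k _.
by rewrite (bigID (fun i : 'I_k.+1 => near N k i)).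
Qed.

Lemma near_count N k : (\sum_(i < k.+1 | near N k i) 1 <= N.+1)%N.
Proof.
rewrite -(big_mkord (near N k) (fun=> 1%N)) sum1_count -size_filter.
(* The admissible [i] lie among the N + 1 integers starting at half of k - N, rounded up. *)
rewrite -(size_iota ((k - N + 1) %/ 2) N.+1).
apply: uniq_leq_size; first by rewrite filter_uniq // iota_uniq.
by move=> i; rewrite mem_filter !mem_iota /near /index_iota; lia.
Qed.

Lemma near_part_le N x v X : uniq X -> (forall p, p \in X -> ptgt p = v) ->
  \sum_(p <- X) cabs (near_part N x p) ^+ 2 <=
  (N.+1%:R * (\sum_(k < d.+1) l2_part F c k) * fnorm x) ^+ 2.
Proof.
move=> uX XD; rewrite mulr_sumr mulr_suml; apply: minkowski_sum => [k _|k _].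
  by rewrite !mulr_ge0 ?l2_part_ge0 ?fnorm_ge0.
apply: (@le_trans _ _ ((\sum_(i < k.+1 | near N k i) l2_part F c k * fnorm x) ^+ 2)).
  apply: minkowski_sum => [i _|i _]; first by rewrite mulr_ge0 ?l2_part_ge0 ?fnorm_ge0.
  exact: (comp_part_le mu_pos mu_min c k i x uF FL uX XD).
have l0 : 0 <= l2_part F c k * fnorm x by rewrite mulr_ge0 ?l2_part_ge0 ?fnorm_ge0.
rewrite ler_pXn2r ?nnegrE //; last 2 first.
- by apply: sumr_ge0.
- by rewrite -mulrA mulr_ge0.
rewrite -[X in \sum_(_ < _ | _) X]mul1r -mulr_suml -mulrA ler_wpM2r //.
have -> : \sum_(i < k.+1 | near N k i) 1 = (\sum_(i < k.+1 | near N k i) 1)%N%:R :> R.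
  by rewrite natr_sum.
by rewrite ler_nat near_count.
Qed.

Lemma l2_part_le_vac k : l2_part F c k <= fnorm (S vac).
Proof.
rewrite -(ler_pXn2r (n := 2)) ?nnegrE ?l2_part_ge0 ?fnorm_ge0 //.
rewrite sqr_sqrtr; last by apply: sumr_ge0 => s _; exact: sqr_ge0.
rewrite -big_filter; apply: (seq_le_fnorm (v := v0)); first exact: filter_uniq.
by move=> p; rewrite mem_filter => /andP[_ /FL []].
Qed.

Lemma haagerup_vac : bounded_by ((d.+1%:R) ^+ 2 * fnorm (S vac)) S.
Proof.
move=> x; apply: le_trans (haagerup_bound x) _; rewrite ler_wpM2r ?fnorm_ge0 //.
apply: (@le_trans _ _ (\sum_(k < d.+1) d.+1%:R * fnorm (S vac))).
  apply: ler_sum => k _; rewrite ler_pM ?l2_part_ge0 ?l2_part_le_vac //.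
  by rewrite ler_nat.
by rewrite sumr_const card_ord -(mulr_natl (_ * _)) mulrA expr2.
Qed.

Variables (D : fop R G) (l : R).
Hypotheses (hS : loop_wick_span mu v0 S) (cD : has_comm S D) (l0 : 0 <= l)
  (Dl : forall x y, npair v0 x y -> fnorm (D x) <= l * fnorm x).

(** The commutator bound at the vacuum, where the commutator multiplies the coefficient of each loop
    by its length. *)
Lemma l2_part_lip : \sum_(k < d.+1) (k%:R * l2_part F c k) ^+ 2 <= l ^+ 2.
Proof.
have nv := @npair_vac R G v0.
have h := Dl nv; have v1 := vac_norm.
have Dv p : D vac p = (plen p)%:R * S vac p.
  have [[T ST] _] := loop_adjointable (loop_wick_span_loop mu_pos hS).
  rewrite (cD nv.2) linear_map0 ?fock0E ?subr0 // => k x y; exact: (adjoint_linear k x y ST).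
apply: (@le_trans _ _ (\sum_(p <- F) cabs (D vac p) ^+ 2)).
  rewrite [leRHS](_ : _ = \sum_(k < d.+1) \sum_(p <- F | plen p == k) cabs (D vac p) ^+ 2).
    apply: ler_sum => k _; rewrite exprMn sqr_sqrtr; last first.
      by apply: sumr_ge0 => s _; exact: sqr_ge0.
    rewrite mulr_sumr; apply: ler_sum => p /eqP pk.
    rewrite Dv cabsM exprMn pk; apply: ler_wpM2r; first exact: sqr_ge0.
    by rewrite -[(k%:R : R[i])](rmorph_nat (real_complex R)) cabs_real ger0_norm.
  rewrite (exchange_big_dep xpredT) //= big_seq [RHS]big_seq.
  apply: eq_bigr => s sF; have sd : (plen s < d.+1)%N by rewrite ltnS Fd.
  rewrite (bigD1 (Ordinal sd)) //= [X in _ + X]big1 ?addr0 // => k /andP[/eqP sk].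
  by rewrite -val_eqE /= sk eqxx.
apply: (le_trans (seq_le_fnorm (v := v0) (D vac) uF _)); first by move=> p /FL [].
rewrite ler_pXn2r ?nnegrE ?fnorm_ge0 //; apply: le_trans h _.
by rewrite -[leRHS]mulr1 ler_wpM2l.
Qed.

Lemma far_weight_npair N m x y z : (0 < N)%N -> npair v0 x y ->
  (forall p, z p = (far_inv R N m (plen p))%:C * x p) -> exists w, npair v0 z w.
Proof.
move=> N0 xy zE.
have [w wE] := @fock_weight (fun p => far_inv R N m (plen p)) y
  (fun p => far_inv_le1 R m (plen p) N0).
exists w; split=> q; first by move=> nq; rewrite zE xy.1 ?mulr0.
by rewrite wE zE xy.2 mulrCA.
Qed.

(* On vectors of length [m], the part of [S x] coming from length differences
   larger than [N] equals the commutator applied to the vector [x] whose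
   components of length [n] are divided by [m - n]. *)
Lemma far_part_comm N x y m z p : (0 < N)%N -> npair v0 x y -> plen p = m ->
  (forall p, z p = (far_inv R N m (plen p))%:C * x p) ->
  D z p = far_part N x p.
Proof.
move=> N0 xy pm zE; have [w zw] := far_weight_npair N0 xy zE.
rewrite (cD zw.2) !op_comp pm mulr_sumr -sumrB.
rewrite /far_part; apply: eq_bigr => k _; rewrite [RHS]big_mkcond mulr_sumr -sumrB.
apply: eq_bigr => i _; have ik : (i <= k)%N by rewrite -ltnS.
have wE q : w q = (((plen q)%:R * far_inv R N m (plen q)))%:C * x q.
  by rewrite zw.2 zE mulrA rmorphM /= rmorph_nat.
rewrite (comp_weight F c (g := far_inv R N m) _ ik zE).
rewrite (comp_weight F c (g := fun n => n%:R * far_inv R N m n) _ ik wE).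
rewrite pm; case: (leqP i m) => im; last first.
  (* With the constant weight 1, [comp_weight] says that a component with more creations than the
     length of [p] vanishes at [p]. *)
  have x1 q : x q = ((fun=> 1) (plen q) : R)%:C * x q by rewrite mul1r.
  rewrite (comp_weight F c (g := fun=> 1) p ik x1) pm leqNgt im /=.
  by rewrite !mul0r !mulr0 subrr; case: ifP.
set n := (k - i + (m - i))%N; set t := comp _ _ _ _ _ _.
rewrite mulrA -mulrBl rmorphM /= !rmorph_nat -mulrBl /far_inv.
(* The change of length m - n is 2i - k. *)
have -> : ~~ near N k i = far N m n by rewrite /near /far /n; lia.
case: ifP => h; last by rewrite mulr0 mul0r.
have mn : m%:R - n%:R != 0 :> R.
  by rewrite subr_eq0 eqr_nat; move: h; rewrite /far; lia.
rewrite -[X in X * _ * _](_ : (m%:R - n%:R : R)%:C = _); last first.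
  by rewrite rmorphB /= !rmorph_nat.
by rewrite -rmorphM divff // mul1r.
Qed.

Lemma fnorm_sq_supported x : loop_supported v0 x ->
  fnorm x ^+ 2 <= fine (sqnorm_at v0 x).
Proof.
move=> sx; have s0 : 0 <= fine (sqnorm_at v0 x) by rewrite fine_ge0 // sqnorm_ge0.
rewrite -(sqr_sqrtr s0) ler_pXn2r ?nnegrE ?sqrtr_ge0 ?fnorm_ge0 //.
apply: fnorm_le_sqnorm => [|v]; first exact: sqrtr_ge0.
rewrite sqr_sqrtr // -sqnorm_val; case: (eqVneq v v0) => [-> //|/eqP vv].
rewrite [leLHS]esum1 ?sqnorm_ge0 // => p pv; rewrite sx ?cabs0 ?expr0n //.
by move=> [_ tp]; apply: vv; rewrite -pv.
Qed.

(** Summing over [m] first, the squared coefficient at a path of length n is multiplied by the sum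
    of 1/(m - n)^2 over m far from n, at most 2/N. *)
Lemma far_weight_sum N M x (Z : nat -> fock R G) : (0 < N)%N -> loop_supported v0 x ->
  (forall m p, Z m p = (far_inv R N m (plen p))%:C * x p) ->
  \sum_(m < M) fnorm (Z m) ^+ 2 <= 2 / N%:R * fnorm x ^+ 2.
Proof.
move=> N0 sx ZE.
apply: (@le_trans _ _ (\sum_(m < M) fine (sqnorm_at v0 (Z m)))).
  apply: ler_sum => m _; apply: fnorm_sq_supported => p np.
  by rewrite ZE sx ?mulr0.
rewrite -lee_fin -sumEFin; under eq_bigr do rewrite -sqnorm_val.
rewrite /sqnorm_at -esum_sum; last by move=> *; rewrite lee_fin sqr_ge0.
have n2 : 0 <= 2 / N%:R :> R by rewrite divr_ge0.
rewrite EFinM; apply: (@le_trans _ _ ((2 / N%:R)%:E * sqnorm_at v0 x)%E); last first.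
  by apply: lee_wpmul2l; [rewrite lee_fin|exact: sqnorm_le_fnorm].
rewrite /sqnorm_at -esumZ // => [|p]; last exact: sqr_ge0.
apply: le_esum => p _; rewrite sumEFin lee_fin.
under eq_bigr do rewrite ZE cabsM cabs_real exprMn real_normK ?num_real //.
by rewrite -mulr_suml ler_wpM2r ?sqr_ge0 // far_inv_sum.
Qed.

(** Values at different lengths are orthogonal, and at length m the far part agrees with [D (Z m)],
    whose norm is at most l times that of [Z m]. Thus a separate input vector may be used for each
    target length. *)
Lemma far_part_le N x y X : (0 < N)%N -> npair v0 x y ->
  uniq X -> (forall p, p \in X -> ptgt p = v0) ->
  \sum_(p <- X) cabs (far_part N x p) ^+ 2 <= l ^+ 2 * (2 / N%:R * fnorm x ^+ 2).
Proof.
move=> N0 xy uX XD.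
have [Z ZE] : {Z : nat -> fock R G & forall m p,
    Z m p = (far_inv R N m (plen p))%:C * x p}.
  apply: (@boolp.choice _ _ (fun m (z : fock R G) => forall p,
    z p = (far_inv R N m (plen p))%:C * x p)) => m.
  by apply: fock_weight => p; exact: far_inv_le1.
pose M := (\max_(p <- X) plen p).+1.
have pM p : p \in X -> (plen p < M)%N.
  by move=> pX; rewrite ltnS (big_rem p) //= leq_maxl.
have -> : \sum_(p <- X) cabs (far_part N x p) ^+ 2 =
  \sum_(m < M) \sum_(p <- X | plen p == m) cabs (D (Z m) p) ^+ 2.
  rewrite (exchange_big_dep xpredT) //= big_seq [RHS]big_seq.
  apply: eq_bigr => p pX; rewrite (bigD1 (Ordinal (pM p pX))) //=.
  rewrite [X in _ + X]big1 ?addr0 => [|m /andP[/eqP pm]]; last first.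
    by rewrite -val_eqE /= pm eqxx.
  by rewrite (far_part_comm (m := plen p) N0 xy erefl (ZE (plen p))).
apply: (@le_trans _ _ (\sum_(m < M) l ^+ 2 * fnorm (Z m) ^+ 2)).
  apply: ler_sum => m _; rewrite -big_filter -exprMn.
  apply: (@le_trans _ _ (fnorm (D (Z m)) ^+ 2)).
    apply: (seq_le_fnorm (v := v0)); first exact: filter_uniq.
    by move=> p; rewrite mem_filter => /andP[_ /XD].
  have [w zw] := far_weight_npair N0 xy (ZE m).
  by rewrite ler_pXn2r ?nnegrE ?fnorm_ge0 ?mulr_ge0 ?fnorm_ge0 // (Dl zw).
rewrite -mulr_sumr ler_wpM2l ?sqr_ge0 //.
exact: far_weight_sum N0 xy.1 ZE.
Qed.

Lemma norm_estimate N s x y : (0 < N)%N -> 0 <= s -> 2 / N%:R <= s ^+ 2 ->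
  npair v0 x y ->
  fnorm (S x) <= (N.+1%:R * (\sum_(k < d.+1) l2_part F c k) + l * s) * fnorm x.
Proof.
move=> N0 s0 Ns xy.
have A0 : 0 <= N.+1%:R * (\sum_(k < d.+1) l2_part F c k).
  by rewrite mulr_ge0 // sumr_ge0 // => k _; exact: l2_part_ge0.
have B0 : 0 <= l * s by rewrite mulr_ge0.
apply: fnorm_le => [|v X uX XD]; first by rewrite mulr_ge0 ?fnorm_ge0 // addr_ge0.
case: (eqVneq v v0) => [vv|/eqP vv]; last first.
  rewrite big_seq big1 ?sqr_ge0 // => p pX.
  have := loop_supportedP (loop_wick_span_loop mu_pos hS) xy.1 (p := p).
  move=> ->; first by rewrite cabs0 expr0n.
  by move=> [_ tp]; apply: vv; rewrite -(XD _ pX).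
rewrite mulrDl; under eq_bigr do rewrite (near_far N).
apply: minkowski2.
- by rewrite mulr_ge0 ?fnorm_ge0.
- by rewrite mulr_ge0 ?fnorm_ge0.
- exact: (near_part_le N x uX XD).
apply: le_trans (far_part_le N0 xy uX _) _; first by move=> p /XD ->.
have -> : (l * s * fnorm x) ^+ 2 = l ^+ 2 * (s ^+ 2 * fnorm x ^+ 2) by ring.
by rewrite ler_wpM2l ?sqr_ge0 // ler_wpM2r ?sqr_ge0.
Qed.

End Decomposition.
End NormEstimates.

(** * From the GNS space to all states *)

Section StateEstimate.
Variables (R : realType) (G : ugraph) (mu : vert G -> R) (v0 : vert G).
Hypotheses (mu_pos : forall v, 0 < mu v) (mu_min : forall v, mu v0 <= mu v).
Implicit Types (S T D : fop R G) (p q : gpath G) (x y z : fock R G).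
Local Notation vac := (vac R v0).
Local Notation es p := (pval p).2.
Local Notation lspan0 := (loop_wick_span mu v0).

Lemma loop_wick_support S : lspan0 S -> exists F : seq (gpath G),
  [/\ uniq F, forall p, p \in F -> loops_at v0 p,
      forall p, (p \in F) = (S vac p != 0) &
      S = \sum_(p <- F) (S vac p : R[i]) *: wick mu p].
Proof.
move=> hS; have [F [uF FL F0 eS]] := loop_wick_repr mu_pos hS.
exists [seq p <- F | S vac p != 0]; split.
- exact: filter_uniq.
- by move=> p; rewrite mem_filter => /andP[_ /FL].
- move=> p; rewrite mem_filter andb_idr //; apply: contraR => /F0 ->.
  by rewrite eqxx.
- rewrite {1}eS (bigID (fun p => S vac p != 0)) /= [X in _ + X]big1 ?addr0.
    by rewrite -big_filter.
  by move=> p; rewrite negbK => /eqP ->; rewrite scale0r.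
Qed.

(** The degree bound that is additive under composition, so that degrees of powers grow linearly. *)
Definition raises (d : nat) S := forall m x, (forall p, (m < plen p)%N -> x p = 0) ->
  forall p, (m + d < plen p)%N -> S x p = 0.

Lemma raises_wick q : raises (plen q) (wick mu q).
Proof.
move=> m x xm p mp; rewrite -(ev_path (wick mu q x)) ev_wick //; case: ifP => // _.
rewrite big1 // => i _; rewrite /wterm; case: ifP => // _.
rewrite /ev; case: insubP => [r _ rv|_]; last by rewrite mulr0.
rewrite [oapp _ _ _]/= xm ?mulr0 //.
have -> : plen r = size (revop (drop i (es q)) ++ drop i (es p)).
  by rewrite /plen -[pval r]/(val r) rv.
rewrite size_cat size_revop !size_drop -/(plen p) -/(plen q).
by have := ltn_ord i; lia.
Qed.

Lemma raises_span S : lspan0 S -> exists d, raises d S.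
Proof.
move: S; apply: lspan_ind => [|k S T [d hS] [e hT]|_ [p _ <-]].
- by exists 0%N => m x _ p _; rewrite fop0E.
- exists (maxn d e) => m x xm p mp; rewrite fopDE fopZE fockDE fockZE.
  by rewrite (hS _ _ xm) ?(hT _ _ xm) ?mulr0 ?addr0 //; lia.
- by exists (plen p); exact: raises_wick.
Qed.

Lemma raises_comp d e S T : raises d S -> raises e T -> raises (d + e) (S \o T).
Proof.
move=> hS hT m x xm p mp; apply: (hS (m + e)%N) => [q mq|]; last by lia.
exact: hT xm q mq.
Qed.

Lemma haagerup_raises d S : lspan0 S -> raises d S ->
  bounded_by ((d.+1%:R) ^+ 2 * fnorm (S vac)) S.
Proof.
move=> hS rS; have [F [uF FL FS eS]] := loop_wick_support hS.
apply: (haagerup_vac mu_pos mu_min uF FL eS) => p; rewrite FS => pn0.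
rewrite leqNgt; apply: contra pn0 => dp; apply/eqP.
apply: (rS 0%N) => [q q0|//]; rewrite vacE; case: eqP => // qE.
by move: q0; rewrite qE.
Qed.

(** The Lip norm gives information on the domain of N only; this domain is preserved by the
    polynomial algebra, so such bounds can be multiplied. *)
Definition core_bounded (k : R) S := forall x y, npair v0 x y ->
  fnorm (S x) <= k * fnorm x.

Lemma core_bounded_comp k l S T : 0 <= k -> lspan0 T ->
  core_bounded k S -> core_bounded l T -> core_bounded (k * l) (S \o T).
Proof.
move=> k0 hT hS hT' x y xy /=.
have [D cD _] := comm_bounded_span mu_pos hT.
have xy' := npair_image (loop_wick_span_loop mu_pos hT) cD xy.
by apply: le_trans (hS _ _ xy') _; rewrite -mulrA ler_wpM2l // (hT' _ _ xy).
Qed.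

(** The core bound of the 2^n-th power of X^* X is (2k^2)^(2^n). Applied to the vacuum it feeds
    [haagerup_raises], which gives a Fock bound with an extra factor quadratic in 2^n d;
    [state_power] removes this factor. *)
Lemma state_core_bounded (phi : state mu v0) (X : loop_alg mu v0) (k : R) : 0 < k ->
  lspan0 (lval X) -> core_bounded k (lval X) -> cabs (phi X) <= 2 * k.
Proof.
move=> k0 hX bX; have [[T XT] _] := loop_adjointable (loop_algP X).
pose Y := mkloop (loop_adjoint (loop_algP X) XT).
have hY : lspan0 (lval Y) by apply: (loop_wick_span_adjoint mu_pos hX); exact: XT.
have bY : core_bounded (2 * k) (lval Y).
  move=> x y xy; have [D cD _] := comm_bounded_span mu_pos hY.
  have xy' := npair_image (loop_algP Y) cD xy.
  exact: (adjoint_bounded_at (ltW k0) XT (bX _ _ xy')).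
have hH : lspan0 (lval (lmul Y X)) by exact: loop_wick_span_comp.
pose B := dyadic_power (lmul Y X).
have hB n : lspan0 (lval (B n)).
  by elim: n => [//|n IH]; exact: loop_wick_span_comp.
have bB n : core_bounded ((2 * k * k) ^+ (2 ^ n)) (lval (B n)).
  elim: n => [|n IH].
    by rewrite expr1; apply: core_bounded_comp bY bX => //; rewrite mulr_ge0 // ltW.
  rewrite expnS mul2n -addnn exprD; apply: core_bounded_comp => //.
  by rewrite exprn_ge0 // !mulr_ge0 // ltW.
have [d rd] := raises_span hH.
have rB n : raises (2 ^ n * d) (lval (B n)).
  elim: n => [|n IH]; first by rewrite mul1n.
  by rewrite expnS mul2n -addnn mulnDl; exact: raises_comp.
have h : cabs (phi X) ^+ 2 <= 2 * k * k.
  apply: (@state_power _ _ _ _ phi X Y 1 (2 * k * k) d) => //; first by rewrite !mulr_gt0.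
  move=> n; rewrite mul1r => x; apply: le_trans (haagerup_raises (hB n) (rB n) x) _.
  rewrite ler_wpM2r ?fnorm_ge0 // ler_wpM2l ?exprn_ge0 //.
  apply: le_trans (bB n _ _ (@npair_vac R G v0)) _.
  by rewrite ler_piMr ?vac_norm // exprn_ge0 // !mulr_ge0 // ltW.
rewrite -(ler_pXn2r (n := 2)) ?nnegrE ?cabs_ge0 ?mulr_ge0 ?(ltW k0) //.
apply: le_trans h _; rewrite exprMn -mulrA -expr2 ler_wpM2r ?sqr_ge0 //.
by rewrite expr2 ler_peMl // ler1n.
Qed.

End StateEstimate.

(** * The topology of the state space *)

Section FiniteLoops.
Variables (G : ugraph).
Hypothesis hfin : locally_finite G.

Lemma finite_out (v : vert G) : finite_set [set e : dedge G | src e = v].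
Proof.
have h : finite_set ([set e : uedge G | (ends e).1 = v \/ (ends e).2 = v] `*` [set: bool]).
  by apply: finite_setX; [exact: hfin|exact: finite_finset].
have i : {in @dval G @^-1` ([set e : uedge G | (ends e).1 = v \/ (ends e).2 = v] `*` [set: bool]) &,
    injective (@dval G)} by move=> e e' _ _; exact: val_inj.
apply: sub_finite_set (finite_preimage i h) => e /= <-.
by split => //; rewrite /src; case: (dval e).2; [right|left].
Qed.

Lemma finite_walks n (v : vert G) : finite_set [set s | walk v s /\ size s = n].
Proof.
elim: n v => [|n IH] v.
  by apply: sub_finite_set (finite_set1 [::]) => s /= [_ /size0nil].
apply: (@sub_finite_set _ _ (\bigcup_(e in [set e : dedge G | src e = v])
   (cons e @` [set s | walk (tgt e) s /\ size s = n]))).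
  move=> [|e s] /= [] // /andP[/eqP ev ws] [sn].
  by exists e => //=; exists s.
apply: bigcup_finite; first exact: finite_out.
by move=> e _; apply: finite_image; exact: IH.
Qed.

Lemma finite_loops (v : vert G) K : exists L : seq (gpath G),
  uniq L /\ forall p, loops_at v p -> (plen p <= K)%N -> p \in L.
Proof.
have h : finite_set (\bigcup_(n in `I_K.+1) [set s | walk v s /\ size s = n]).
  by apply: bigcup_finite => [|n _]; [exact: finite_II|exact: finite_walks].
set H := \bigcup_(n in _) _ in h.
pose B : set (gpath G) := [set p | loops_at v p /\ (plen p <= K)%N].
have fB : finite_set B.
  have i : {in @pval G @^-1` ([set v] `*` H) &, injective (@pval G)}.
    by move=> p q _ _; exact: val_inj.
  apply: sub_finite_set (finite_preimage i (finite_setX (finite_set1 v) h)).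
  move=> p [[sp _] pK]; split => //=; exists (plen p) => //=.
  by split => //; rewrite -sp; case: (p).
exists (finmap.enum_fset (fset_set B)); split; first exact: finmap.fset_uniq.
move=> p lp pK; have := in_fset_set fB p => e; rewrite [_ \in _]e inE.
by split.
Qed.

End FiniteLoops.

(** * Equicontinuity of differences of states *)

Section Equicontinuity.
Variables (R : realType) (G : ugraph) (mu : vert G -> R) (v0 : vert G).
Hypotheses (mu_pos : forall v, 0 < mu v) (mu_min : forall v, mu v0 <= mu v).
Hypothesis hfin : locally_finite G.
Implicit Types (S T D : fop R G) (p q : gpath G) (x y z : fock R G).
Local Notation vac := (vac R v0).
Local Notation lspan0 := (loop_wick_span mu v0).

Lemma sum_sq_le (I : Type) (r : seq I) (P : pred I) (a : I -> R) :
  (forall i, 0 <= a i) ->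
  \sum_(i <- r | P i) a i ^+ 2 <= (\sum_(i <- r | P i) a i) ^+ 2.
Proof.
move=> a0; elim: r => [|i r IH]; first by rewrite !big_nil expr0n.
rewrite !big_cons; case: ifP => // _.
have h : 0 <= \sum_(j <- r | P j) a j by apply: sumr_ge0.
rewrite sqrrD; apply: (le_trans (lerD (lexx _) IH)); rewrite -addrA lerD2l lerDr.
by rewrite mulrn_wge0 // mulr_ge0.
Qed.

(** Degrees up to k0^2 involve only loops of [L], with coefficients at most [eta]. Beyond, the
    l^2-norm is written as (k |c_k|)(1/k) and split by Young's inequality with parameter k0; the two
    sums contribute 2/k0 and 1/k0. Here [far_inv] with n = 0 is 1/k, restricted to k > k0^2. *)
Lemma l2_part_sum (F : seq (gpath G)) (c : gpath G -> R[i]) d k0 (eta : R) (L : seq (gpath G)) :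
  (0 < k0)%N -> 0 <= eta -> uniq F ->
  (forall p, p \in F -> (plen p <= k0 ^ 2)%N -> p \in L /\ cabs (c p) <= eta) ->
  \sum_(k < d.+1) (k%:R * l2_part F c k) ^+ 2 <= 2 ^+ 2 ->
  \sum_(k < d.+1) l2_part F c k <= (size L)%:R * eta + 3 / k0%:R.
Proof.
move=> k00 eta0 uF FL hl.
have k1 : 0 < k0%:R :> R by rewrite ltr0n.
apply: (@le_trans _ _ (\sum_(k < d.+1) (
   (\sum_(p <- [seq p <- F | (plen p <= k0 ^ 2)%N] | plen p == k) cabs (c p)) +
   ((2 * k0%:R)^-1 * (k%:R * l2_part F c k) ^+ 2 + k0%:R / 2 * far_inv R (k0 ^ 2) k 0 ^+ 2)))).
  apply: ler_sum => k _.
  have A0 : 0 <= l2_part F c k by exact: sqrtr_ge0.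
  case: (leqP k (k0 ^ 2)) => kK.
    apply: ler_wpDr.
      by rewrite addr_ge0 // mulr_ge0 ?sqr_ge0 ?invr_ge0 ?divr_ge0 ?mulr_ge0 ?ltW.
    rewrite big_filter_cond -(ler_pXn2r (n := 2)) ?nnegrE //; last first.
      by apply: sumr_ge0 => p _; exact: cabs_ge0.
    rewrite sqr_sqrtr; last by apply: sumr_ge0 => p _; exact: sqr_ge0.
    rewrite (eq_bigl (fun p => plen p == k)) => [|p]; last first.
      by case: (eqVneq (plen p) k) => [->|_]; rewrite ?kK ?andbF.
    by apply: sum_sq_le => p; exact: cabs_ge0.
  apply: ler_wpDl; first by apply: sumr_ge0 => p _; exact: cabs_ge0.
  rewrite /far_inv /far add0n kK /= subr0.
  have kp : 0 < k%:R :> R by rewrite ltr0n; lia.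
  have -> : (2 * k0%:R)^-1 * (k%:R * l2_part F c k) ^+ 2 + k0%:R / 2 * k%:R^-1 ^+ 2 =
     l2_part F c k + (k%:R * l2_part F c k - k0%:R * k%:R^-1) ^+ 2 / (2 * k0%:R).
    by field; rewrite !gt_eqF.
  by rewrite lerDl divr_ge0 ?sqr_ge0 // mulr_ge0 // ltW.
rewrite big_split big_split /= -!mulr_sumr; apply: lerD.
  have -> : \sum_(k < d.+1) \sum_(p <- [seq p <- F | (plen p <= k0 ^ 2)%N] | plen p == k) cabs (c p) =
    \sum_(p <- [seq p <- F | (plen p <= k0 ^ 2)%N]) \sum_(k < d.+1 | plen p == k) cabs (c p).
    by rewrite (exchange_big_dep xpredT).
  apply: (@le_trans _ _ (\sum_(p <- [seq p <- F | (plen p <= k0 ^ 2)%N]) eta)).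
    rewrite big_seq [leRHS]big_seq; apply: ler_sum => p; rewrite mem_filter => /andP[pK pF].
    have [_ cp] := FL p pF pK; apply: le_trans cp.
    case: (ltnP (plen p) d.+1) => pd.
      rewrite (big_pred1 (Ordinal pd)) // => k; by rewrite /= -val_eqE eq_sym.
    rewrite big1 ?cabs_ge0 // => k /eqP pk.
    by move: pd; rewrite pk ltnNge leq_ord.
  rewrite big_const_seq count_predT iter_addr_0 -(mulr_natl eta) ler_wpM2r // ler_nat.
  apply: uniq_leq_size; first exact: filter_uniq.
  by move=> p; rewrite mem_filter => /andP[pK pF]; have [] := FL p pF pK.
have h2 := far_inv_sum R d.+1 0 (_ : (0 < k0 ^ 2)%N).
have {}h2 : \sum_(k < d.+1) far_inv R (k0 ^ 2) k 0 ^+ 2 <= 2 / (k0 ^ 2)%:R.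
  by apply: h2; rewrite expn_gt0 k00.
have a1 : 0 <= (2 * k0%:R)^-1 :> R by rewrite invr_ge0 mulr_ge0 // ltW.
have a2 : 0 <= k0%:R / 2 :> R by rewrite divr_ge0 // ltW.
apply: (le_trans (lerD (ler_wpM2l a1 hl) (ler_wpM2l a2 h2))).
rewrite natrX le_eqVlt; apply/orP; left; apply/eqP; field; rewrite gt_eqF //.
Qed.

Lemma nat_above (a : R) : exists n : nat, (0 < n)%N /\ a <= n%:R.
Proof. by exists (Num.truncn a).+1; split => //; apply/ltW/truncnS_gt. Qed.

(** The Lip bound is 2 because the lemma serves for differences of two elements of the Lip ball. *)
Lemma state_equicontinuity (e : R) : 0 < e -> exists (L : seq (gpath G)) (eta : R), [/\ 0 < eta,
  forall p, p \in L -> loops_at v0 p /\ (0 < plen p)%N &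
  forall X : loop_alg mu v0, lspan0 (lval X) -> (lip mu v0 (lval X) <= 2%:E)%E ->
    (forall p, p \in L -> cabs (lval X vac p) <= eta) ->
    forall phi psi : state mu v0, cabs (phi X - psi X) <= e].
Proof.
move=> e0.
(* Three contributions are made at most e/12: the far part 2/M, since 2/N = 1/M^2; the high degrees
   3(N + 1)/k0; and the loops in [L], through [eta]. The core bound e/4 becomes e/2 for each of the
   two states. *)
have [M [M0 hM]] := nat_above (24 / e).
pose N := (2 * M ^ 2)%N.
have [k0 [k00 hk]] := nat_above (36 * N.+1%:R / e).
have [L0 [uL0 hL0]] := finite_loops hfin v0 (k0 ^ 2).
pose L := [seq p <- L0 | `[< loops_at v0 p >] && (0 < plen p)%N].
have n0 : 0 < 12 * N.+1%:R * (size L).+1%:R :> R by rewrite !mulr_gt0.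
pose eta := e / (12 * N.+1%:R * (size L).+1%:R).
have eta0 : 0 < eta by rewrite divr_gt0.
exists L, eta; split => // [p|X hX lX cX phi psi].
  by rewrite mem_filter => /andP[/andP[/asboolP]].
pose c : R[i] := lval X vac (pnil v0).
(* The coefficient of the empty loop is not controlled by L. Removing it changes neither the
   commutator nor the difference of two states. *)
pose X' := (- c) *: loop_one mu v0 + X.
have hX' : lspan0 (lval X').
  exact: (@lspan_lin _ _ _ (- c) (lval (loop_one mu v0)) (lval X) (loop_wick_span_one v0 mu_pos) hX).
have [D cD _] := comm_bounded_span mu_pos hX.
have Dl : forall x y, npair v0 x y -> fnorm (D x) <= 2 * fnorm x.
  by apply/(lip_leP mu_pos hX cD).
have cD' : has_comm (lval X') D.
  have := has_comm_lin (- c) (@comm_fproj R G v0) cD.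
  by rewrite scaler0 add0r.
have vX' p : lval X' vac p = if p == pnil v0 then 0 else lval X vac p.
  have -> : lval X' vac p = - c * vac p + lval X vac p.
    rewrite lvalDE lvalZE loneE fockDE fockZE fprojE; case: eqP => // sp.
    by rewrite (@vac_supported R G v0) // => -[].
  by rewrite vacE; case: eqP => [->|_]; rewrite ?mulr1 ?addNr // mulr0 add0r.
have [F [uF FL FS eS]] := loop_wick_support mu_pos hX'.
pose d := \max_(p <- F) plen p.
have Fd p : p \in F -> (plen p <= d)%N.
  by move=> pF; rewrite /d (big_rem p) //= leq_maxl.
have bX' : core_bounded v0 (e / 4) (lval X').
  move=> x y xy.
  have M1 : 0 < M%:R :> R by rewrite ltr0n.
  have hN : 2 / N%:R <= (M%:R^-1) ^+ 2 :> R.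
    rewrite /N natrM natrX exprVn le_eqVlt; apply/orP; left; apply/eqP.
    by field; rewrite gt_eqF.
  have s0 : 0 <= M%:R^-1 :> R by rewrite invr_ge0.
  have N0 : (0 < N)%N by rewrite muln_gt0 expn_gt0 M0.
  apply: le_trans (norm_estimate mu_pos mu_min uF FL eS Fd hX' cD' (ler0n R 2) Dl N0 s0 hN xy) _.
  rewrite ler_wpM2r ?fnorm_ge0 //.
  have hl := l2_part_lip mu_pos uF FL Fd hX' cD' (ler0n R 2) Dl.
  have := @l2_part_sum F (fun p => lval X' vac p) d k0 eta L k00 (ltW eta0) uF _ hl.
  move=> /(_ _); set A := \sum_(k < _) _ => hA.
  have {}hA : A <= (size L)%:R * eta + 3 / k0%:R.
    apply: hA => p pF pK; have pn : p != pnil v0.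
      by apply: contraTneq pF => ->; rewrite FS vX' eqxx eqxx.
    have pL : p \in L.
      have lp := FL p pF; rewrite mem_filter hL0 // andbT; apply/andP; split; first exact/asboolP.
      rewrite lt0n; apply: contra pn => /eqP /size0nil p0; apply/eqP.
      by apply: gpath_eq; [have [-> _] := lp|rewrite p0].
    by split => //; rewrite vX' (negPf pn) cX.
  have N1 : 0 < N.+1%:R :> R by rewrite ltr0n.
  have h1 : N.+1%:R * ((size L)%:R * eta) <= e / 12.
    have -> : e / 12 = N.+1%:R * ((size L).+1%:R * eta).
      by rewrite /eta; field; rewrite !gt_eqF.
    by rewrite ler_pM2l // ler_pM2r // ler_nat.
  have h2 : N.+1%:R * (3 / k0%:R) <= e / 12.
    have kp : 0 < k0%:R :> R by rewrite ltr0n.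
    rewrite mulrA ler_pdivrMr //; move: hk; rewrite ler_pdivrMr // => hk.
    by move: hk; rewrite (mulrC k0%:R) mulrAC; lra.
  have h3 : 2 * M%:R^-1 <= e / 12.
    rewrite ler_pdivrMr //; move: hM; rewrite ler_pdivrMr // => hM.
    by rewrite (mulrC M%:R) in hM; lra.
  have : N.+1%:R * A <= N.+1%:R * ((size L)%:R * eta + 3 / k0%:R) by rewrite ler_pM2l.
  rewrite mulrDr; lra.
have e4 : 0 < e / 4 by rewrite divr_gt0.
have s1 := state_core_bounded mu_pos mu_min phi e4 hX' bX'.
have s2 := state_core_bounded mu_pos mu_min psi e4 hX' bX'.
have -> : phi X - psi X = phi X' - psi X'.
  have E (chi : state mu v0) : chi X' = - c + chi X.
    by rewrite /X' linearD linearZ /= state_one mulr1.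
  by rewrite !E opprD addrACA subrr add0r.
apply: le_trans (cabsD _ _) _; rewrite cabsN; apply: le_trans (lerD s1 s2) _; lra.
Qed.

End Equicontinuity.

(** One function at a time: its range is cut into cells of width [eta] and the induction hypothesis
    is applied inside each cell, so that the net consists of points of [B] itself. *)
Lemma finite_net (R : realType) (I T : eqType) (f : I -> T -> R) (L : seq I)
    (eta : R) : 0 < eta -> forall B : set T,
  (forall i, i \in L -> forall X, B X -> `|f i X| <= 1) ->
  exists XS : seq T, (forall Y, Y \in XS -> B Y) /\
    forall X, B X -> exists2 Y, Y \in XS & forall i, i \in L -> `|f i X - f i Y| <= eta.
Proof.
move=> eta0; elim: L => [|i L IH] B fB.
  have [[X0 BX0]|nB] := pselect (exists X, B X).
    exists [:: X0]; split => [Y|X BX]; first by rewrite inE => /eqP ->.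
    by exists X0; rewrite ?inE.
  by exists [::]; split => // X BX; case: nB; exists X.
pose cell X := Num.truncn ((f i X + 1) / eta).
have [XS hXS] : {XS : nat -> seq T & forall k, (forall Y, Y \in XS k -> B Y /\ cell Y = k) /\
    forall X, B X -> cell X = k -> exists2 Y, Y \in XS k &
      forall j, j \in L -> `|f j X - f j Y| <= eta}.
  apply: (@boolp.choice _ _ (fun k XS => (forall Y, Y \in XS -> B Y /\ cell Y = k) /\
    forall X, B X -> cell X = k -> exists2 Y, Y \in XS &
      forall j, j \in L -> `|f j X - f j Y| <= eta)) => k.
  have [|XS [h1 h2]] := IH [set X | B X /\ cell X = k].
    by move=> j jL X [BX _]; apply: fB => //; rewrite inE jL orbT.
  by exists XS; split => // X BX cX; exact: h2.
pose M := (Num.truncn (2 / eta)).+1.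
exists (flatten [seq XS k | k <- iota 0 M]); split.
  by move=> Y /flattenP [_ /mapP [k _ ->] /(hXS k).1 []].
move=> X BX.
have f1 Y : B Y -> 0 <= (f i Y + 1) / eta <= 2 / eta.
  move=> BY; have := fB i (mem_head _ _) Y BY; rewrite ler_norml => /andP[a b].
  by rewrite divr_ge0 ?(ltW eta0) ?ler_pM2r ?invr_gt0 //=; lra.
have [Y YX hY] := (hXS (cell X)).2 X BX erefl.
exists Y.
  apply/flattenP; exists (XS (cell X)) => //; apply: map_f.
  rewrite mem_iota /= add0n ltnS; apply: le_truncn.
  by have /andP[] := f1 X BX.
have [BY cY] := (hXS (cell X)).1 Y YX.
move=> j; rewrite inE => /predU1P[->|]; last exact: hY.
have /andP[x0 _] := f1 X BX; have /andP[y0 _] := f1 Y BY.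
have /andP[] := truncn_itv x0; have /andP[] := truncn_itv y0.
rewrite -/(cell X) -/(cell Y) cY; rewrite -natr1.
rewrite !ler_pdivlMr // !ltr_pdivrMr // mulrDl mul1r => a b c d.
by rewrite ler_norml; apply/andP; split; lra.
Qed.

(** * Comparison of the two topologies *)

Section Topology.
Variables (R : realType) (G : ugraph) (mu : vert G -> R) (v0 : vert G).
Hypotheses (mu_pos : forall v, 0 < mu v) (mu_min : forall v, mu v0 <= mu v).
Hypothesis hfin : locally_finite G.
Local Notation vac := (vac R v0).
Local Notation lspan0 := (loop_wick_span mu v0).
Local Notation wk := (initial_topology (@state_eval R G mu v0)).

Lemma lip_coef (S : fop R G) p : lspan0 S -> (lip mu v0 S <= 1%:E)%E ->
  (0 < plen p)%N -> cabs (S vac p) <= 1.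
Proof.
move=> hS lS p0; have [D cD _] := comm_bounded_span mu_pos hS.
have Dl := (lip_leP mu_pos hS cD ler01).1 lS _ _ (@npair_vac R G v0).
have [[T ST] _] := loop_adjointable (loop_wick_span_loop mu_pos hS).
have := cD _ _ (@npair_vac R G v0).2 p.
rewrite linear_map0; last by move=> c x y; exact: (adjoint_linear c x y ST).
rewrite fock0E subr0 => Dv.
have := le_trans (cabs_le_fnorm (D vac) p) Dl; rewrite Dv cabsM mul1r.
rewrite -[(plen p)%:R](rmorph_nat (real_complex R)) cabs_real ger0_norm //.
move=> h; have := le_trans h (@vac_norm R G v0); apply: le_trans.
by rewrite ler_peMl ?cabs_ge0 // ler1n.
Qed.

Lemma cabs_le_Re_Im (z : R[i]) (e : R) : `|complex.Re z| <= e -> `|complex.Im z| <= e ->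
  cabs z <= 2 * e.
Proof.
move=> hr hi; rewrite [z]complexE; apply: le_trans (cabsD _ _) _.
rewrite cabsM !cabs_real.
have -> : cabs ('i%C : R[i]) = 1 by rewrite /cabs /= expr0n expr1n add0r sqrtr1.
by rewrite mul1r mulr_natl mulr2n lerD.
Qed.

(** On [L] the coefficients of elements of the Lip ball are bounded by 1, which gives a finite net.
    The difference from a net point has Lip norm at most 2 and small coefficients on [L], so
    [state_equicontinuity] applies. *)
Lemma lip_ball_net (e : R) : 0 < e -> exists XS : seq (loop_alg mu v0),
  forall phi psi : state mu v0,
    (forall Y, Y \in XS -> cabs (phi Y - psi Y) <= e) ->
    (lip_dist phi psi <= (2 * e)%:E)%E.
Proof.
move=> e0; have [L [eta [eta0 hL hX]]] := state_equicontinuity mu_pos mu_min hfin e0.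
pose f (i : gpath G * bool) (X : loop_alg mu v0) : R :=
  if i.2 then complex.Re (lval X vac i.1) else complex.Im (lval X vac i.1).
pose B : set (loop_alg mu v0) := [set X | lspan0 (lval X) /\ (lip mu v0 (lval X) <= 1%:E)%E].
(* The net is taken in real coordinates; accuracy eta/2 for real and imaginary parts gives eta for
   the complex coefficients. *)
have eta2 : 0 < eta / 2 by rewrite divr_gt0.
have [|XS [XSB hXS]] := @finite_net R _ _ f [seq (p, b) | p <- L, b <- [:: true; false]] _ eta2 B.
  move=> i /allpairsP [[p b] /= [pL _ ->]] X [hX1 lX].
  have h := lip_coef hX1 lX (hL p pL).2.
  by rewrite /f /=; case: b; apply: le_trans h; [exact: Re_le_cabs|exact: Im_le_cabs].
exists XS => phi psi h; apply: ge_ereal_sup => _ [X [pX lX] <-].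
rewrite poly_algebraE // in pX; rewrite lee_fin.
have [Y YXS hY] := hXS X (conj pX lX); have [pY lY] := XSB Y YXS.
have hXY : lspan0 (lval (X - Y)).
  rewrite addrC -scaleN1r.
  exact: (@lspan_lin _ _ _ (-1) (lval Y) (lval X) pY pX).
have lXY : (lip mu v0 (lval (X - Y)%R) <= 2%:E)%E.
  have -> : lval (X - Y) = lval X + (-1) *: lval Y by rewrite scaleN1r.
  apply: le_trans (lip_add mu_pos pX (lspan_scale (-1) pY)) _.
  rewrite lip_scale // cabsN (cabs_real 1) normr1 mul1e.
  by have := leeD lX lY; rewrite -EFinD.
have := hX (X - Y) hXY lXY _ phi psi.
have E (chi : state mu v0) : chi (X - Y) = chi X - chi Y by rewrite linearB.
rewrite !E => hXY'.
have -> : phi X - psi X = (phi X - phi Y - (psi X - psi Y)) + (phi Y - psi Y) by ring.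
apply: le_trans (cabsD _ _) _.
have -> : 2 * e = e + e by ring.
apply: lerD; last exact: h.
apply: hXY' => p pL.
have -> : eta = 2 * (eta / 2) by field.
have e1 : (lval (X - Y) vac p : R[i]) = lval X vac p - lval Y vac p by [].
rewrite e1; apply: cabs_le_Re_Im.
  have := hY (p, true); rewrite /f /=.
  have -> : complex.Re (lval X vac p - lval Y vac p : R[i]) =
    complex.Re (lval X vac p) - complex.Re (lval Y vac p).
    by case: (lval X vac p); case: (lval Y vac p).
  by apply; apply: (@allpairs_f _ _ _ (fun p b => (p, b)) L [:: true; false] p true pL).
have := hY (p, false); rewrite /f /=.
have -> : complex.Im (lval X vac p - lval Y vac p : R[i]) =
  complex.Im (lval X vac p) - complex.Im (lval Y vac p).
  by case: (lval X vac p); case: (lval Y vac p).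
by apply; apply: (@allpairs_f _ _ _ (fun p b => (p, b)) L [:: true; false] p false pL).
Qed.

Lemma eval_near (phi : state mu v0) (X : loop_alg mu v0) (e : R) : 0 < e ->
  nbhs (phi : wk) [set psi : state mu v0 | cabs (phi X - psi X) <= e].
Proof.
move=> e0.
have c : (fun psi : wk => (state_eval psi X : R[i]^o)) @ (phi : wk) --> (state_eval phi X : R[i]^o).
  apply: (@continuous_comp wk {ptws loop_alg mu v0 -> R[i]^o} R[i]^o (@state_eval R G mu v0)
    (fun g => g X)).
    exact: initial_continuous.
  exact: (@proj_continuous _ (fun _ => R[i]^o) X).
have e0' : 0 < e%:C by rewrite ltcR.
move/cvgrPdist_le : c => /(_ _ e0').
apply: filterS => psi /=.
by rewrite normc_def lecR /cabs; case: (_ - _).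
Qed.

Lemma lip_open_wkstar (U : set (state mu v0)) : lip_open U -> wkstar_open U.
Proof.
move=> hU; rewrite /wkstar_open openE => phi Uphi; rewrite /interior.
have [e e0 he] := hU phi Uphi.
have e4 : 0 < e / 4 by rewrite divr_gt0.
have [XS hXS] := lip_ball_net e4.
apply: (@filterS _ _ _ [set psi : state mu v0 | forall Y, Y \in XS -> cabs (phi Y - psi Y) <= e / 4]).
  move=> psi h; apply: he; apply: le_lt_trans (hXS phi psi h) _; rewrite lte_fin; lra.
elim: XS {hXS} => [|Y XS IH]; first by apply: filterS filterT => psi _ Y.
apply: filterS (filterI (eval_near phi Y e4) IH) => psi [h1 h2] Z.
by rewrite inE => /predU1P[->|/h2].
Qed.

Lemma lip_dist_eval (phi psi : state mu v0) (X : loop_alg mu v0) (l : R) : 0 < l ->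
  poly_algebra mu v0 (lval X) -> (lip mu v0 (lval X) <= l%:E)%E ->
  forall e : R, (lip_dist phi psi < e%:E)%E -> cabs (phi X - psi X) <= l * e.
Proof.
move=> l0 pX lX e he; have pX' := pX; rewrite poly_algebraE // in pX'.
have cl : cabs ((l^-1)%:C) = l^-1 by rewrite cabs_real ger0_norm // invr_ge0 ltW.
have : ((cabs (phi ((l^-1)%:C *: X) - psi ((l^-1)%:C *: X)))%:E <= lip_dist phi psi)%E.
  apply: ereal_sup_ubound; exists ((l^-1)%:C *: X) => //; split.
    by rewrite poly_algebraE //; exact: (lspan_scale (l^-1)%:C pX').
  rewrite -[X in lip _ _ X]/((l^-1)%:C *: lval X) lip_scale // cl.
  apply: le_trans (lee_wpmul2l _ lX) _; first by rewrite lee_fin invr_ge0 ltW.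
  by rewrite -EFinM mulVf // gt_eqF.
have E (chi : state mu v0) : chi ((l^-1)%:C *: X) = (l^-1)%:C * chi X by rewrite linearZ.
move=> /le_lt_trans /(_ he); rewrite !E -(mulrBr (l^-1)%:C) cabsM cl lte_fin.
by rewrite ltr_pdivrMl // => /ltW.
Qed.

(** Density of the polynomial algebra: the distance controls an approximant of [X], and
    [state_bounded], with its factor 3, controls the error uniformly in the state; the e/12 leave
    e/2 for the approximant. *)
Lemma lip_eval_cvg (phi : state mu v0) (X : loop_alg mu v0) (e : R) : 0 < e ->
  exists2 d : R, 0 < d & forall psi : state mu v0, (lip_dist phi psi < d%:E)%E ->
    cabs (phi X - psi X) <= e.
Proof.
move=> e0; have e12 : 0 < e / 12 by rewrite divr_gt0.
have [T hT bT] := loop_approx mu_pos (loop_algP X) e12.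
pose Y := mkloop (loop_wick_span_loop mu_pos hT).
pose l := fine (lip mu v0 T) + 1.
have l0 : 0 < l by rewrite ltr_wpDl // fine_ge0 // lip_ge0.
have lT : (lip mu v0 (lval Y) <= l%:E)%E.
  by rewrite -[lval Y]/T -(fineK (lip_fin mu_pos hT)) lee_fin lerDl.
exists (e / (2 * l)) => [|psi hpsi]; first by rewrite divr_gt0 // mulr_gt0.
have pY : poly_algebra mu v0 (lval Y) by rewrite poly_algebraE.
have h1 := lip_dist_eval l0 pY lT hpsi.
have bXY : bounded_by (e / 12) (lval (X - Y)) by exact: bT.
have h2 := state_bounded phi e12 bXY; have h3 := state_bounded psi e12 bXY.
have -> : phi X - psi X = phi (X - Y) - psi (X - Y) + (phi Y - psi Y).
  have E (chi : state mu v0) : chi (X - Y) = chi X - chi Y by rewrite linearB.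
  by rewrite !E; ring.
apply: le_trans (cabsD _ _) _; apply: le_trans (lerD (cabsD _ _) h1) _.
rewrite cabsN; have -> : l * (e / (2 * l)) = e / 2 by field; rewrite gt_eqF.
lra.
Qed.

Lemma wkstar_lip_open (U : set (state mu v0)) : wkstar_open U -> lip_open U.
Proof.
move=> [V oV <-] phi Vphi.
(* The filter of distance balls around phi. It converges to phi at every element, hence in the
   topology of pointwise convergence, and so it contains the given open set. *)
pose F : set_system (state mu v0) :=
  filter_from [set d : R | 0 < d] (fun d => [set psi | (lip_dist phi psi < d%:E)%E]).
have FF : Filter F.
  apply: filter_from_filter; first by exists 1; exact: ltr01.
  move=> a b a0 b0; exists (Num.min a b); first by rewrite /= lt_min; apply/andP.
  by move=> psi /= h; split; apply: lt_le_trans h _; rewrite lee_fin ge_min lexx ?orbT.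
have cv : (@state_eval R G mu v0) @ F --> (state_eval phi : {ptws loop_alg mu v0 -> R[i]^o}).
  apply/cvg_sup => X A hA.
  pose W := initial_topology (@proj _ (fun _ : loop_alg mu v0 => R[i]^o) X).
  have : @nbhs W W (state_eval phi : W) A := hA.
  rewrite nbhsE => -[B [[C oC CB] Bphi] BA].
  have : nbhs (phi X : R[i]^o) C.
    by apply: open_nbhs_nbhs; split => //; move: Bphi; rewrite -CB.
  move=> /nbhs_ballP [[e e'] /=].
  rewrite ltcE /= => /andP[/eqP -> e0] hC.
  have e2 : 0 < e / 2 by rewrite divr_gt0.
  have [d d0 hd] := lip_eval_cvg phi X e2.
  exists d => //= psi hpsi; apply: BA; rewrite -CB; apply: hC.
  rewrite -ball_normE /= normc_def ltcR.
  apply: (@le_lt_trans _ _ (cabs (phi X - psi X))); first by rewrite /cabs; case: (_ - _).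
  apply: le_lt_trans (hd psi hpsi) _.
  by rewrite ltr_pdivrMr // ltr_pMr // ltr1n.
have [d d0 hd] : F ((@state_eval R G mu v0) @^-1` V).
  by apply: cv; apply: open_nbhs_nbhs; split.
by exists d => // psi hpsi; exact: hd.
Qed.

End Topology.

Theorem theoremA (R : realType) (G : ugraph) (mu : vert G -> R) (v0 : vert G)
  (hconn : connected_graph G) (hfin : locally_finite G)
  (hpos : forall v, 0 < mu v)
  (hmu0 : mu v0 = 1) (hmin : forall v, mu v0 <= mu v)
  (hsum : forall v, mu v < \sum_(e \in [set e : dedge G | src e = v]) mu (tgt e)) :
  [/\ (* L is a finite seminorm on A *)
      forall a, poly_algebra mu v0 a -> lip mu v0 a \is a fin_num,
      forall a b, poly_algebra mu v0 a -> poly_algebra mu v0 b ->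
        (lip mu v0 (a + b)%R <= lip mu v0 a + lip mu v0 b)%E,
      forall (k : R[i]) a, poly_algebra mu v0 a ->
        (lip mu v0 (k *: a)%R = (cabs k)%:E * lip mu v0 a)%E,
      (* its kernel is C 1_A, where 1_A = p_v0 *)
      forall a, poly_algebra mu v0 a ->
        (lip mu v0 a = 0%E <-> exists k : R[i], a = k *: fproj R v0)
    & (* it induces the weak-* topology on the state space *)
      forall U : set (state mu v0), lip_open U <-> wkstar_open U].
Proof.
rewrite poly_algebraE //; split.
- by move=> a ha; exact: lip_fin.
- by move=> a b ha hb; exact: lip_add.
- by move=> k a ha; exact: lip_scale.
- by move=> a ha; exact: lip_kernel.
- by move=> U; split; [exact: lip_open_wkstar|exact: wkstar_lip_open].
Qed.
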